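(* Let $m,n\ge 0$ be integers and let $x,y,z,t$ and $a_1,\dotsc,a_m,b_1,\dotsc,b_n$ be non-negative integers. Let $q$ be an indeterminate. (a) We have $$\sum_{\pi}q^{|\pi|}=\Phi^{q}_{x,y,z,t}(a_1,\dotsc,a_m;b_1,\dotsc,b_n),$$ where the sum is taken over all monotone stacks $\pi$ that fit in the augmented box corresponding to the region $P_{x,y,z,t}(a_1,\dotsc,a_m;b_1,\dotsc,b_n)$, and $|\pi|$ denotes the volume (number of unit cubes) of $\pi$. (b) We have $$\sum_{\pi}q^{|\pi|}=\Psi^{q}_{x,y,z,t}(a_1,\dotsc,a_m;b_1,\dotsc,b_n),$$ where the sum is taken over all monotone stacks $\pi$ that fit in the augmented box corresponding to the region $Q_{x,y,z,t}(a_1,\dotsc,a_m;b_1,\dotsc,b_n)$.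
   Context: Tilings. Consider the triangular lattice drawn so that one family of lattice lines is horizontal. A lozenge is the union of two unit triangles sharing an edge; a lozenge tiling of a lattice region is a covering of it by lozenges lying in it, with no gaps or overlaps. Side-lengths of a hexagon on this lattice are listed clockwise starting from the northwestern side (NW, N, NE, SE, S, SW). Notation. $o_a=a_1+a_3+a_5+\cdots$, $e_a=a_2+a_4+\cdots$, $o_b=b_1+b_3+b_5+\cdots$, $e_b=b_2+b_4+\cdots$, $a=a_1+a_2+\cdots$, $b=b_1+b_2+\cdots$. Ferns. A fern is a string of contiguous equilateral lattice triangles (lobes) of alternating orientations lined up along a common horizontal lattice line (the axis): consecutive lobes touch at a point of the axis, each lobe has one side on the axis, up-pointing lobes lie above the axis and down-pointing lobes lie below it. Lobes may have side-length $0$ (empty). The region $P_{x,y,z,t}(a_1,\dotsc,a_m;b_1,\dotsc,b_n)$. Start with the hexagon of side-lengths $x+y+o_a+o_b,\ z+e_a+e_b,\ y+t+o_a+o_b,\ x+y+e_a+e_b,\ z+o_a+o_b,\ y+t+e_a+e_b$. The axis is the horizontal lattice line that is $x$ units (lattice rows) above the western vertex and, equivalently, $t$ units above the eastern vertex. Along it remove two ferns: a left fern whose leftmost point is where the axis meets the northwestern side, with lobes of side-lengths $a_1,a_2,\dotsc,a_m$ from left to right, the lobe of side $a_i$ pointing up for $i$ odd and down for $i$ even; and a right fern whose rightmost point is where the axis meets the northeastern side, with lobes of side-lengths $b_1,\dotsc,b_n$ from right to left, the lobe of side $b_i$ pointing up for $i$ odd and down for $i$ even. (The distance between the two ferns is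 $y+z$.) The region $Q_{x,y,z,t}(a_1,\dotsc,a_m;b_1,\dotsc,b_n)$. Start with the hexagon of side-lengths $x+y+t+o_a+e_b,\ z+e_a+o_b,\ y+o_a+e_b,\ x+y+t+e_a+o_b,\ z+o_a+e_b,\ y+e_a+o_b$. The axis is the horizontal lattice line that is $x$ units above the western vertex and, equivalently, $t$ units below the eastern vertex. Along it remove a left fern whose leftmost point is where the axis meets the northwestern side, with lobes $a_1,\dotsc,a_m$ from left to right, the lobe of side $a_i$ pointing up for $i$ odd and down for $i$ even; and a right fern whose rightmost point is where the axis meets the southeastern side, with lobes $b_1,\dotsc,b_n$ from right to left, the lobe of side $b_i$ pointing down for $i$ odd and up for $i$ even. (The distance between the two ferns is again $y+z$.) Augmented boxes, monotone stacks and volume. View the triangular lattice as the orthogonal projection of the cubic lattice along its main diagonal, so that the three positive coordinate directions (the ''up'' directions) project to the directions of polar angles $0$, $2\pi/3$ and $-2\pi/3$. Let $R$ be one of the regions $P_{x,y,z,t}(a_1,\dotsc,a_m;b_1,\dotsc,b_n)$ or $Q_{x,y,z,t}(a_1,\dotsc,a_m;b_1,\dotsc,b_n)$. Each lozenge tiling $T$ of $R$ is the projection of a stepped surface $\Sigma_T$ made of unit lattice squares; the lifts are normalized so that the top left corner of the hexagon always lifts to the same vertex of the cubic lattice. All the surfaces $\Sigma_T$ then have the same boundary contour (a boundary point of $R$ where two lobes touch is to be regarded as several distinct boundary points, according to the side from which it is approached, which may lift to different points). Among these surfaces there is a lowest one $\Sigma_{\min}$ and a highest one $\Sigma_{\max}$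 (every $\Sigma_T$ lies weakly above $\Sigma_{\min}$ and weakly below $\Sigma_{\max}$). The augmented box corresponding to $R$ is the solid consisting of the unit cubes of the cubic lattice contained between $\Sigma_{\min}$ and $\Sigma_{\max}$. The monotone stacks fitting in this augmented box are the sets $\pi_T$ of unit cubes lying between $\Sigma_{\min}$ and $\Sigma_T$, where $T$ ranges over the lozenge tilings of $R$; the map $T\mapsto\pi_T$ is a bijection, and $|\pi_T|$ is the number of unit cubes in $\pi_T$. Adding one unit cube to a stack corresponds to changing the tiling inside a unit hexagon tiled by three lozenges to the other tiling of this unit hexagon, in such a way that the lozenge with sides of polar directions $0$ and $\pi/3$ moves from the lower position to the upper position. $q$-notation. $[n]_q=1+q+\cdots+q^{n-1}$, $[n]_q!=[1]_q[2]_q\cdots[n]_q$ (with $[0]_q!=1$), and $\operatorname{H}_q(n)=[0]_q!\,[1]_q!\,[2]_q!\cdots[n-1]_q!$ (so $\operatorname{H}_q(0)=1$). The function $s_q$. For a list of non-negative integers of odd length, $$s_q(c_1,\dots,c_{2r-1})=\frac{1}{\operatorname{H}_q(c_1+c_3+\cdots+c_{2r-1})}\cdot\frac{\prod_{1\le i\le j\le 2r-1,\ j-i+1\text{ odd}}\operatorname{H}_q(c_i+c_{i+1}+\cdots+c_j)}{\prod_{1\le i\le j\le 2r-1,\ j-i+1\text{ even}}\operatorname{H}_q(c_i+c_{i+1}+\cdots+c_j)}.$$ The functions $\Phi^q$ and $\Psi^q$. For lists of even lengths, $$\begin{aligned}\Phi^q_{x,y,z,t}&(a_1,\dotsc,a_{2l};b_1,\dotsc,b_{2k})=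 s_q(a_1,\dotsc,a_{2l-1},a_{2l}+y+z+b_{2k},b_{2k-1},\dotsc,b_1)\\&\times s_q(x,a_1,\dotsc,a_{2l},y+z,b_{2k},\dotsc,b_1,t)\\&\times\frac{\operatorname{H}_q(y)\operatorname{H}_q(z)\operatorname{H}_q(a+b+x+2y+z+t)}{\operatorname{H}_q(y+z)\operatorname{H}_q(a+b+x+2y+t)}\cdot\frac{\operatorname{H}_q(a+b+x+y+t)}{\operatorname{H}_q(a+b+x+y+z+t)}\\&\times\frac{\operatorname{H}_q(a+x+y)\operatorname{H}_q(b+y+t)}{\operatorname{H}_q(a+x)\operatorname{H}_q(b+t)}\cdot\frac{\operatorname{H}_q(e_a+e_b+x+t)\operatorname{H}_q(o_a+o_b)}{\operatorname{H}_q(e_a+e_b+x+y+t)\operatorname{H}_q(o_a+o_b+y)},\end{aligned}$$ $$\begin{aligned}\Psi^q_{x,y,z,t}&(a_1,\dotsc,a_{2l};b_1,\dotsc,b_{2k})= s_q(a_1,\dotsc,a_{2l-1},a_{2l}+y+z,b_{2k},\dotsc,b_1,t)\\&\times s_q(x,a_1,\dotsc,a_{2l},y+z+b_{2k},b_{2k-1},\dotsc,b_1)\\&\times\frac{\operatorname{H}_q(y)\operatorname{H}_q(z)\operatorname{H}_q(a+b+x+2y+z+t)}{\operatorname{H}_q(y+z)\operatorname{H}_q(a+b+x+2y+t)}\cdot\frac{\operatorname{H}_q(a+b+x+y+t)}{\operatorname{H}_q(a+b+x+y+z+t)}\\&\times\frac{\operatorname{H}_q(a+x+y)\operatorname{H}_q(b+y+t)}{\operatorname{H}_q(a+x)\operatorname{H}_q(b+t)}\cdot\frac{\operatorname{H}_q(e_a+o_b+x)\operatorname{H}_q(o_a+e_b+t)}{\operatorname{H}_q(e_a+o_b+x+y)\operatorname{H}_q(o_a+e_b+y+t)}.\end{aligned}$$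 If the list $a_1,\dotsc,a_m$ (respectively $b_1,\dotsc,b_n$) has odd length, $\Phi^q$ and $\Psi^q$ are defined by appending a $0$ at the end of that list; an empty list is read as the list $(0,0)$. *)

(* Defs.v *)
From HB Require Import structures.
From mathcomp Require Import all_boot all_order all_algebra.
From mathcomp Require Import fraction finmap.
From mathcomp Require Import boolp classical_sets functions cardinality fsbigop.

Set Implicit Arguments.
Unset Strict Implicit.
Unset Printing Implicit Defensive.

Import Order.TTheory GRing.Theory Num.Theory.

Local Open Scope classical_set_scope.
Local Open Scope ring_scope.

(* The pair (i, j) is the lattice point i *: u + j *: v, where u and v are the
   unit vectors of polar angles 0 and pi/3; thus j indexes horizontal lines. *)
Definition lattice_point : Type := (int * int)%type.

(* (true, (i, j)) and (false, (i, j)) are the up- and the down-pointing unit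
   triangle of the cell spanned by u and v at (i, j). *)
Definition triangle : Type := (bool * lattice_point)%type.

Definition vertices (tau : triangle) : seq lattice_point :=
  let: (up, (i, j)) := tau in
  if up then [:: (i, j); (i + 1, j); (i, j + 1)]
  else [:: (i + 1, j); (i, j + 1); (i + 1, j + 1)].

Definition share_edge (tau tau' : triangle) : bool :=
  (tau != tau') && (count (mem (vertices tau')) (vertices tau) == 2)%N.

(* A lozenge is identified with the set of the two unit triangles it covers. *)
Definition is_lozenge (l : set triangle) : Prop :=
  exists tau tau', share_edge tau tau' /\ l = [set tau; tau'].

Definition is_tiling (R : set triangle) (T : set (set triangle)) : Prop :=
  (forall l, T l -> is_lozenge l /\ l `<=` R) /\
  (forall tau, R tau -> exists! l, T l /\ l tau).

(* Closed hexagon with the given side-lengths, listed clockwise from the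
   northwestern side, with western vertex (0, 0).  Opposite sides are parallel,
   so it is an intersection of three strips: between NW and SE (direction v),
   between S and N (direction u), between SW and NE (direction u - v).  The
   side-lengths used below satisfy the closing conditions
   nw + sw = ne + se and n + ne = s + sw. *)
Definition in_hexagon (nw n ne se s sw : nat) (p : lattice_point) : bool :=
  let: (i, j) := p in
  [&& 0 <= i <= (n + ne)%:Z,
      - sw%:Z <= j <= nw%:Z &
      (nw + n)%:Z - (se + s)%:Z <= i + j <= (nw + n)%:Z].

(* The lobe (up, p, k) has side-length k; its side on the axis goes from
   abscissa p to abscissa p + k.  The axis is the line j = h. *)
Definition lobe : Type := (bool * int * nat)%type.

Definition in_lobe (h : int) (l : lobe) (w : lattice_point) : bool :=
  let: (up, p, k) := l in
  let: (i, j) := w in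
  if up then [&& p <= i, h <= j & i + j <= p + h + k%:Z]
  else [&& i <= p + k%:Z, j <= h & p + h <= i + j].

(* Lobes of side-lengths c listed from left to right, starting at abscissa p. *)
Fixpoint left_fern (up : bool) (p : int) (c : seq nat) : seq lobe :=
  if c is k :: c' then (up, p, k) :: left_fern (~~ up) (p + k%:Z) c' else [::].

(* Lobes of side-lengths c listed from right to left, starting at abscissa p. *)
Fixpoint right_fern (up : bool) (p : int) (c : seq nat) : seq lobe :=
  if c is k :: c' then
    (up, p - k%:Z, k) :: right_fern (~~ up) (p - k%:Z) c'
  else [::].

Record region := Region { cells : set triangle; top_left : lattice_point }.

Definition hexagon_minus_lobes (nw n ne se s sw h : nat) (ls : seq lobe) :
    region :=
  Region
    [set tau : triangle |
       all (in_hexagon nw n ne se s sw) (vertices tau) &&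
       ~~ has (fun l => all (in_lobe h%:Z l) (vertices tau)) ls]
    (0, nw%:Z).

(* o_c = c_1 + c_3 + ... and e_c = c_2 + c_4 + ...; nth counts from 0. *)
Definition odd_sum (c : seq nat) : nat :=
  (\sum_(i < size c | ~~ odd i) nth 0 c i)%N.
Definition even_sum (c : seq nat) : nat :=
  (\sum_(i < size c | odd i) nth 0 c i)%N.

(* The axis j = x meets the northeastern side i + j = nw + n at abscissa
   nw + n - x = a + b + y + z. *)
Definition regionP (x y z t : nat) (a b : seq nat) : region :=
  let oa := odd_sum a in let ea := even_sum a in
  let ob := odd_sum b in let eb := even_sum b in
  hexagon_minus_lobes
    (x + y + oa + ob) (z + ea + eb) (y + t + oa + ob)
    (x + y + ea + eb) (z + oa + ob) (y + t + ea + eb) x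
    (left_fern true 0 a
       ++ right_fern true (sumn a + sumn b + y + z)%N%:Z b).

(* The axis j = x meets the southeastern side i = n + ne at abscissa
   n + ne = a + b + y + z. *)
Definition regionQ (x y z t : nat) (a b : seq nat) : region :=
  let oa := odd_sum a in let ea := even_sum a in
  let ob := odd_sum b in let eb := even_sum b in
  hexagon_minus_lobes
    (x + y + t + oa + eb) (z + ea + ob) (y + oa + eb)
    (x + y + t + ea + ob) (z + oa + eb) (y + ea + ob) x
    (left_fern true 0 a
       ++ right_fern false (sumn a + sumn b + y + z)%N%:Z b).

(* Vertices of the cubic lattice. *)
Definition cubic_point : Type := 'rV[int]_3.

Definition axis_vec (k : 'I_3) : cubic_point := delta_mx 0 k.

(* Projection along the main diagonal: the three coordinate vectors go to u,
   v - u and - v, of polar angles 0, 2pi/3 and -2pi/3. *)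
Definition diag_proj (p : cubic_point) : lattice_point :=
  (p 0 0 - p 0 1, p 0 1 - p 0 ord_max).

(* Compares lattice points on a common line parallel to the main diagonal. *)
Definition height (p : cubic_point) : int := \sum_(k < 3) p 0 k.

(* A lifting assigns a cubic lattice point to each corner (tau, w), w a vertex
   of tau, and not just to w: two corners at w need only have the same lift if
   one can turn around w from one to the other inside the region.  This makes
   a point where two lobes touch count as several boundary points. *)
Definition lifting : Type := triangle -> lattice_point -> cubic_point.

Definition lozenge_side (T : set (set triangle)) (tau : triangle)
    (w w' : lattice_point) : Prop :=
  forall l tau', T l -> l tau -> l tau' ->
    w \in vertices tau' -> w' \in vertices tau' -> tau' = tau.

Definition is_lift (R : set triangle) (T : set (set triangle)) (L : lifting) :
    Prop :=
  [/\ (forall tau w, R tau -> w \in vertices tau -> diag_proj (L tau w) = w),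
      (forall tau tau' w, R tau -> R tau' -> share_edge tau tau' ->
         w \in vertices tau -> w \in vertices tau' -> L tau w = L tau' w) &
      (forall tau w w' k, R tau -> w \in vertices tau -> w' \in vertices tau ->
         w' = w + diag_proj (axis_vec k) -> lozenge_side T tau w w' ->
         L tau w' = L tau w + axis_vec k)].

Definition boundary_edge (R : set triangle) (tau : triangle)
    (w w' : lattice_point) : Prop :=
  [/\ R tau, w != w', w \in vertices tau, w' \in vertices tau &
      forall tau', R tau' -> w \in vertices tau' -> w' \in vertices tau' ->
        tau' = tau].

(* Lifts of all the tilings, normalized at the top left corner of the hexagon,
   and with the same boundary contour.  The last clause only adds to the second
   one in degenerate cases (such as y = z = 0), when the interior of the region
   is disconnected. *)
Definition normalized_lifts (R : region)
    (L : set (set triangle) -> lifting) : Prop :=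
  [/\ (forall T, is_tiling (cells R) T -> is_lift (cells R) T (L T)),
      (forall T T' tau tau', is_tiling (cells R) T -> is_tiling (cells R) T' ->
         cells R tau -> cells R tau' ->
         top_left R \in vertices tau -> top_left R \in vertices tau' ->
         L T tau (top_left R) = L T' tau' (top_left R)) &
      (forall T T' tau w w',
         is_tiling (cells R) T -> is_tiling (cells R) T' ->
         boundary_edge (cells R) tau w w' -> L T tau w = L T' tau w)].

(* The stacks below do not depend on the choice made by xget, except for
   translations along the main diagonal. *)
Definition surface (R : region) : set (set triangle) -> lifting :=
  xget (fun _ _ _ => 0) [set L | normalized_lifts R L].

Definition weakly_below (R : set triangle) (L L' : lifting) : Prop :=
  forall tau w, R tau -> w \in vertices tau ->
    height (L tau w) <= height (L' tau w).

Definition lowest_tiling (R : region) : set (set triangle) :=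
  xget set0
    [set T | is_tiling (cells R) T /\
             forall T', is_tiling (cells R) T' ->
               weakly_below (cells R) (surface R T) (surface R T')].

(* A unit cube is identified with its lowest vertex. *)
Definition cube : Type := cubic_point.

Definition cube_vertex (p : cube) (S : {set 'I_3}) : cubic_point :=
  p + \sum_(k in S) axis_vec k.

(* The cube p projects onto the unit hexagon centered at diag_proj p.  Over
   each of the six triangles of this hexagon both surfaces are flat, so that it
   is enough to compare them with the vertices of the cube. *)
Definition cube_between (R : set triangle) (lo hi : lifting) (p : cube) : Prop :=
  forall tau, diag_proj p \in vertices tau ->
    R tau /\
    forall S : {set 'I_3}, diag_proj (cube_vertex p S) \in vertices tau ->
      height (lo tau (diag_proj (cube_vertex p S))) <= height (cube_vertex p S)
        <= height (hi tau (diag_proj (cube_vertex p S))).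

Definition stack_of_tiling (R : region) (T : set (set triangle)) : set cube :=
  [set p | cube_between (cells R)
             (surface R (lowest_tiling R)) (surface R T) p].

Definition monotone_stacks (R : region) : set (set cube) :=
  [set stack_of_tiling R T | T in [set T | is_tiling (cells R) T]].

Definition volume (pi : set cube) : nat := #|` fset_set pi |.

Section QFunctions.

Variables (F : fieldType) (q : F).

Definition qint (n : nat) : F := \sum_(i < n) q ^+ i.
Definition qfact (n : nat) : F := \prod_(i < n) qint i.+1.
Definition qH (n : nat) : F := \prod_(i < n) qfact i.

Definition segment_sum (c : seq nat) (i j : nat) : nat :=
  (\sum_(i <= k < j.+1) nth 0 c k)%N.

Definition qs (c : seq nat) : F :=
  (qH (odd_sum c))^-1 *
  ((\prod_(i < size c) \prod_(j < size c | (i <= j)%N && odd (j - i + 1))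
      qH (segment_sum c i j)) /
   (\prod_(i < size c) \prod_(j < size c | (i <= j)%N && ~~ odd (j - i + 1))
      qH (segment_sum c i j))).

Definition all_but_last (c : seq nat) : seq nat := take (size c).-1 c.

Definition Phi_even (x y z t : nat) (a b : seq nat) : F :=
  let sa := sumn a in let sb := sumn b in
  let oa := odd_sum a in let ea := even_sum a in
  let ob := odd_sum b in let eb := even_sum b in
  qs (all_but_last a
        ++ (last 0%N a + y + z + last 0%N b)%N :: rev (all_but_last b)) *
  qs (x :: a ++ (y + z)%N :: rcons (rev b) t) *
  (qH y * qH z * qH (sa + sb + x + 2 * y + z + t) /
   (qH (y + z) * qH (sa + sb + x + 2 * y + t))) *
  (qH (sa + sb + x + y + t) / qH (sa + sb + x + y + z + t)) *
  (qH (sa + x + y) * qH (sb + y + t) / (qH (sa + x) * qH (sb + t))) *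
  (qH (ea + eb + x + t) * qH (oa + ob) /
   (qH (ea + eb + x + y + t) * qH (oa + ob + y))).

Definition Psi_even (x y z t : nat) (a b : seq nat) : F :=
  let sa := sumn a in let sb := sumn b in
  let oa := odd_sum a in let ea := even_sum a in
  let ob := odd_sum b in let eb := even_sum b in
  qs (all_but_last a ++ (last 0%N a + y + z)%N :: rcons (rev b) t) *
  qs (x :: a ++ (y + z + last 0%N b)%N :: rev (all_but_last b)) *
  (qH y * qH z * qH (sa + sb + x + 2 * y + z + t) /
   (qH (y + z) * qH (sa + sb + x + 2 * y + t))) *
  (qH (sa + sb + x + y + t) / qH (sa + sb + x + y + z + t)) *
  (qH (sa + x + y) * qH (sb + y + t) / (qH (sa + x) * qH (sb + t))) *
  (qH (ea + ob + x) * qH (oa + eb + t) /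
   (qH (ea + ob + x + y) * qH (oa + eb + y + t))).

Definition pad_even (c : seq nat) : seq nat :=
  if c is [::] then [:: 0; 0]%N else if odd (size c) then rcons c 0%N else c.

Definition Phi (x y z t : nat) (a b : seq nat) : F :=
  Phi_even x y z t (pad_even a) (pad_even b).

Definition Psi (x y z t : nat) (a b : seq nat) : F :=
  Psi_even x y z t (pad_even a) (pad_even b).

End QFunctions.

(* The indeterminate q, in the field of rational functions over the integers. *)
Definition qvar : {fraction {poly int}} := tofrac ('X : {poly int}).

(* Main.v *)
(* Cut the region along the axis.  The positions U of the lozenges crossing the
   axis between the two ferns, together with the lobes, determine the bottom row
   of each half, and a tiling of a half amounts to a Gelfand-Tsetlin pattern over
   this row: the rows of the pattern record the lozenges with a horizontal
   diagonal.  Adding a unit cube moves one such lozenge (one crossing the axis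
   counted once) by one unit, so the volume is, up to a constant, the sum of all
   positions.  The patterns over a row c, weighted by q to the sum of positions,
   add up to the product of the q^(c_j) - q^(c_i), up to a factor depending only
   on the size of c; hence the generating function is a discrete Selberg sum over
   U, with L positions to the left and R to the right of the gap.  Expanding one
   of its two Vandermonde factors by interlacing relates the sum for (L, R, y) to
   the one for (L + 1, R + 1, y - 1), which evaluates it.  All identities are
   taken up to powers of q and q - 1; both sides of the theorem have nonzero
   values at 0 and 1, and the closed form has value 1 at 0, which removes the
   ambiguity. *)

Require Import Defs.
From mathcomp Require Import all_boot all_order all_fingroup all_algebra.
From mathcomp Require Import fraction finmap.
From mathcomp Require Import boolp classical_sets functions cardinality fsbigop.
From mathcomp Require Import zify ring.

Set Implicit Arguments.
Unset Strict Implicit.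
Unset Printing Implicit Defensive.

Import Order.TTheory GRing.Theory Num.Theory.

(** * Interlacing patterns *)

Section InterlacingLists.

(** The surfaces and the lowest tiling are only given by choice, so nothing can be computed from
    them directly. Height functions are the go-between: they are the counting functions of the rows
    of a pattern and also, up to sign and a fixed shift, the second coordinate of an explicit lift.
    At each corner of the region, any normalised lift differs in height from the explicit one by an
    amount that is the same for all tilings. Height functions are closed under pointwise maximum,
    which yields the lowest surface, and a stack is a union of columns whose lengths are differences
    of height functions.

    A lobe removed from one half leaves its base free in the other, so outside of the gap the dents
    of the two halves together fill the axis. This is why the two Vandermonde products combine into
    a single sum that depends on the ferns only through the lengths L and R. Its recursion ends at y
    = 0, with the product of two blocks.

    No tiling is ever exhibited: that one exists follows from the closed form being non-zero. *)

Lemma in_nth (P : pred nat) (c : seq nat) :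
  (forall r, r < size c -> P (nth 0 c r)) -> {in c, forall a, P a}.
Proof. by move=> h a /(nthP 0)[r rc <-]; exact: h. Qed.

Definition cnt (c : seq nat) (i : nat) : nat := count (fun a => a < i) c.

Lemma ltn_cnt (c : seq nat) (r i : nat) : sorted ltn c ->
  (r < cnt c i) = (r < size c) && (nth 0 c r < i).
Proof.
rewrite /cnt; elim: c r => [|a c IH] r //= pac.
have sc := path_sorted pac; case: r => [|r] /=.
  case: (ltnP a i) => //= ai; rewrite add0n.
  rewrite -has_count; apply/hasPn => b bc /=.
  by have := allP (order_path_min ltn_trans pac) _ bc; lia.
case: (ltnP a i) => ai /=; first by rewrite add1n ltnS IH.
rewrite add0n ltnS.
have -> : count (fun b => b < i) c = 0.
  apply/eqP; rewrite -leqn0 leqNgt -has_count; apply/hasPn => b bc.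
  by have := allP (order_path_min ltn_trans pac) _ bc; lia.
case: (ltnP r (size c)) => //= rc.
by have /= := allP (order_path_min ltn_trans pac) _ (mem_nth 0 rc); lia.
Qed.

Lemma cnt_cat (c d : seq nat) i : cnt (c ++ d) i = cnt c i + cnt d i.
Proof. exact: count_cat. Qed.

Lemma cnt_all (c : seq nat) i : {in c, forall a, a < i} -> cnt c i = size c.
Proof. by move=> h; apply/eqP; rewrite -all_count; apply/allP. Qed.

Lemma cnt_none (c : seq nat) i : {in c, forall a, i <= a} -> cnt c i = 0.
Proof.
move=> h; apply/eqP; rewrite -leqn0 leqNgt -has_count; apply/hasPn => b bc.
by have := h _ bc; lia.
Qed.

Lemma cntS (c : seq nat) (i : nat) : uniq c ->
  cnt c i.+1 = cnt c i + (i \in c).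
Proof.
elim: c => [|a c IH] //= /andP[ac uc]; rewrite /cnt /= -/(cnt c i) -/(cnt c i.+1).
rewrite IH // inE; case: eqP => [->|] /=; last by lia.
by rewrite (negbTE ac); lia.
Qed.

Lemma sorted_ltn_uniq (c : seq nat) : sorted ltn c -> uniq c.
Proof. exact/sorted_uniq/ltnn/ltn_trans. Qed.

(** Double counting: an entry [a] is smaller than exactly [W - a] of the indices up to [W]. This
    turns sums of heights into sums of positions. *)
Lemma sum_cnt (c : seq nat) (W : nat) : {in c, forall a, a <= W} ->
  \sum_(0 <= i < W.+1) cnt c i + sumn c = W * size c.
Proof.
elim: c => [|a c IH] h /=.
  by rewrite big1_seq ?muln0.
under eq_bigr => i _ do rewrite /cnt /= -/(cnt c i).
rewrite big_split /= mulnS -IH; last first.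
  by move=> b bc; apply: h; rewrite inE bc orbT.
have aW : a <= W by apply: h; rewrite inE eqxx.
suff : \sum_(0 <= i < W.+1) (a < i)%N + a = W by lia.
rewrite (big_cat_nat (n := a.+1)) //= ?ltnS //.
rewrite big1_seq; last by move=> i; rewrite mem_index_iota; lia.
rewrite (@eq_big_nat _ _ _ _ _ _ (fun=> 1%N)); last by lia.
by rewrite sum_nat_const_nat; lia.
Qed.

Lemma cnt_inj (c d : seq nat) : sorted ltn c -> sorted ltn d ->
  (forall i, cnt c i = cnt d i) -> c = d.
Proof.
move=> sc sd e; apply: (irr_sorted_eq ltn_trans ltnn) => // i.
have := e i.+1; rewrite !cntS ?sorted_ltn_uniq // e.
by case: (i \in c); case: (i \in d) => //; lia.
Qed.

(** The intervals are half-open because rows use slanted coordinates: at a fixed abscissa, the next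
    row lies half a unit further to the right. An entry may thus repeat its left neighbour of the
    row before, but not its right one. *)
Fixpoint interl (c : seq nat) : seq (seq nat) :=
  if c is a :: c' then
    if c' is b :: _ then [seq d :: ds | d <- iota a (b - a), ds <- interl c']
    else [:: [::]]
  else [:: [::]].

Lemma interlP (c d : seq nat) :
  reflect (size d = (size c).-1 /\
           forall r, r < size d -> nth 0 c r <= nth 0 d r < nth 0 c r.+1)
          (d \in interl c).
Proof.
elim: c d => [|a [|b c] IH] d.
- by rewrite inE; apply: (iffP eqP) => [->|[/size0nil]].
- by rewrite inE; apply: (iffP eqP) => [->|[/size0nil]].
apply: (iffP allpairsP) => [[[x ds] /= [xi dsi ->]]|[]].
  have [sds hds] := IH _ dsi; split=> /=; first by rewrite sds.
  by move: xi; rewrite mem_iota => xi [|r] //=; [lia|apply: hds].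
case: d => [|x ds] //= [sds] h; exists (x, ds); split => //=.
  by have := h 0 isT; rewrite mem_iota /=; lia.
by apply/IH; split => // r rs; apply: (h r.+1).
Qed.

Lemma interl_uniq (c : seq nat) : uniq (interl c).
Proof.
elim: c => [|a [|b c] IH] //=.
apply: allpairs_uniq; rewrite ?iota_uniq //.
by move=> [x s] [x' s'] _ _ /= [-> ->].
Qed.

Lemma interl_sorted (c d : seq nat) : d \in interl c -> sorted ltn d.
Proof.
case/interlP => _ h; apply/(sortedP 0) => r rd.
have := h r (ltnW rd); have := h r.+1 rd; lia.
Qed.

(** In terms of counting functions, interlacing becomes the two local conditions [hf_vert] and
    [hf_diag] of a height function; [cnt_interl] is the converse. *)
Lemma interl_cnt (c d : seq nat) (i : nat) : sorted ltn c -> d \in interl c ->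
  cnt d i <= cnt c i <= (cnt d i).+1 /\ cnt d i <= cnt c i.+1 <= (cnt d i).+1.
Proof.
move=> sc dc; have sd := interl_sorted dc; case/interlP: dc => szd h.
have le m n : (forall r, r < m -> r < n) -> m <= n.
  by move=> hr; rewrite leqNgt; apply/negP => /hr; rewrite ltnn.
have le1 m n : (forall r, r.+1 < m -> r < n) -> m <= n.+1.
  by case: m => // m hr; rewrite ltnS; apply: le => r; exact: hr.
have hd r j : r < cnt d j -> r < size d /\ nth 0 d r < j.
  by rewrite ltn_cnt // => /andP.
have hc r j : r < cnt c j -> r < size c /\ nth 0 c r < j.
  by rewrite ltn_cnt // => /andP.
split; apply/andP; split.
- apply: le => r /hd[rd di]; rewrite ltn_cnt //; have := h r rd; lia.
- apply: le1 => r /hc[rc ci]; rewrite ltn_cnt // szd.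
  have rd : r < size d by lia.
  have := h r rd; lia.
- apply: le => r /hd[rd di]; rewrite ltn_cnt //; have := h r rd; lia.
- apply: le1 => r /hc[rc ci]; rewrite ltn_cnt // szd.
  have rd : r < size d by lia.
  have := h r rd; lia.
Qed.

Lemma cnt_interl (c d : seq nat) : sorted ltn c -> sorted ltn d ->
  size d = (size c).-1 ->
  (forall i, cnt d i <= cnt c i) -> (forall i, cnt c i.+1 <= (cnt d i).+1) ->
  d \in interl c.
Proof.
move=> sc sd szd h1 h2; apply/interlP; split => // r rd.
apply/andP; split.
  have : r < cnt c (nth 0 d r).+1.
    by apply: leq_trans (h1 _); rewrite ltn_cnt // rd /=.
  by rewrite ltn_cnt // => /andP[].
have : r.+1 < cnt c (nth 0 c r.+1).+1.
  by rewrite ltn_cnt // ltnS leqnn andbT; lia.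
move/leq_trans => /(_ _ (h2 _)); rewrite ltnS ltn_cnt // => /andP[].
by [].
Qed.

(** The starting row [c] is left out, as it is known from [U] and the dents. For [n = size c] the
    last row is empty. *)
Fixpoint pats (n : nat) (c : seq nat) : seq (seq (seq nat)) :=
  if n is m.+1 then [seq d :: p | d <- interl c, p <- pats m d] else [:: [::]].

Lemma patsP (n : nat) (c : seq nat) (p : seq (seq nat)) :
  reflect (size p = n /\
           forall r, r < n -> nth [::] p r \in interl (nth [::] (c :: p) r))
          (p \in pats n c).
Proof.
elim: n c p => [|n IH] c p /=.
  by rewrite inE; apply: (iffP eqP) => [->|[/size0nil]].
apply: (iffP allpairsPdep) => [[d [p' [dc /IH[sp hp] ->]]]|[]].
  by split => [|[|r] rn] //=; [rewrite sp|apply: hp].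
case: p => // d p' /= [sp] h; exists d, p'; split => //; first exact: (h 0).
by apply/IH; split => // r rn; apply: (h r.+1).
Qed.

Lemma pats_uniq (n : nat) (c : seq nat) : uniq (pats n c).
Proof.
elim: n c => [|n IH] c //=; apply: allpairs_uniq_dep; rewrite ?interl_uniq //.
by move=> [x s] [x' s'] _ _ /= [<- <-].
Qed.

Lemma pats_size (n : nat) (c : seq nat) (p : seq (seq nat)) (r : nat) :
  p \in pats n c -> r <= n -> size (nth [::] (c :: p) r) = size c - r.
Proof.
move=> /patsP[sp h]; elim: r => [|r IH] rn; first by rewrite subn0.
by case/interlP: (h r rn) => /= -> _; rewrite IH; lia.
Qed.

Lemma pats_sorted (n : nat) (c : seq nat) (p : seq (seq nat)) (r : nat) :
  sorted ltn c -> p \in pats n c -> sorted ltn (nth [::] (c :: p) r).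
Proof.
move=> sc /patsP[sp h]; case: r => [|r] //=.
case: (ltnP r n) => rn; first exact: interl_sorted (h r rn).
by rewrite nth_default ?sp.
Qed.

Fixpoint ksub (lo m k : nat) : seq (seq nat) :=
  if k is k'.+1 then
    if m is m'.+1 then
      [seq lo :: s | s <- ksub lo.+1 m' k'] ++ ksub lo.+1 m' k
    else [::]
  else [:: [::]].

Lemma ksubP (lo m k : nat) (s : seq nat) :
  reflect [/\ sorted ltn s, size s = k & {in s, forall a, lo <= a < lo + m}]
          (s \in ksub lo m k).
Proof.
elim: m lo k s => [|m IH] lo [|k] s /=.
- by rewrite inE; apply: (iffP eqP) => [->|[_ /size0nil]].
- constructor => -[_]; case: s => // a s _ /(_ a); rewrite inE eqxx; lia.
- by rewrite inE; apply: (iffP eqP) => [->|[_ /size0nil]].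
rewrite mem_cat; apply: (iffP orP) => [[]|[]].
- case/mapP => s' /IH[ss sz h] ->; split => /=; last 1 first.
  + by move=> a; rewrite inE => /orP[/eqP->|/h]; lia.
  + rewrite path_sortedE //; last exact: ltn_trans.
    by rewrite ss andbT; apply/allP => a /h /=; lia.
  + by rewrite sz.
- case/IH => ss sz h; split => // a /h; lia.
case: s => // a s /= pas [sz] h; case: (eqVneq a lo) => [->|alo].
  left; apply/mapP; exists s => //; apply/IH; split=> //.
    exact: path_sorted pas.
  move=> b bs; have := allP (order_path_min ltn_trans pas) _ bs.
  have := h b; have := h a; rewrite !inE bs eqxx orbT /=; lia.
right; apply/IH; split => //=; first by rewrite sz.
move=> b; rewrite inE => bs; have := h b; have := h a; rewrite !inE eqxx /= bs.
case/orP: bs => [/eqP->|bs]; first lia.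
have := allP (order_path_min ltn_trans pas) _ bs; lia.
Qed.

Lemma ksub_uniq (lo m k : nat) : uniq (ksub lo m k).
Proof.
elim: m lo k => [|m IH] lo [|k] //=.
rewrite cat_uniq IH map_inj_uniq ?IH ?andbT /=; last by move=> ? ? [].
apply/hasPn => s /ksubP[_ _ h]; apply/negP => /mapP[s' _ es].
have := h lo; rewrite es inE eqxx; lia.
Qed.

End InterlacingLists.

(** * Height functions *)

(* The two halves of the region, each seen as lying above the axis (the lower
   one after a reflection), are indexed by a boolean.  Half [s] is a trapezoid
   with base from [lo s] to [hi s] on the line of the axis, minus the lobes with
   bases [lob s], given as pairs (left end, length).  Where a half widens away
   from the axis, the trapezoid sticks out of it by one more lobe, beyond the end
   of the axis.  The unit segments of these bases are the dents, [Bl s] on the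
   left and [Br s] on the right of the gap between the ferns, which extends from
   [ml] to [mr] and where [nfree] lozenges cross the axis. *)
Record halves := Halves {
  lo : bool -> nat;
  hi : bool -> nat;
  ml : nat;
  mr : nat;
  nfree : nat;
  Bl : bool -> seq nat;
  Br : bool -> seq nat;
  lob : bool -> seq (nat * nat) }.

Section HeightFunctions.

Variable D : halves.

Definition dents (s : bool) : seq nat := Bl D s ++ Br D s.
Definition rows (s : bool) : nat := size (dents s) + nfree D.
Definition inl (s : bool) (i l : nat) : bool :=
  has (fun pk => (pk.1 <= i) && (i + l <= pk.1 + pk.2)) (lob D s).

Record wf_halves : Prop := WfHalves {
  wf_lo : forall s, lo D s <= ml D;
  wf_mid : ml D + nfree D <= mr D;
  wf_hi : forall s, mr D <= hi D s;
  wf_sBl : forall s, sorted ltn (Bl D s);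
  wf_sBr : forall s, sorted ltn (Br D s);
  wf_Bl : forall s, {in Bl D s, forall i, lo D s <= i < ml D};
  wf_Br : forall s, {in Br D s, forall i, mr D <= i < hi D s};
  wf_lob : forall s i, inl s i 1 = (i \in dents s);
  wf_cover : forall i, (forall s, (lo D s <= i < hi D s) && (i \notin dents s)) ->
    ml D <= i < mr D }.

Hypothesis wf : wf_halves.

Let N := rows.

Definition cntB (s : bool) (i : nat) : nat := cnt (dents s) i.

(* [h s r i] counts the lozenges with a horizontal diagonal (dents included, for
   [r = 0]) centered on row [r] of half [s] and to the left of abscissa [i]. *)
Record isHF (h : bool -> nat -> nat -> nat) : Prop := IsHF {
  hf_left : forall s i, i <= ml D -> h s 0 i = cntB s i;
  hf_right : forall s i, mr D <= i -> h s 0 i = cntB s i + nfree D;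
  hf_axis : forall i, h true 0 i + cntB false i = h false 0 i + cntB true i;
  hf_horiz : forall s r i, h s r i <= h s r i.+1 <= (h s r i).+1;
  hf_vert : forall s r i, r < N s -> h s r.+1 i <= h s r i <= (h s r.+1 i).+1;
  hf_diag : forall s r i, r < N s ->
    h s r.+1 i <= h s r i.+1 <= (h s r.+1 i).+1;
  hf_top : forall s r i, N s <= r -> h s r i = 0 }.

(** Every condition fixes a value, fixes a difference or bounds one, and all of these survive a
    maximum. As heights enter the surface with a minus sign, the largest height function gives the
    lowest surface. *)
Lemma hf_max (h h' : bool -> nat -> nat -> nat) : isHF h -> isHF h' ->
  isHF (fun s r i => maxn (h s r i) (h' s r i)).
Proof.
move=> H H'; split.
- by move=> s i il; rewrite (hf_left H) // (hf_left H') // maxnn.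
- by move=> s i il; rewrite (hf_right H) // (hf_right H') // maxnn.
- by move=> i; have := hf_axis H i; have := hf_axis H' i; lia.
- by move=> s r i; have := hf_horiz H s r i; have := hf_horiz H' s r i; lia.
- by move=> s r i rN; have := hf_vert H i rN; have := hf_vert H' i rN; lia.
- by move=> s r i rN; have := hf_diag H i rN; have := hf_diag H' i rN; lia.
- by move=> s r i rN; rewrite (hf_top H) // (hf_top H').
Qed.

Lemma inl_sub s i l i' l' : i <= i' -> i' + l' <= i + l -> inl s i l ->
  inl s i' l'.
Proof.
move=> h1 h2 /hasP[pk hpk h]; apply/hasP; exists pk => //; lia.
Qed.

Lemma dents_uniq s : uniq (dents s).
Proof.
rewrite cat_uniq !sorted_ltn_uniq ?(wf_sBl wf) ?(wf_sBr wf) // andbT /=.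
apply/hasPn => i /(wf_Br wf) h; apply/negP => /(wf_Bl wf).
have := wf_mid wf; lia.
Qed.

Lemma dents_out s i : i \in dents s -> i < ml D \/ mr D <= i.
Proof. by rewrite mem_cat => /orP[/(wf_Bl wf)|/(wf_Br wf)]; lia. Qed.

Lemma dents_base s i : i \in dents s -> lo D s <= i < hi D s.
Proof.
have := wf_lo wf s; have := wf_mid wf; have := wf_hi wf s.
by rewrite mem_cat => ? ? ? /orP[/(wf_Bl wf)|/(wf_Br wf)]; lia.
Qed.

Lemma rows_base s : N s + lo D s <= hi D s.
Proof.
have szl : size (Bl D s) + lo D s <= ml D.
  have : size (Bl D s) <= size (iota (lo D s) (ml D - lo D s)).
    apply: uniq_leq_size; first exact/sorted_ltn_uniq/(wf_sBl wf).
    by move=> i /(wf_Bl wf); rewrite mem_iota; lia.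
  by rewrite size_iota; have := wf_lo wf s; lia.
have szr : size (Br D s) + mr D <= hi D s.
  have : size (Br D s) <= size (iota (mr D) (hi D s - mr D)).
    apply: uniq_leq_size; first exact/sorted_ltn_uniq/(wf_sBr wf).
    by move=> i /(wf_Br wf); rewrite mem_iota; lia.
  by rewrite size_iota; have := wf_hi wf s; lia.
by rewrite /N /rows size_cat; have := wf_mid wf; lia.
Qed.

Lemma cntBS s i : cntB s i.+1 = cntB s i + (i \in dents s).
Proof. exact/cntS/dents_uniq. Qed.

Lemma cntB_lo s i : i <= lo D s -> cntB s i = 0.
Proof. by move=> il; apply: cnt_none => a /dents_base; lia. Qed.

Lemma cntB_hi s i : hi D s <= i -> cntB s i = size (dents s).
Proof. by move=> il; apply: cnt_all => a /dents_base; lia. Qed.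

Lemma cntB_mid s i : ml D <= i <= mr D -> cntB s i = size (Bl D s).
Proof.
move=> im; rewrite /cntB cnt_cat cnt_all ?cnt_none ?addn0 //.
  by move=> a /(wf_Br wf); lia.
by move=> a /(wf_Bl wf); lia.
Qed.

Section OneHeightFunction.

Variable h : bool -> nat -> nat -> nat.
Hypothesis H : isHF h.

Lemma hf_le0 s r i : h s r i <= h s 0 i.
Proof.
elim: r => // r IH; case: (ltnP r (N s)) => rN.
  by have := hf_vert H i rN; lia.
by rewrite (hf_top H) // ltnW.
Qed.

Lemma hf_bound s r i : h s r i <= N s - r.
Proof.
case: (ltnP (N s) r) => rN; first by rewrite (hf_top H) // ltnW.
have -> : r = N s - (N s - r) by lia.
elim: (N s - r) (leq_subr r (N s)) => [|k IH] kN.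
  by rewrite subn0 (hf_top H).
have := IH (ltnW kN); have lt : N s - k.+1 < N s by lia.
have := hf_vert H i lt; rewrite (_ : (N s - k.+1).+1 = N s - k); lia.
Qed.

Lemma hf_diag0 s r i : r <= N s -> h s 0 (i + r) <= h s r i + r.
Proof.
elim: r i => [|r IH] i rN; first by rewrite !addn0.
by have := IH i.+1 (ltnW rN); have := hf_diag H i rN; rewrite addSnnS; lia.
Qed.

Lemma hf_lo s r i : i <= lo D s -> h s r i = 0.
Proof.
move=> il; apply/eqP; rewrite -leqn0; apply: leq_trans (hf_le0 s r i) _.
by rewrite (hf_left H) ?cntB_lo //; have := wf_lo wf s; lia.
Qed.

Lemma hf_hi s r i : r <= N s -> hi D s <= i + r -> h s r i = N s - r.
Proof.
move=> rN ih; have := hf_bound s r i; have := hf_diag0 i rN.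
rewrite (hf_right H); last by have := wf_hi wf s; lia.
by rewrite cntB_hi // -/(rows s) -/(N s); lia.
Qed.

Lemma hf_dent s i : i \in dents s -> h s 0 i.+1 = (h s 0 i).+1.
Proof.
move=> ib; case: (dents_out ib) => io.
  by rewrite !(hf_left H) ?cntBS ?ib ?addn1 //; lia.
by rewrite !(hf_right H) ?cntBS ?ib ?addn1 ?addSn //; lia.
Qed.

Lemma hf_nodent s i : i \notin dents s -> i < ml D \/ mr D <= i ->
  h s 0 i.+1 = h s 0 i.
Proof.
move=> /negbTE ib [] io.
  by rewrite !(hf_left H) ?cntBS ?ib ?addn0 //; lia.
by rewrite !(hf_right H) ?cntBS ?ib ?addn0 //; lia.
Qed.

Lemma hf_lobe_axis s i l : inl s i l -> h s 0 (i + l) = h s 0 i + l.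
Proof.
elim: l => [|l IH] il; first by rewrite !addn0.
rewrite !addnS hf_dent ?IH //; first by apply: inl_sub il; lia.
by rewrite -(wf_lob wf); apply: inl_sub il; lia.
Qed.

(** A lobe is frozen: the axis height grows by [r] from [i] to [i + r], while [hf_diag0] lets it
    exceed the value at the apex by at most [r], so that value cannot be below the one at [i]. *)
Lemma hf_lobe s r i : inl s i r -> h s r i = h s 0 i.
Proof.
move=> il; have e := hf_lobe_axis il.
have b := hf_bound s 0 (i + r); have rN : r <= N s by lia.
have := hf_diag0 i rN; have := hf_le0 s r i; lia.
Qed.

End OneHeightFunction.

(** The point of abscissa [i] in row [r] is the apex of the triangle based on the axis from [i] to
    [i + r], whence [inl s i r]. A point of the axis is surrounded by cells only if neither half is
    empty. *)
Definition interior (s : bool) (r i : nat) : bool :=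
  if r is 0 then [&& ml D < i, i < mr D, 0 < N true & 0 < N false]
  else [&& lo D s < i, i + r < hi D s, r < N s & ~~ inl s i r].

(** Elsewhere the value is forced by the dents, an end of the row, the top or a lobe. This is the
    source of the common boundary contour. *)
Lemma hf_fixed h h' s r i : isHF h -> isHF h' -> r <= N s ->
  ~~ interior s r i -> h s r i = h' s r i.
Proof.
move=> H H' rN.
have ax s' j : ~~ interior s' 0 j -> h s' 0 j = h' s' 0 j.
  rewrite /= !negb_and -!leqNgt => /or4P[jl|jr|t0|f0].
  - by rewrite (hf_left H) // (hf_left H').
  - by rewrite (hf_right H) // (hf_right H').
  (* An empty half has height 0 on the axis, and [hf_axis] then determines the other half there. *)
  - have := hf_axis H j; have := hf_axis H' j.
    have := hf_top H j t0; have := hf_top H' j t0; case: s'; lia.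
  - have := hf_axis H j; have := hf_axis H' j.
    have := hf_top H j f0; have := hf_top H' j f0; case: s'; lia.
case: r rN => [|r] rN; first exact: ax.
rewrite /= !negb_and -!leqNgt negbK => /or4P[il|ih|rt|il].
- by rewrite !hf_lo.
- by rewrite !hf_hi.
- by rewrite (hf_top H) // (hf_top H').
- rewrite (hf_lobe H) // (hf_lobe H') //.
  apply: ax; apply/negP => /= /and4P[h1 h2 _ _].
  have : i \in dents s by rewrite -(wf_lob wf); apply: inl_sub il; lia.
  by case/dents_out; lia.
Qed.

(* The cell (s, up, r, i) is the unit triangle whose horizontal side is the
   segment from i to i + 1 of row r (if [up]), or of row r + 1 (otherwise).
   The smallest triangle which contains it and has its base on the axis has base
   from i to i + [clen up r]. *)
Definition clen (up : bool) (r : nat) : nat := r + (if up then 1 else 2).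

Definition inR (s up : bool) (r i : nat) : bool :=
  [&& lo D s <= i, i + clen up r <= hi D s, r < N s & ~~ inl s i (clen up r)].

Section Crossings.

Variable h : bool -> nat -> nat -> nat.
Hypothesis H : isHF h.

(** The lemmas of this section keep the cell matched with a given one, as read off the heights,
    inside the region. The suffixes [V], [L], [R] stand for the neighbour across the horizontal
    side, to the left and to the right. *)
Lemma cross_axis s i : inR s true 0 i -> h s 0 i.+1 = (h s 0 i).+1 ->
  inR (~~ s) true 0 i.
Proof.
rewrite /inR /clen add0n => /and4P[h1 h2 h3 h4] e.
have ib : i \notin dents s by rewrite -(wf_lob wf).
have im : ml D <= i < mr D.
  case: (ltnP i (ml D)) => io.
    by have := hf_nodent H ib (or_introl io); lia.
  by case: (ltnP i (mr D)) => // io'; have := hf_nodent H ib (or_intror io'); lia.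
have ib' s' : i \notin dents s'.
  by apply/negP => /dents_out; lia.
rewrite (wf_lob wf) ib' andbT.
have := wf_lo wf (~~ s); have := wf_hi wf (~~ s) => w1 w2.
apply/and3P; split; [lia|lia|].
(* If the opposite half had no rows, its height on the axis would vanish, and [hf_axis] would
   exclude a step at [i]. *)
rewrite lt0n; apply/negP => /eqP n0.
have := hf_axis H i; have := hf_axis H i.+1; rewrite !cntBS.
rewrite (negbTE (ib' true)) (negbTE (ib' false)) !addn0.
have t0 := hf_top H (s := ~~ s) (r := 0); rewrite n0 in t0.
by case: s e t0 {h1 h2 h3 h4 ib w1 w2 n0} => /= e t0; rewrite !t0 //; lia.
Qed.

Lemma cross_upV s r i : inR s true r.+1 i ->  inR s false r i.
Proof. by rewrite /inR /clen addn2 addn1 => /and4P[-> -> rN ->]; rewrite (ltnW rN). Qed.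

Lemma cross_upL s r i : inR s true r i -> h s r i = (h s r.+1 i).+1 ->
  exists2 i', i = i'.+1 & inR s false r i'.
Proof.
rewrite /inR /clen => /and4P[h1 h2 h3 h4] e.
have il : lo D s < i.
  by rewrite ltnNge; apply/negP => il; rewrite (hf_lo H) in e.
case: i il {h1} h2 h4 e => // i il h2 h4 e; exists i => //.
apply/and4P; split => //; [lia|].
by apply: contra h4; apply: inl_sub; lia.
Qed.

Lemma cross_upR s r i : inR s true r i -> h s r i.+1 = h s r.+1 i ->
  inR s false r i.
Proof.
rewrite /inR /clen => /and4P[h1 h2 h3 h4] e.
apply/and4P; split => //.
  rewrite leqNgt; apply/negP => ih.
  have := hf_hi H (s := s) (r := r) (i := i.+1).
  have := hf_hi H (s := s) (r := r.+1) (i := i).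
  by move=> /(_ ltac:(lia) ltac:(lia)) a /(_ ltac:(lia) ltac:(lia)); lia.
by apply: contra h4; apply: inl_sub; lia.
Qed.

Lemma cross_dnV s r i : inR s false r i -> h s r.+1 i.+1 = (h s r.+1 i).+1 ->
  inR s true r.+1 i.
Proof.
rewrite /inR /clen => /and4P[h1 h2 h3 h4] e.
have -> : r.+1 + 1 = r + 2 by lia.
rewrite h1 h2 h4 andbT /= ltnNge; apply/negP => t.
by rewrite !(hf_top H) in e.
Qed.

Lemma cross_dnL s r i : inR s false r i -> h s r i.+1 = (h s r.+1 i.+1).+1 ->
  inR s true r i.+1.
Proof.
rewrite /inR /clen => /and4P[h1 h2 h3 h4] e.
apply/and4P; split => //; [lia|lia|].
apply/negP; rewrite addn1 => il; have := hf_lobe H il.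
have := hf_lobe H (s := s) (r := r) (i := i.+1).
by move=> /(_ ltac:(apply: inl_sub il; lia)); lia.
Qed.

Lemma cross_dnR s r i : inR s false r i -> h s r i.+1 = h s r.+1 i ->
  inR s true r i.
Proof.
rewrite /inR /clen => /and4P[h1 h2 h3 h4] e.
apply/and4P; split => //; first lia.
apply/negP; rewrite addn1 => il; have := hf_lobe H il.
have := hf_lobe H (s := s) (r := r) (i := i.+1).
move=> /(_ ltac:(apply: inl_sub il; lia)).
have : i \in dents s by rewrite -(wf_lob wf); apply: inl_sub il; lia.
by move/(hf_dent H); lia.
Qed.

End Crossings.

End HeightFunctions.

(** * Configurations of positions and their height functions *)

Section Configurations.

Variable D : halves.
Hypothesis wf : wf_halves D.

Let N := rows D.

Definition conf : Type := (seq nat * (seq (seq nat) * seq (seq nat)))%type.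

Definition crow (U : seq nat) (s : bool) : seq nat := Bl D s ++ U ++ Br D s.

Definition confs : seq conf :=
  [seq (U, pp) | U <- ksub (ml D) (mr D - ml D) (nfree D),
    pp <- [seq (p, p') | p <- pats (N true) (crow U true),
                         p' <- pats (N false) (crow U false)]].

Definition cpat (c : conf) (s : bool) := if s then c.2.1 else c.2.2.

Definition crows (c : conf) (s : bool) (r : nat) : seq nat :=
  nth [::] (crow c.1 s :: cpat c s) r.

Definition hof (c : conf) (s : bool) (r i : nat) : nat := cnt (crows c s r) i.

Lemma confsP (c : conf) :
  reflect (c.1 \in ksub (ml D) (mr D - ml D) (nfree D) /\
           forall s, cpat c s \in pats (N s) (crow c.1 s))
          (c \in confs).
Proof.
case: c => U [p p']; apply: (iffP allpairsPdep) => /=.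
  move=> [U' [pp [hU /allpairsP[[p1 p1'] /= [h1 h2 ->]] [-> -> ->]]]].
  by split => //; case.
move=> [hU hp]; exists U, (p, p'); split => //.
by apply/allpairsP; exists (p, p'); split; [exact: (hp true)|exact: (hp false)|].
Qed.

Lemma confs_uniq : uniq confs.
Proof.
apply: allpairs_uniq_dep; rewrite ?ksub_uniq //.
  move=> U _; apply: allpairs_uniq; rewrite ?pats_uniq //.
  by move=> [? ?] [? ?].
by move=> [x s] [x' s'] _ _ /= [-> ->].
Qed.

Lemma crow_sorted (U : seq nat) (s : bool) :
  U \in ksub (ml D) (mr D - ml D) (nfree D) -> sorted ltn (crow U s).
Proof.
case/ksubP => sU szU hU.
rewrite /crow sorted_pairwise; last exact: ltn_trans.
rewrite !pairwise_cat -!sorted_pairwise; try exact: ltn_trans.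
rewrite sU (wf_sBl wf) (wf_sBr wf) !andbT; have := wf_mid wf => wm.
apply/andP; split.
  apply/allrelP => a b /(wf_Bl wf) ha; rewrite mem_cat.
  by case/orP => [/hU|/(wf_Br wf)]; lia.
by apply/allrelP => a b /hU ha /(wf_Br wf); lia.
Qed.

Lemma crow_size (U : seq nat) (s : bool) :
  U \in ksub (ml D) (mr D - ml D) (nfree D) -> size (crow U s) = N s.
Proof.
by case/ksubP => _ szU _; rewrite /crow /N /rows /dents !size_cat szU; lia.
Qed.

Lemma cnt_crow (U : seq nat) (s : bool) i :
  cnt (crow U s) i = cntB D s i + cnt U i.
Proof. by rewrite /cntB !cnt_cat; lia. Qed.

Lemma crows_sorted c s r : c \in confs -> sorted ltn (crows c s r).
Proof.
by case/confsP => hU hp; apply: pats_sorted (hp s); exact: crow_sorted.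
Qed.

Lemma crows_size c s r : c \in confs -> r <= N s -> size (crows c s r) = N s - r.
Proof.
by case/confsP => hU hp rN; rewrite (pats_size (hp s)) // crow_size.
Qed.

Lemma crows_interl c s r : c \in confs -> r < N s ->
  crows c s r.+1 \in interl (crows c s r).
Proof. by case/confsP => _ hp rN; case/patsP: (hp s) => _; apply. Qed.

Lemma hof_HF c : c \in confs -> isHF D (hof c).
Proof.
move=> cc; have [hU hp] := confsP _ cc; have [sU szU inU] := ksubP _ _ _ _ hU.
have := wf_mid wf => wm; split.
- move=> s i il; rewrite /hof /crows /= cnt_crow (cnt_none (c := c.1)) ?addn0 //.
  by move=> a /inU; lia.
- move=> s i il; rewrite /hof /crows /= cnt_crow (cnt_all (c := c.1)) ?szU //.
  by move=> a /inU; lia.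
- by move=> i; rewrite /hof /crows /= !cnt_crow; lia.
- move=> s r i; rewrite /hof cntS; last exact/sorted_ltn_uniq/crows_sorted.
  by case: (i \in _); lia.
- move=> s r i rN.
  by have [] := interl_cnt i (crows_sorted s r cc) (crows_interl cc rN).
- move=> s r i rN.
  by have [] := interl_cnt i (crows_sorted s r cc) (crows_interl cc rN).
- move=> s r i; rewrite leq_eqVlt => /orP[/eqP e|lt].
    have := crows_size (c := c) (s := s) (r := r) cc.
    by rewrite -e leqnn subnn /hof => /(_ isT)/size0nil ->.
  rewrite /hof /crows nth_default //=; case/patsP: (hp s) => -> _.
  exact: lt.
Qed.

Lemma hof_inj c c' : c \in confs -> c' \in confs ->
  (forall s r i, r <= N s -> hof c s r i = hof c' s r i) -> c = c'.
Proof.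
move=> cc cc' e; have [hU hp] := confsP _ cc; have [hU' hp'] := confsP _ cc'.
have eU : c.1 = c'.1.
  case/ksubP: hU => sU _ _; case/ksubP: hU' => sU' _ _.
  apply: cnt_inj => // i; have := e true 0 i.
  by rewrite /hof /crows /= !cnt_crow => /(_ isT); lia.
have ep s : cpat c s = cpat c' s.
  case/patsP: (hp s) => sz _; case/patsP: (hp' s) => sz' _.
  apply: (@eq_from_nth _ [::]); first by rewrite sz sz'.
  rewrite sz => r rN; have := e s r.+1.
  rewrite /hof /crows /= => ee; apply: cnt_inj => [||i].
  - exact: (crows_sorted s r.+1 cc).
  - exact: (crows_sorted s r.+1 cc').
  - exact: ee.
case: c c' eU ep {cc cc' e hU hp hU' hp'} => U [p p'] [U' [p1 p1']] /= -> ep.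
by have /= -> := ep true; have /= -> := ep false.
Qed.

(** The row of a height function is the list of its jumps; these are unit jumps, so the height
    counts them ([cstep]). The jumps on the axis outside of the gap are the dents, and those inside
    form [U]. *)
Lemma conf_of h : isHF D h ->
  exists2 c, c \in confs & forall s r i, hof c s r i = h s r i.
Proof.
move=> H; have wm := wf_mid wf.
pose row s r := [seq a <- iota 0 (hi D s) | h s r a < h s r a.+1].
have srow s r : sorted ltn (row s r).
  by apply: sorted_filter; [exact: ltn_trans|exact: iota_ltn_sorted].
have cstep (c : seq nat) (f : nat -> nat) : uniq c -> f 0 = 0 ->
    (forall i, f i.+1 = f i + (i \in c)) -> forall i, cnt c i = f i.
  move=> uc f0 fS; elim=> [|i IH]; first by rewrite f0 cnt_none.
  by rewrite cntS // fS IH.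
have crow_h s r i : cnt (row s r) i = h s r i.
  apply: cstep => [||{}i]; first exact/sorted_ltn_uniq/srow.
    by rewrite (hf_lo wf H).
  (* Cutting at [hi D s] loses no jump, since the height is constant from there on. *)
  rewrite mem_filter mem_iota add0n /=; have := hf_horiz H s r i.
  case: (ltnP i (hi D s)) => ih; first by case: ltnP; lia.
  rewrite andbF addn0 => _; case: (leqP r (N s)) => rN.
    by rewrite !(hf_hi wf H) //; lia.
  by rewrite !(hf_top H) // ltnW.
pose U := [seq a <- iota (ml D) (mr D - ml D) | h true 0 a < h true 0 a.+1].
have sU : sorted ltn U.
  by apply: sorted_filter; [exact: ltn_trans|exact: iota_ltn_sorted].
have cU i : cnt U i + cntB D true i = h true 0 i.
  elim: i => [|i IH].
    by rewrite cnt_none // (cntB_lo wf) // (hf_lo wf H).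
  rewrite cntS ?sorted_ltn_uniq // cntBS // mem_filter mem_iota.
  have := hf_horiz H true 0 i.
  case: (boolP (i \in dents D true)) => ib.
    have := dents_out wf ib; rewrite (hf_dent wf H ib).
    by case: andP => [[_ ?]|_]; lia.
  case: (boolP (ml D <= i < mr D)) => im.
    by rewrite (_ : i < _ = true); [case: ltnP|]; lia.
  rewrite (hf_nodent wf H ib) ?ltnn /=; lia.
have szU : size U = nfree D.
  have := cU (mr D); rewrite (hf_right H) // cnt_all; first by lia.
  by move=> a; rewrite mem_filter mem_iota; lia.
have hU : U \in ksub (ml D) (mr D - ml D) (nfree D).
  by apply/ksubP; split => // a; rewrite mem_filter mem_iota => /andP[].
have crow0 s : crow U s = row s 0.
  apply: cnt_inj => // [|i]; first exact: crow_sorted.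
  rewrite cnt_crow crow_h; have := cU i; have := hf_axis H i.
  by case: s; lia.
pose p s := [seq row s r.+1 | r <- iota 0 (N s)].
have nthp s r : r <= N s -> nth [::] (crow U s :: p s) r = row s r.
  case: r => [|r] rN /=; first exact: crow0.
  by rewrite (nth_map 0) ?size_iota // nth_iota.
have szrow s r : r <= N s -> size (row s r) = N s - r.
  move=> rN; rewrite -(hf_hi wf H (i := hi D s) rN) ?leq_addr // -crow_h.
  by rewrite cnt_all // => a; rewrite mem_filter mem_iota; lia.
exists (U, (p true, p false)).
  apply/confsP; split => //= s.
  have -> : cpat (U, (p true, p false)) s = p s by case: s.
  apply/patsP; split; first by rewrite size_map size_iota.
  move=> r rN; have /= -> := nthp s r.+1 rN; rewrite (nthp s r (ltnW rN)).
  apply: cnt_interl => // [|i|i].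
  - by rewrite !szrow // ?(ltnW rN) //; lia.
  - by rewrite !crow_h; have := hf_vert H i rN; lia.
  - by rewrite !crow_h; have := hf_diag H i rN; lia.
move=> s r i; rewrite /hof /crows /=.
have -> : cpat (U, (p true, p false)) s = p s by case: s.
case: (leqP r (N s)) => rN; first by rewrite nthp.
by rewrite nth_default ?(hf_top H) ?(ltnW rN) //= size_map size_iota.
Qed.

Definition wt (c : conf) : nat :=
  sumn c.1 + sumn (map sumn c.2.1) + sumn (map sumn c.2.2).

Variable W : nat.
Hypothesis hiW : forall s, hi D s <= W.

(** On the axis the heights of the two halves differ by an amount independent of [h], so only the
    upper one enters, just as [U] enters [wt] once. *)
Definition vsum (h : bool -> nat -> nat -> nat) : nat :=
  \sum_(0 <= i < W.+1) h true 0 i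
  + (\sum_(1 <= r < (N true).+1) \sum_(0 <= i < W.+1) h true r i
     + \sum_(1 <= r < (N false).+1) \sum_(0 <= i < W.+1) h false r i).

Lemma crows_leqW c s r : c \in confs -> {in crows c s r, forall a, a <= W}.
Proof.
move=> cc a ar; have H := hof_HF cc; rewrite leqNgt; apply/negP => Wa.
have ha : hi D s <= a by have := hiW s; lia.
have := cntS a (sorted_ltn_uniq (crows_sorted s r cc)); rewrite ar.
rewrite -/(hof c s r a) -/(hof c s r a.+1); case: (leqP r (N s)) => rN.
  by rewrite !(hf_hi wf H) //; lia.
by rewrite !(hf_top H) ?(ltnW rN).
Qed.

(** Apply [sum_cnt] to every row. The dents of the upper half appear because the axis row of [vsum]
    counts them, whereas [wt] records only [U] there. *)
Lemma vsum_wt c : c \in confs ->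
  vsum (hof c) + wt c + sumn (dents D true) =
  W * N true + (\sum_(1 <= r < (N true).+1) W * (N true - r)
                + \sum_(1 <= r < (N false).+1) W * (N false - r)).
Proof.
move=> cc; have rowsum s : \sum_(1 <= r < (N s).+1) \sum_(0 <= i < W.+1) hof c s r i
    + sumn (map sumn (cpat c s)) = \sum_(1 <= r < (N s).+1) W * (N s - r).
  have -> : sumn (map sumn (cpat c s)) =
      \sum_(1 <= r < (N s).+1) sumn (crows c s r).
    case/confsP: cc => _ /(_ s)/patsP[sz _].
    rewrite big_add1 /= sumnE big_map (big_nth [::]) sz.
    by apply: eq_big_nat.
  rewrite -big_split /=; apply: eq_big_nat => r rN.
  rewrite sum_cnt; last exact: crows_leqW.
  by rewrite crows_size //; lia.
have := rowsum true; have := rowsum false.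
have := sum_cnt (crows_leqW (s := true) (r := 0) cc).
rewrite crows_size // subn0 -/N.
have -> : sumn (crows c true 0) = sumn (Bl D true) + (sumn c.1 + sumn (Br D true)).
  by rewrite /crows /= /crow !sumn_cat.
rewrite /vsum /wt /dents sumn_cat /hof /=; lia.
Qed.

End Configurations.

Local Open Scope ring_scope.

(** * Interlacing sums of q-Vandermonde products *)

(** Subtracting from each row of the Vandermonde matrix the previous one (multiplication by the
    unitriangular [L]) leaves a single non-zero entry in the first column, along which [B] is
    expanded. *)
Lemma det_consecutive_powers (R : comNzRingType) (n : nat) (x : nat -> R) :
  \det (\matrix_(r < n, s < n) (x r.+1 ^+ s.+1 - x r ^+ s.+1))
  = \prod_(i < n.+1) \prod_(j < n.+1 | (i < j)%N) (x j - x i).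
Proof.
have <- : \det (\matrix_(r < n.+1, s < n.+1) x r ^+ s)
    = \prod_(i < n.+1) \prod_(j < n.+1 | (i < j)%N) (x j - x i).
  have := det_Vandermonde (\row_(j < n.+1) x j).
  under eq_bigr => i _ do under eq_bigr => j _ do rewrite !mxE.
  move=> <-; rewrite -det_tr; congr (\det _); apply/matrixP => i j.
  by rewrite !mxE.
pose L : 'M[R]_n.+1 :=
  \matrix_(r, s) ((s == r)%:R - (s.+1 == r :> nat)%:R).
pose B : 'M[R]_n.+1 :=
  \matrix_(r, s) (x r ^+ s - if (r : nat) is r'.+1 then x r' ^+ s else 0).
have -> : \det (\matrix_(r < n.+1, s < n.+1) x r ^+ s) = \det B.
  have <- : L *m (\matrix_(r < n.+1, s < n.+1) x r ^+ s) = B.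
    apply/matrixP => r s; rewrite !mxE.
    under eq_bigr => k _ do rewrite !mxE mulrBl.
    rewrite sumrB; congr (_ - _).
      rewrite (bigD1 r) //= eqxx mul1r big1 ?addr0 // => k /negbTE ->.
      by rewrite mul0r.
    case: r => -[|r] rn /=; first by rewrite big1 // => k _; rewrite mul0r.
    rewrite (bigD1 (Ordinal (ltnW rn))) //= eqxx mul1r big1 ?addr0 // => k.
    rewrite -val_eqE /= => /negbTE kr; rewrite eqSS kr mul0r //.
  rewrite det_mulmx det_trig; last first.
    apply/is_trig_mxP => i j ij; rewrite mxE -val_eqE.
    by rewrite !gtn_eqF ?subr0 // ltnW.
  rewrite big1 ?mul1r // => i _; rewrite mxE eqxx.
  by rewrite gtn_eqF ?subr0 //.
rewrite (expand_det_col _ ord0) (bigD1 ord0) //= !mxE subr0 expr0 mul1r.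
rewrite big1 ?addr0; last first.
  move=> [[|i] ip] //= _; by rewrite mxE /= !expr0 subrr mul0r.
rewrite /cofactor expr0 mul1r; congr (\det _); apply/matrixP => i j.
by rewrite !mxE.
Qed.

Section VandermondeSums.

Variables (F : fieldType) (q : F).

Definition cross (A B : seq nat) : F :=
  \prod_(a <- A) \prod_(b <- B) (q ^+ b - q ^+ a).

Fixpoint vd (c : seq nat) : F :=
  if c is a :: c' then cross [:: a] c' * vd c' else 1.

Lemma cross_consl a A B : cross (a :: A) B = cross [:: a] B * cross A B.
Proof. by rewrite /cross big_cons big_seq1. Qed.

Lemma cross_catl A A' B : cross (A ++ A') B = cross A B * cross A' B.
Proof. by rewrite /cross big_cat. Qed.

Lemma cross_catr A B B' : cross A (B ++ B') = cross A B * cross A B'.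
Proof.
by rewrite /cross -big_split; apply: eq_bigr => a _; rewrite big_cat.
Qed.

Lemma cross_perml A A' B : perm_eq A A' -> cross A B = cross A' B.
Proof. by move=> p; rewrite /cross (perm_big _ p). Qed.

Lemma cross_permr A B B' : perm_eq B B' -> cross A B = cross A B'.
Proof.
by move=> p; rewrite /cross; apply: eq_bigr => a _; rewrite (perm_big _ p).
Qed.

Lemma cross_nil A : cross [::] A = 1.
Proof. by rewrite /cross big_nil. Qed.

Lemma cross_nilr A : cross A [::] = 1.
Proof. by rewrite /cross big1_seq // => i _; rewrite big_nil. Qed.

Lemma vd_cat A B : vd (A ++ B) = vd A * cross A B * vd B.
Proof.
elim: A => [|a A IH] /=; first by rewrite cross_nil !mul1r.
by rewrite IH (cross_consl a A) cross_catr; ring.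
Qed.

Lemma vdE (c : seq nat) : vd c = \prod_(i < size c)
  \prod_(j < size c | (i < j)%N) (q ^+ nth 0%N c j - q ^+ nth 0%N c i).
Proof.
elim: c => [|a c IH] /=; first by rewrite big_ord0.
rewrite big_ord_recl /=; congr (_ * _).
  rewrite [RHS]big_mkcond big_ord_recl /= mul1r /cross big_seq1.
  by rewrite (big_nth 0%N) big_mkord.
rewrite IH; apply: eq_bigr => i _.
by rewrite [RHS]big_mkcond big_ord_recl /= mul1r -big_mkcond.
Qed.

(** Each entry of an interlacing list ranges over its own interval, whatever the other entries are,
    so the sum factors. *)
Lemma sum_interl_prod (G : nat -> nat -> F) (c : seq nat) :
  \sum_(d <- interl c) \prod_(r < (size c).-1) G r (nth 0%N d r)
  = \prod_(r < (size c).-1)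
      \sum_(a <- index_iota (nth 0%N c r) (nth 0%N c r.+1)) G r a.
Proof.
elim: c G => [|a [|b c] IH] G.
- by rewrite /= big_seq1 !big_ord0.
- by rewrite /= big_seq1 !big_ord0.
rewrite [interl _]/= big_allpairs_dep /=.
rewrite big_ord_recl /= -(IH (fun r => G r.+1)) mulr_suml.
by apply: eq_bigr => d _; rewrite mulr_sumr; apply: eq_bigr => ds _;
  rewrite big_ord_recl.
Qed.

(** The factor [q ^+ sumn d] raises the exponents from [s] to [s.+1]; the geometric sums over the
    entries then avoid the exponent 0, where the denominator would vanish. *)
Lemma vd_det (n : nat) (d : seq nat) : size d = n ->
  q ^+ sumn d * vd d
  = \sum_(s : 'S_n) (-1) ^+ s * \prod_(r < n) q ^+ (nth 0%N d r * (s r).+1)%N.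
Proof.
move=> sd; transitivity (\det (\matrix_(r < n, s < n)
  q ^+ (nth 0%N d r * s.+1)%N)); last first.
  rewrite /determinant; apply: eq_bigr => s _; congr (_ * _).
  by apply: eq_bigr => r _; rewrite mxE.
have -> : (\matrix_(r < n, s < n) q ^+ (nth 0%N d r * s.+1)%N)
  = diag_mx (\row_r q ^+ (nth 0%N d r)) *m
    (Vandermonde n (\row_r q ^+ (nth 0%N d r)))^T.
  apply/matrixP => r s; rewrite mul_diag_mx !mxE.
  by rewrite -exprM -exprD mulnS.
rewrite det_mulmx det_diag det_tr det_Vandermonde vdE; congr (_ * _).
  rewrite sumnE (big_nth 0%N) big_mkord sd -prodrXr.
  by apply: eq_bigr => r _; rewrite mxE.
rewrite sd; apply: eq_bigr => i _; apply: eq_bigr => j _; by rewrite !mxE.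
Qed.

Definition qden (n : nat) : F := \prod_(s < n) (q ^+ s.+1 - 1).

(** Expand the determinant of [vd_det]. Every entry contributes a geometric sum, which telescopes to
    a difference of two powers, and the permutations reassemble into the determinant of
    [det_consecutive_powers]. *)
Lemma sum_interl_vd (n : nat) (c : seq nat) : sorted ltn c -> size c = n.+1 ->
  (\sum_(d <- interl c) q ^+ sumn d * vd d) * qden n = vd c.
Proof.
move=> sc szc.
under eq_big_seq => d /interlP[sd _].
  rewrite (@vd_det n); last by rewrite sd szc.
  over.
rewrite exchange_big /=.
under eq_bigr => s _ do rewrite -mulr_sumr.
pose x r := q ^+ nth 0%N c r.
rewrite vdE szc -(det_consecutive_powers n x) /determinant mulr_suml.
apply: eq_bigr => s _; rewrite -!mulrA; congr (_ * _).
have -> : qden n = \prod_(r < n) (q ^+ (s r).+1 - 1).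
  by rewrite /qden (reindex_inj (@perm_inj _ s)).
(* [sum_interl_prod] is indexed by natural numbers but [s] permutes ordinals; the default value 1 is
   never reached, as [r < n]. *)
pose G (r a : nat) := if insub r is Some r' then q ^+ (a * (s r').+1)%N else 1.
have -> : \sum_(d <- interl c) \prod_(r < n) q ^+ (nth 0%N d r * (s r).+1)%N
  = \sum_(d <- interl c) \prod_(r < (size c).-1) G r (nth 0%N d r).
  rewrite szc /=; apply: eq_bigr => d _; apply: eq_bigr => r _.
  by rewrite /G valK.
rewrite sum_interl_prod szc /= -big_split /=; apply: eq_bigr => r _.
rewrite mxE /x -!exprM /G valK.
have le : (nth 0%N c r <= nth 0%N c r.+1)%N.
  apply: ltnW; apply: (sortedP 0%N sc); rewrite szc ltnS //.
elim: (nth 0%N c r.+1) le => [|m IH] le.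
  by move: le; rewrite leqn0 => /eqP ->; rewrite big_geq // mul0r subrr.
move: le; rewrite leq_eqVlt => /orP[/eqP ->|].
  by rewrite big_geq // mul0r subrr.
rewrite ltnS => le; rewrite big_nat_recr //= mulrDl IH //.
by rewrite mulSn exprD; ring.
Qed.

Definition qdens (n : nat) : F := \prod_(m < n) qden m.

Lemma sum_pats (c : seq nat) : sorted ltn c ->
  (\sum_(p <- pats (size c) c) q ^+ sumn (map sumn p)) * qdens (size c) = vd c.
Proof.
move: {2 4}(size c) (erefl (size c)) => n.
elim: n c => [|n IH] c szc sc; rewrite szc /=.
  by rewrite big_seq1 /qdens big_ord0 (size0nil szc) !mulr1.
rewrite -(sum_interl_vd sc szc) big_allpairs_dep /= /qdens big_ord_recr /=.
rewrite -/(qdens n) mulrA mulr_suml; congr (_ * _); apply: eq_big_seq => d dc.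
have sd := interl_sorted dc; case/interlP: dc => szd _.
rewrite szc /= in szd.
rewrite -(IH d szd sd) szd mulrA; congr (_ * _).
by rewrite mulr_sumr; apply: eq_bigr => p _; rewrite -exprD.
Qed.

End VandermondeSums.

(** * The discrete Selberg sum *)

Section SelbergSum.

Variables (F : fieldType) (q : F).

(** A half-open interval between consecutive integers holds one point, so the block passes unchanged
    to every interlacing list; [interl_right] is the same on the other side. *)
Lemma interl_left (L : nat) (a : nat) (c : seq nat) :
  interl (iota a L ++ (a + L)%N :: c)
  = [seq iota a L ++ U | U <- interl ((a + L)%N :: c)].
Proof.
elim: L a => [|L IH] a; first by rewrite /= addn0 map_id.
have -> : interl (iota a L.+1 ++ (a + L.+1)%N :: c)
  = [seq a :: U | U <- interl (iota a.+1 L ++ (a.+1 + L)%N :: c)].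
  by case: L {IH} => [|L] /=; rewrite ?addnS ?addn0 ?subSnn //= cats0.
by rewrite IH -map_comp -addSnnS.
Qed.

Lemma interl_right (M R : nat) (c : seq nat) :
  interl (c ++ M :: iota M.+1 R)
  = [seq U ++ iota M R | U <- interl (c ++ [:: M])].
Proof.
elim: c => [|a c IH].
  rewrite /=; elim: R M => [|R IH] M //=; have /= := IH M.+1.
  by rewrite subSnn /= => ->.
rewrite !cat_cons.
have -> : interl (a :: c ++ M :: iota M.+1 R) =
  [seq d :: ds | d <- iota a (head 0%N (c ++ [:: M]) - a),
                 ds <- interl (c ++ M :: iota M.+1 R)].
  by case: c {IH}.
have -> : interl (a :: c ++ [:: M]) =
  [seq d :: ds | d <- iota a (head 0%N (c ++ [:: M]) - a),
                 ds <- interl (c ++ [:: M])].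
  by case: c {IH}.
by rewrite IH map_allpairs allpairs_mapr.
Qed.

(** The condition [U_r <= d_r < U_(r+1)] also reads [d_(r-1) + 1 <= U_r < d_r + 1]: conversely, [U]
    interlaces with the shift of [d]. The range of [U] supplies the two outer bounds. *)
Lemma interl_ksub (L n z : nat) (U' d' : seq nat) :
  U' \in ksub L (n.+1 + z) n.+1 -> d' \in interl U' ->
  d' \in ksub L (n + z) n /\
  U' \in interl (L :: map succn d' ++ [:: (L + n.+1 + z)%N]).
Proof.
move=> /ksubP[sS szS hS] dS.
  have sd := interl_sorted dS; move: (dS) => /interlP[szd hd].
  rewrite szS /= in szd.
  have hU r : (r < n.+1)%N -> (L <= nth 0 U' r < L + (n.+1 + z))%N.
    by move=> rn; apply: hS; rewrite mem_nth ?szS.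
  split.
    apply/ksubP; split => //; apply: in_nth => r rd.
    have := hd r rd; have := hU r; have := hU r.+1; rewrite szd in rd. lia.
  apply/interlP; split; first by rewrite /= size_cat size_map /=; lia.
  move=> r; rewrite szS => rn; apply/andP; split.
    case: r rn => [|r] rn /=; first by have := hU 0%N; lia.
    rewrite nth_cat size_map szd; have rn' : (r < n)%N by [].
    rewrite rn' (nth_map 0%N) ?szd //; have := hd r; lia.
  rewrite /= nth_cat size_map szd.
  case: (ltnP r n) => rn'; first by rewrite (nth_map 0%N) ?szd //; have := hd r; lia.
  have -> : r = n by lia.
  rewrite subnn /=; have := hU n; lia.
Qed.

Lemma ksub_interl (L n z : nat) (U' d' : seq nat) :
  d' \in ksub L (n + z) n ->
  U' \in interl (L :: map succn d' ++ [:: (L + n.+1 + z)%N]) ->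
  U' \in ksub L (n.+1 + z) n.+1 /\ d' \in interl U'.
Proof.
move=> /ksubP[sd szd hd] dS.
  have sS := interl_sorted dS; move: (dS) => /interlP[szS hS].
  rewrite /= size_cat size_map szd addn1 in szS.
  have h1 r : (r < n)%N -> (nth 0 U' r <= nth 0 d' r < nth 0 U' r.+1)%N.
    move=> rn; have /= := hS r; have /= := hS r.+1.
    rewrite nth_cat size_map szd rn (nth_map 0%N) ?szd //.
    lia.
  split; last first.
    by apply/interlP; rewrite szS szd; split.
  apply/ksubP; split => //; apply: in_nth => r rd.
  have hr := hS r rd; have hd' s : (s < n)%N -> (L <= nth 0 d' s < L + (n + z))%N.
    by move=> sn; apply: hd; rewrite mem_nth ?szd.
  apply/andP; split.
    case: r rd hr => [|r] rd hr; first by move: hr => /= /andP[].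
    have := h1 r; have := hd' r; lia.
  case: (ltnP r n) => rn; first by have := h1 r rn; have := hd' r rn; lia.
  have er : r = n by lia.
  by move: hr; rewrite er /= nth_cat size_map szd ltnn subnn /=; lia.
Qed.

Lemma exchange_ksub (G : seq nat -> seq nat -> F) (L n z : nat) :
  \sum_(U <- ksub L (n.+1 + z) n.+1) \sum_(d <- interl U) G U d
  = \sum_(d <- ksub L (n + z) n)
      \sum_(U <- interl (L :: map succn d ++ [:: (L + n.+1 + z)%N])) G U d.
Proof.
transitivity (\sum_(p <- [seq (U, d) | U <- ksub L (n.+1 + z) n.+1,
  d <- interl U]) G p.1 p.2); first by rewrite big_allpairs_dep.
transitivity (\sum_(p <- [seq (U, d) | d <- ksub L (n + z) n,
  U <- interl (L :: map succn d ++ [:: (L + n.+1 + z)%N])]) G p.1 p.2);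
  last by rewrite big_allpairs_dep.
apply: perm_big; apply: uniq_perm.
- apply: allpairs_uniq_dep; rewrite ?ksub_uniq //.
    by move=> *; exact: interl_uniq.
  by move=> [x s] [x' s'] _ _ /= [-> ->].
- apply: allpairs_uniq_dep; rewrite ?ksub_uniq //.
    by move=> *; exact: interl_uniq.
  by move=> [x s] [x' s'] _ _ /= [-> ->].
move=> [U d]; apply/allpairsPdep/allpairsPdep.
- move=> [U' [d' [US dS [-> ->]]]] {U d}.
  by exists d', U'; have [? ?] := interl_ksub US dS.
- move=> [d' [U' [dS US [-> ->]]]] {U d}.
  by exists U', d'; have [? ?] := ksub_interl dS US.
Qed.

Lemma vd_succ (n : nat) : exists e, forall d, size d = n ->
  q ^+ sumn (map succn d) * vd q (map succn d)
  = q ^+ e * (q ^+ sumn d * vd q d).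
Proof.
elim: n => [|n [e IH]].
  by exists 0%N => d /size0nil ->; rewrite /= !mul1r.
exists (e + n + 1)%N => -[|a d] //= [szd].
have -> : cross q [:: a.+1] (map succn d) = q ^+ n * cross q [:: a] d.
  rewrite /cross !big_seq1 big_map.
  under eq_bigr => b _ do rewrite !exprS -mulrBr.
  by rewrite big_split /= big_const_seq count_predT iter_mulr_1 szd.
rewrite !exprD exprS expr1.
transitivity (q * q ^+ a * (q ^+ n * cross q [:: a] d) *
  (q ^+ sumn (map succn d) * vd q (map succn d))); first by ring.
by rewrite IH //; ring.
Qed.

Lemma ksub_succ (L m k : nat) :
  ksub L.+1 m k = [seq map succn d | d <- ksub L m k].
Proof.
elim: m L k => [|m IH] L [|k] //=.
by rewrite map_cat !IH -!map_comp.
Qed.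

Definition Zsum (L R y z : nat) : F :=
  \sum_(U <- ksub L (y + z) y)
    q ^+ sumn U * (vd q U * vd q (iota 0 L ++ U ++ iota (L + y + z) R)).

Lemma sorted_blocks (L M R : nat) (d : seq nat) : sorted ltn d ->
  {in d, forall a, (L <= a < M)%N} -> (L <= M)%N ->
  sorted ltn (iota 0 L ++ d ++ iota M R).
Proof.
move=> sd hd LM.
rewrite sorted_pairwise; last exact: ltn_trans.
rewrite !pairwise_cat -!sorted_pairwise; try exact: ltn_trans.
rewrite sd !iota_ltn_sorted !andbT; apply/andP; split.
  apply/allrelP => a b; rewrite mem_iota mem_cat mem_iota => aL.
  by case/orP => [/hd|]; lia.
by apply/allrelP => a b /hd; rewrite mem_iota; lia.
Qed.

(* One factor [vd q U] is expanded over the lists interlacing with [U]; after an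
   exchange of sums, the sum over [U] is again of this kind, because fixed
   consecutive entries leave only one choice for those between them. *)
Lemma Zsum_step (L R n z : nat) :
  exists e e', q ^+ e * (Zsum L R n.+1 z * qden q (L + R + n.+1))
          = q ^+ e' * (qden q n * Zsum L.+1 R.+1 n z).
Proof.
set M := (L + n.+1 + z)%N.
pose u := q ^+ (sumn (iota 0 L) + sumn (iota M R)).
(* The two outer bounds of [exchange_ksub] are adjacent to the fixed blocks and prolong each of them
   by one entry; this is where [L.+1] and [R.+1] come from. *)
pose c d := iota 0 L.+1 ++ map succn d ++ iota M R.+1.
have inner d : d \in ksub L (n + z) n ->
    \sum_(U <- interl (L :: map succn d ++ [:: M])) u *
      (q ^+ sumn U * vd q (iota 0 L ++ U ++ iota M R)) * qden q (L + R + n.+1)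
    = vd q (c d).
  case/ksubP => sd szd hd.
  have sc : sorted ltn (c d).
    apply: sorted_blocks; last by rewrite /M; lia.
      by rewrite (@sorted_map _ _ succn ltn) /=; exact: sd.
    by move=> a /mapP[b /hd bd ->]; rewrite /M; lia.
  have szc : size (c d) = (L + R + n.+1).+1.
    by rewrite /c !size_cat !size_iota size_map szd; lia.
  rewrite -(sum_interl_vd q sc szc) mulr_suml.
  have -> : c d = iota 0 L ++ (0 + L)%N :: map succn d ++ M :: iota M.+1 R.
    by rewrite /c -addn1 iotaD -catA.
  rewrite interl_left.
  rewrite (_ : (0 + L)%N :: map succn d ++ M :: iota M.+1 R
    = (L :: map succn d) ++ M :: iota M.+1 R) // interl_right -map_comp big_map.
  apply: eq_bigr => U _ /=; rewrite !sumn_cat !exprD /u exprD; ring.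
have [e he'] := vd_succ n.
exists (sumn (iota 0 L) + sumn (iota M R) + e)%N, 0%N.
rewrite mul1r [in LHS]exprD -/u.
have -> : Zsum L R n.+1 z = qden q n *
  \sum_(U <- ksub L (n.+1 + z) n.+1) \sum_(d <- interl U)
    (q ^+ sumn d * vd q d) * (q ^+ sumn U * vd q (iota 0 L ++ U ++ iota M R)).
  rewrite /Zsum mulr_sumr; apply: eq_big_seq => U /ksubP[sS szS _].
  rewrite -{1}(sum_interl_vd q sS szS) -/M -mulr_suml; ring.
rewrite exchange_ksub -/M; set X := \sum_(_ <- _) _.
suff <- : u * q ^+ e * X * qden q (L + R + n.+1) = Zsum L.+1 R.+1 n z by ring.
rewrite [RHS]/Zsum /X mulr_sumr mulr_suml {X}.
rewrite ksub_succ big_map; apply: eq_big_seq => d dk.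
rewrite (_ : (L.+1 + n + z = M)%N); last by rewrite /M; lia.
case/ksubP: (dk) => _ szd _.
rewrite mulrA he' // -(inner d dk) [RHS]mulr_sumr mulr_sumr mulr_suml.
apply: eq_bigr => U _; ring.
Qed.

End SelbergSum.

(** * Vandermonde products of blocks, and the function s_q *)

Fixpoint lblk (up : bool) (p : nat) (c : seq nat) : seq nat :=
  if c is k :: c' then
    (if up then iota p k else [::]) ++ lblk (~~ up) (p + k) c'
  else [::].

Lemma lblk_cat up p c c' :
  lblk up p (c ++ c') = lblk up p c ++ lblk (up (+) odd (size c)) (p + sumn c) c'.
Proof.
elim: c up p => [|k c IH] up p /=; first by rewrite addn0 addbF.
by rewrite IH catA addnA addNb addbN.
Qed.

Lemma odd_sum_cons k c : odd_sum (k :: c) = (k + even_sum c)%N.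
Proof.
rewrite /odd_sum /even_sum big_mkcond big_ord_recl /=; congr (_ + _)%N.
by rewrite [RHS]big_mkcond; apply: eq_bigr => i _ /=; rewrite negbK.
Qed.

Lemma even_sum_cons k c : even_sum (k :: c) = odd_sum c.
Proof.
rewrite /odd_sum /even_sum big_mkcond big_ord_recl /= add0n.
by rewrite [RHS]big_mkcond; apply: eq_bigr => i _.
Qed.

Lemma odd_sum_nil : odd_sum [::] = 0%N.
Proof. by rewrite /odd_sum big_ord0. Qed.

Lemma even_sum_nil : even_sum [::] = 0%N.
Proof. by rewrite /even_sum big_ord0. Qed.

Lemma odd_even_sum c : (odd_sum c + even_sum c)%N = sumn c.
Proof.
elim: c => [|k c IH] /=; first by rewrite odd_sum_nil even_sum_nil.
by rewrite odd_sum_cons even_sum_cons -IH; lia.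
Qed.

Lemma size_lblk up p c :
  size (lblk up p c) = if up then odd_sum c else even_sum c.
Proof.
elim: c up p => [|k c IH] up p; first by rewrite odd_sum_nil even_sum_nil if_same.
rewrite odd_sum_cons even_sum_cons /= size_cat IH; case: up => //=.
by rewrite size_iota.
Qed.

Section BlockVandermonde.

Variables (F : fieldType) (q : F).
Hypothesis q_neq0 : q != 0.
Hypothesis q_nroot : forall n, q ^+ n.+1 != 1.

Lemma q1_neq0 : q - 1 != 0.
Proof. by have := q_nroot 0; rewrite expr1 subr_eq0. Qed.

(** Powers stand on both sides so that no negative exponent is needed. The powers of [q - 1] come
    from writing [q ^+ n - 1] as [q - 1] times a q-integer. *)
Definition eqv (x y : F) : Prop :=
  exists a b c d : nat,
    q ^+ a * (q - 1) ^+ b * x = q ^+ c * (q - 1) ^+ d * y.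

Lemma eqv_refl x : eqv x x.
Proof. by exists 0%N, 0%N, 0%N, 0%N. Qed.

Lemma eq_eqv x y : x = y -> eqv x y.
Proof. by move=> ->; exact: eqv_refl. Qed.

Lemma eqv_trans y x z : eqv x y -> eqv y z -> eqv x z.
Proof.
case=> a [b [c [d e]]] [a' [b' [c' [d' e']]]].
exists (a + a')%N, (b + b')%N, (c + c')%N, (d + d')%N; rewrite !exprD.
transitivity (q ^+ a' * (q - 1) ^+ b' * (q ^+ a * (q - 1) ^+ b * x)).
  by ring.
rewrite e.
transitivity (q ^+ c * (q - 1) ^+ d * (q ^+ a' * (q - 1) ^+ b' * y)).
  by ring.
by rewrite e'; ring.
Qed.

Lemma eqv_mul x y x' y' : eqv x y -> eqv x' y' -> eqv (x * x') (y * y').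
Proof.
case=> a [b [c [d e]]] [a' [b' [c' [d' e']]]].
exists (a + a')%N, (b + b')%N, (c + c')%N, (d + d')%N; rewrite !exprD.
transitivity (q ^+ a * (q - 1) ^+ b * x * (q ^+ a' * (q - 1) ^+ b' * x')).
  by ring.
by rewrite e e'; ring.
Qed.

Lemma eqv_inv x y : eqv x y -> eqv x^-1 y^-1.
Proof.
case=> a [b [c [d e]]]; exists c, d, a, b.
have nz m n : q ^+ m * (q - 1) ^+ n != 0.
  by rewrite mulf_neq0 // expf_neq0 // q1_neq0.
move: (nz a b) (nz c d) e; set u := _ * _; set v := _ ^+ c * _ => hu hv e.
have -> : x^-1 = u * (v^-1 * y^-1) by rewrite -invfM -e invfM mulVKf.
by rewrite mulrCA mulVKf.
Qed.

Lemma eqv_div x y x' y' : eqv x y -> eqv x' y' -> eqv (x / x') (y / y').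
Proof. by move=> h h'; apply: eqv_mul => //; exact: eqv_inv. Qed.

Lemma eqv_unit a b x : eqv (q ^+ a * (q - 1) ^+ b * x) x.
Proof. by exists 0%N, 0%N, a, b; rewrite !mul1r. Qed.

Lemma qint_expr n : q ^+ n - 1 = (q - 1) * qint q n.
Proof. exact: subrX1. Qed.

Lemma qint_neq0 n : qint q n.+1 != 0.
Proof.
have := q_nroot n; rewrite -subr_eq0 qint_expr mulf_eq0 negb_or.
by case/andP.
Qed.

Lemma qfact_neq0 n : qfact q n != 0.
Proof. by apply/prodf_neq0 => i _; exact: qint_neq0. Qed.

Lemma qH_neq0 n : qH q n != 0.
Proof. by apply/prodf_neq0 => i _; exact: qfact_neq0. Qed.

Lemma qfactS n : qfact q n.+1 = qfact q n * qint q n.+1.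
Proof. by rewrite /qfact big_ord_recr. Qed.

Lemma qHS n : qH q n.+1 = qH q n * qfact q n.
Proof. by rewrite /qH big_ord_recr. Qed.

Lemma qH0 : qH q 0 = 1.
Proof. by rewrite /qH big_ord0. Qed.

Lemma eqv_qden n : eqv (qden q n) (qfact q n).
Proof.
have -> : qden q n = q ^+ 0 * (q - 1) ^+ n * qfact q n; last exact: eqv_unit.
rewrite mul1r /qden; under eq_bigr => i _ do rewrite qint_expr.
by rewrite big_split /= prodr_const card_ord.
Qed.

Lemma eqv_qdens n : eqv (qdens q n) (qH q n).
Proof.
elim: n => [|n IH]; first by rewrite /qdens /qH !big_ord0; exact: eqv_refl.
rewrite qHS /qdens big_ord_recr; apply: eqv_mul => //; exact: eqv_qden.
Qed.

Lemma eqv_cross_point (p h l : nat) :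
  eqv (cross q [:: p] (iota (p + h.+1) l)) (qfact q (h + l) / qfact q h).
Proof.
elim: l h => [|l IH] h; first by rewrite cross_nilr addn0 divff ?qfact_neq0 //; exact: eqv_refl.
rewrite [iota _ _]/= -(cat1s _ (iota _ _)) cross_catr -addnS.
have -> : qfact q (h + l.+1) / qfact q h =
    qint q h.+1 * (qfact q (h.+1 + l) / qfact q h.+1).
  rewrite qfactS addSnnS; field; by rewrite qint_neq0 qfact_neq0.
apply: eqv_mul => //; rewrite /cross !big_seq1.
have -> : q ^+ (p + h.+1) - q ^+ p = q ^+ p * (q - 1) ^+ 1 * qint q h.+1.
  by rewrite expr1 -mulrA -qint_expr exprD; ring.
exact: eqv_unit.
Qed.

(** Adding an entry to the left block multiplies by a ratio of q-factorials, by [eqv_cross_point],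
    and these are quotients of successive values of [qH]. *)
Lemma eqv_cross_blocks (p k g l : nat) :
  eqv (cross q (iota p k) (iota (p + k + g) l))
      (qH q (k + g + l) * qH q g / (qH q (k + g) * qH q (g + l))).
Proof.
elim: k p => [|k IH] p.
  rewrite cross_nil add0n; apply: eq_eqv; field.
  by rewrite !qH_neq0.
rewrite [iota p _]/= cross_consl -addSnnS.
apply: eqv_trans.
  apply: eqv_mul (IH _); rewrite !addSnnS addnS -addnS -addnA.
  exact: eqv_cross_point.
rewrite !addSn !qHS; apply: eq_eqv; field.
by rewrite !qH_neq0 !qfact_neq0.
Qed.

Lemma eqv_vd_block (p k : nat) : eqv (vd q (iota p k)) (qH q k).
Proof.
elim: k p => [|k IH] p; first by rewrite qH0; exact: eqv_refl.
rewrite [iota _ _]/= [vd _ _]/= qHS mulrC; apply: eqv_mul => //.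
rewrite -addn1; apply: eqv_trans (eqv_cross_point _ _ _) _.
by rewrite add0n [qfact q 0]/qfact big_ord0 divr1; exact: eqv_refl.
Qed.

(* Alternating products over the prefixes of [c], so that [blockprod c] runs over
   all the segments of [c], as in [qs]. *)
Fixpoint rho (up : bool) (acc : nat) (c : seq nat) : F :=
  if c is k :: c' then
    (if up then qH q (acc + k) else (qH q (acc + k))^-1)
      * rho (~~ up) (acc + k) c'
  else 1.

Fixpoint blockprod (c : seq nat) : F :=
  if c is k :: c' then rho true 0 (k :: c') * blockprod c' else 1.

(** A list of odd length alternates blocks and gaps and ends with a block; the induction removes a
    block with the gap after it. *)
Lemma seq_ind2_odd (P : seq nat -> Prop) :
  (forall k, P [:: k]) -> (forall k g c, odd (size c) -> P c -> P (k :: g :: c)) ->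
  forall c, odd (size c) -> P c.
Proof.
move=> h1 h2 c; have [n] := ubnP (size c).
elim: n c => // n IH [|k [|g c]] //= /ltnW sn; rewrite negbK => oc.
by apply: h2 => //; apply: IH.
Qed.

(** Every block further right contributes by [eqv_cross_blocks]; [rho true (k + g)] collects the
    distances from the left end of the first block, [rho false g] those from its right end. *)
Lemma eqv_cross_lblk (p k : nat) (c : seq nat) : odd (size c) -> forall g,
  eqv (cross q (iota p k) (lblk true (p + k + g) c))
      (qH q g / qH q (k + g) * (rho true (k + g) c * rho false g c)).
Proof.
move: c; apply: seq_ind2_odd => [l|l g' c oc IH] g /=.
  rewrite cats0; apply: eqv_trans (eqv_cross_blocks _ _ _ _) _.
  by apply: eq_eqv; field; rewrite !qH_neq0.
rewrite cross_catr; apply: eqv_trans.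
  apply: eqv_mul; first exact: eqv_cross_blocks.
  by rewrite -!addnA addnA; exact: IH.
rewrite !addnA; apply: eq_eqv; field.
by rewrite !qH_neq0.
Qed.

Lemma eqv_vd_lblk (c : seq nat) : odd (size c) -> forall p,
  eqv (vd q (lblk true p c)) (blockprod c).
Proof.
move: c; apply: seq_ind2_odd => [l|l g c oc IH] p.
  by rewrite /= cats0 !mulr1; exact: eqv_vd_block.
rewrite [lblk _ _ _]/= vd_cat; apply: eqv_trans.
  apply: eqv_mul (IH _); apply: eqv_mul (eqv_vd_block _ _) _.
  exact: eqv_cross_lblk.
rewrite /= !add0n; apply: eq_eqv; field.
by rewrite !qH_neq0.
Qed.

Lemma segment_sumS (k : nat) (c : seq nat) i j :
  segment_sum (k :: c) i.+1 j.+1 = segment_sum c i j.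
Proof. by rewrite /segment_sum big_add1. Qed.

Lemma rhoE (up : bool) acc c : rho up acc c =
  (\prod_(j < size c | odd j == ~~ up) qH q (acc + segment_sum c 0 j)) /
  (\prod_(j < size c | odd j == up) qH q (acc + segment_sum c 0 j)).
Proof.
elim: c up acc => [|k c IH] up acc /=; first by rewrite !big_ord0 divr1.
have s0 : segment_sum (k :: c) 0 0 = k by rewrite /segment_sum big_nat1.
have sS j : (acc + segment_sum (k :: c) 0 j.+1 = acc + k + segment_sum c 0 j)%N.
  by rewrite /segment_sum big_nat_recl //= addnA.
have split b : \prod_(j < (size c).+1 | odd j == b)
    qH q (acc + segment_sum (k :: c) 0 j)
  = (if b then 1 else qH q (acc + k)) *
    \prod_(j < size c | odd j == ~~ b) qH q (acc + k + segment_sum c 0 j).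
  rewrite big_mkcond big_ord_recl /= s0; congr (_ * _); first by case: b.
  rewrite [RHS]big_mkcond; apply: eq_bigr => i _.
  by rewrite /bump add1n sS /= eqb_negLR.
rewrite IH !split negbK; case: up => /=; rewrite ?mul1r ?invfM; ring.
Qed.

Lemma qsE c : qs q c = (qH q (odd_sum c))^-1 * blockprod c.
Proof.
rewrite /qs; congr (_ * _); elim: c => [|k c IH].
  by rewrite !big_ord0 divr1.
rewrite [blockprod _]/= -/(rho true 0 (k :: c)) -IH rhoE.
have split (P : nat -> bool) :
  \prod_(i < size (k :: c)) \prod_(j < size (k :: c) | (i <= j)%N && P (j - i)%N)
     qH q (segment_sum (k :: c) i j)
  = \prod_(j < size (k :: c) | P j) qH q (segment_sum (k :: c) 0 j) *
    \prod_(i < size c) \prod_(j < size c | (i <= j)%N && P (j - i)%N)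
     qH q (segment_sum c i j).
  rewrite big_ord_recl; congr (_ * _).
    by apply: eq_bigl => j; rewrite subn0.
  apply: eq_bigr => i _; rewrite big_mkcond big_ord_recl /= mul1r.
  rewrite [RHS]big_mkcond; apply: eq_bigr => j _.
  by rewrite /bump !add1n ltnS subSS segment_sumS.
have := split (fun n => odd (n + 1)); have := split (fun n => ~~ odd (n + 1)).
move=> /= -> ->; rewrite invfM mulrACA; congr (_ * _); congr (_ / _).
  by apply: eq_bigl => j; rewrite addn1 /=; case: (odd j).
by apply: eq_bigl => j; rewrite addn1 /=; case: (odd j).
Qed.

(** With [sum_pats] and [eqv_qdens], this identifies [qs q c] with the weighted number of patterns
    over the blocks of [c]: it is a q-analogue of the Cohn-Larsen-Propp count of tilings of a dented
    trapezoid. *)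
Lemma eqv_vd_qs (c : seq nat) (p : nat) : odd (size c) ->
  eqv (vd q (lblk true p c)) (qs q c * qH q (odd_sum c)).
Proof.
move=> oc; rewrite qsE mulrAC mulVf ?qH_neq0 // mul1r; exact: eqv_vd_lblk.
Qed.

(** Induction on [y] with [L] and [R] free, as [Zsum_step] raises both. For [y = 0] only the empty
    list remains, and the sum is the product of two blocks at distance [z]. *)
Lemma eqv_Zsum (L R y z : nat) : eqv (Zsum q L R y z)
  (qH q y * qH q (L + R + y) / qH q (L + R + y + y) *
   (qH q (L + y) * qH q (R + y) * qH q (L + R + y + y + z) * qH q z /
     (qH q (L + y + z) * qH q (R + y + z)))).
Proof.
elim: y L R => [|y IH] L R.
  rewrite /Zsum; have -> : ksub L (0 + z) 0 = [:: [::]] by case: z.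
  rewrite big_seq1 /= !mul1r !addn0 vd_cat.
  apply: eqv_trans.
    apply: eqv_mul (eqv_vd_block _ _); apply: eqv_mul (eqv_vd_block _ _) _.
    exact: (eqv_cross_blocks 0).
  rewrite qH0 (_ : (L + z + R = L + R + z)%N); last by lia.
  rewrite (addnC z R); apply: eq_eqv; field; by rewrite !qH_neq0.
have [e [e' h]] := Zsum_step q L R y z.
have h' : eqv (Zsum q L R y.+1 z * qden q (L + R + y.+1))
              (qden q y * Zsum q L.+1 R.+1 y z).
  by exists e, 0%N, e', 0%N; rewrite !mulr1.
have nz : qden q (L + R + y.+1) != 0.
  by apply/prodf_neq0 => i _; rewrite subr_eq0.
have -> : Zsum q L R y.+1 z =
    Zsum q L R y.+1 z * qden q (L + R + y.+1) / qden q (L + R + y.+1).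
  by rewrite mulfK.
apply: eqv_trans.
  apply: eqv_div (eqv_qden _); apply: eqv_trans h' _.
  apply: eqv_mul (IH _ _); exact: eqv_qden.
rewrite !(addSn, addnS) !qHS; apply: eq_eqv; field.
by rewrite !qH_neq0 !qfact_neq0.
Qed.

End BlockVandermonde.

Local Open Scope classical_set_scope.

(** * Tilings and their lifts *)

Definition tri (up : bool) (i j : int) : triangle := (up, (i, j)).

Definition neighbours (tau : triangle) : seq triangle :=
  Eval cbv beta delta [tri] in
  let: (up, (i, j)) := tau in
  if up then [:: tri false i (j - 1); tri false (i - 1) j; tri false i j]
  else [:: tri true i (j + 1); tri true (i + 1) j; tri true i j].

Ltac ilia :=
  change (Algebra.BaseAddMagma.sort ssrint_int__canonical__Algebra_BaseAddMagma)
    with int in *;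
  lia.

Ltac vmem := rewrite /= ?inE ?xpair_eqE /=; lia.

Lemma share_edge_translate (b b' : bool) (p d : lattice_point) :
  share_edge (b, p) (b', p + d) = share_edge (b, 0) (b', d).
Proof.
have vE c w : vertices (c, p + w) = [seq p + v | v <- vertices (c, w)].
  case: p w => [i j] [k l]; case: c => /=;
    by rewrite /= -!addrA.
have -> : (b, p) = (b, p + 0) :> triangle by rewrite addr0.
rewrite /share_edge !vE count_map; congr andb.
  congr (~~ _); rewrite -[LHS]/((b == b') && (p + 0 == p + d)).
  by rewrite (inj_eq (addrI p)).
congr (_ == _)%N; apply: eq_count => v /=.
by rewrite mem_map //; exact: addrI.
Qed.

Lemma share_edgeE (tau tau' : triangle) :
  share_edge tau tau' = (tau' \in neighbours tau).
Proof.
case: tau => b [i j]; case: tau' => b' [i' j'].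
have [d ->] : exists d : lattice_point, (i', j') = (i, j) + d :> lattice_point.
  exists (i' - i, j' - j); by rewrite -[RHS]/(i + (i' - i), j + (j' - j)) !subrKC.
rewrite share_edge_translate; case: d => k l.
have -> : ((b', (i, j) + (k, l)) \in neighbours (b, (i, j)))
   = ((b', (k, l)) \in neighbours (b, (0, 0))).
  case: b; rewrite /= !inE !xpair_eqE /=; case: b'; rewrite //=; lia.
(* Displacements of absolute value at least 3 stay symbolic: no vertices can coincide, so they
   compute as well. *)
case: k => [[|[|[|k]]]|[|[|k]]]; case: l => [[|[|[|l]]]|[|[|l]]];
  case: b; case: b'; vm_compute; reflexivity.
Qed.

Lemma share_edge_sym (tau tau' : triangle) :
  share_edge tau tau' = share_edge tau' tau.
Proof.
rewrite !share_edgeE.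
case: tau => [[] [i j]]; case: tau' => [[] [i' j']];
  rewrite /= !inE !xpair_eqE /=; lia.
Qed.

Lemma set2_eq (T : Type) (a b c d : T) : c <> d ->
  [set a; b] = [set c; d] -> (a = c /\ b = d) \/ (a = d /\ b = c).
Proof.
move=> cd e; have ha : [set c; d] a by rewrite -e; left.
have hb : [set c; d] b by rewrite -e; right.
have hc : [set a; b] c by rewrite e; left.
have hd : [set a; b] d by rewrite e; right.
by case: ha hb hc hd => -> [] -> [] e1 [] e2; try (by left); try (by right);
  exfalso; congruence.
Qed.

Lemma set2C (T : Type) (a b : T) : [set a; b] = [set b; a].
Proof. by rewrite setUC. Qed.

Lemma share_edge_neq (tau tau' : triangle) : share_edge tau tau' -> tau <> tau'.
Proof. by case/andP => /eqP. Qed.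

Section Tilings.

Variables (R : set triangle) (T : set (set triangle)).
Hypothesis tilT : is_tiling R T.

Lemma tiling_pair (tau tau' : triangle) : T [set tau; tau'] ->
  [/\ R tau, R tau' & share_edge tau tau'].
Proof.
case/(proj1 tilT) => -[s [s' [ss e]]] sub; split.
- by apply: sub; left.
- by apply: sub; right.
case: (set2_eq (share_edge_neq ss) e) => -[-> ->] //.
by rewrite share_edge_sym.
Qed.

Lemma tiling_partner (tau : triangle) : R tau -> exists tau',
  T [set tau; tau'] /\ forall tau'', T [set tau; tau''] -> tau'' = tau'.
Proof.
move=> Rt; case: (proj2 tilT _ Rt) => l [[Tl lt] uniql].
have [[s [s' [ss e]]] _] := proj1 tilT _ Tl.
have [tau' [el tn]] : exists tau', l = [set tau; tau'] /\ tau <> tau'.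
  move: lt; rewrite e => -[->|->]; first by exists s'; split => //; exact: share_edge_neq.
  by exists s; split; [rewrite set2C|move/esym; exact: share_edge_neq].
exists tau'; split; first by rewrite -el.
move=> tau'' Tt''; have e'' : l = [set tau; tau''] by apply: uniql; split => //; left.
by case: (set2_eq tn (etrans (esym e'') el)) => -[] // -> ->.
Qed.

End Tilings.

Lemma tiling_sub (R : set triangle) (T T' : set (set triangle)) :
  is_tiling R T -> is_tiling R T' -> T `<=` T' -> T = T'.
Proof.
move=> h h' sub; apply/seteqP; split => // l T'l.
have [[s [s' [ss e]]] sl] := proj1 h' _ T'l.
have Rs : R s by apply: sl; rewrite e; left.
have [l' [[Tl' ls'] _]] := proj2 h _ Rs.
have [l0 [_ u]] := proj2 h' _ Rs.
rewrite -(u l) ?(u l') //; split => //; first exact: sub.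
by rewrite e; left.
Qed.

Definition pt (i j : int) : lattice_point := (i, j).

(** The last branch needs no test: two of the differences bounded in [steps] add up to the third,
    which leaves exactly one exceptional edge. *)
Definition mate (P : triangle -> lattice_point -> int) (tau : triangle) :
    triangle :=
  Eval cbv beta delta [tri pt] in
  let: (up, (i, j)) := tau in
  if up then
    if P tau (pt i j) - P tau (pt (i + 1) j) == 1 then tri false i (j - 1)
    else if P tau (pt i (j + 1)) - P tau (pt i j) == 1 then tri false (i - 1) j
    else tri false i j
  else
    if P tau (pt i (j + 1)) - P tau (pt (i + 1) (j + 1)) == 1
    then tri true i (j + 1)
    else if P tau (pt (i + 1) (j + 1)) - P tau (pt (i + 1) j) == 1
    then tri true (i + 1) j
    else tri true i j.

(* [P tau w] plays the role of the second coordinate of the lift of the corner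
   [(tau, w)]; an edge along which it takes its exceptional value is the
   diagonal of a lozenge. *)
Definition steps (P : triangle -> lattice_point -> int) (tau : triangle) :
    Prop :=
  Eval cbv beta delta [pt] in
  let: (up, (i, j)) := tau in
  if up then
    [/\ 0 <= P tau (pt i j) - P tau (pt (i + 1) j) <= 1,
        0 <= P tau (pt i (j + 1)) - P tau (pt i j) <= 1 &
        0 <= P tau (pt i (j + 1)) - P tau (pt (i + 1) j) <= 1]
  else
    [/\ 0 <= P tau (pt i (j + 1)) - P tau (pt (i + 1) (j + 1)) <= 1,
        0 <= P tau (pt (i + 1) (j + 1)) - P tau (pt (i + 1) j) <= 1 &
        0 <= P tau (pt i (j + 1)) - P tau (pt (i + 1) j) <= 1].

Definition point3 (a b c : int) : cubic_point := \row_k [:: a; b; c]`_k.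

Lemma heightD p p' : height (p + p') = height p + height p'.
Proof.
by rewrite /height -big_split; apply: eq_bigr => k _; rewrite mxE.
Qed.

Lemma height_axis k : height (axis_vec k) = 1.
Proof.
rewrite /height (bigD1 k) //= mxE !eqxx big1 ?addr0 // => j jk.
by rewrite mxE (negbTE jk) andbF.
Qed.

Lemma diag_proj_point3 a b c : diag_proj (point3 a b c) = (a - b, b - c).
Proof. by rewrite /diag_proj !mxE. Qed.

Lemma point3E (p : 'rV[int]_3) : p = point3 (p 0 0) (p 0 1) (p 0 ord_max).
Proof.
apply/rowP => -[[|[|[|k]]] hk] //; rewrite mxE /=;
  congr (p 0 _); exact/val_inj.
Qed.

Lemma axis_vecE (k : 'I_3) : axis_vec k =
  [:: point3 1 0 0; point3 0 1 0; point3 0 0 1]`_k.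
Proof.
by apply/rowP => l; case: k => -[|[|[|k]]] hk //; case: l => -[|[|[|l]]] hl //;
  rewrite !mxE.
Qed.

Lemma diag_proj_axis (k : 'I_3) : diag_proj (axis_vec k) =
  [:: (1, 0); (- 1, 1); (0, - 1)]`_k.
Proof.
rewrite axis_vecE; case: k => -[|[|[|k]]] hk //=; rewrite diag_proj_point3 //.
Qed.

Section LiftOfFunction.

Variables (R : set triangle) (P : triangle -> lattice_point -> int).
Hypothesis P_steps : forall tau, R tau -> steps P tau.
Hypothesis P_mate : forall tau, R tau -> R (mate P tau).
Hypothesis P_adj : forall tau tau' (w : lattice_point), R tau -> R tau' -> share_edge tau tau' ->
  w \in vertices tau -> w \in vertices tau' -> P tau w = P tau' w.

Definition tiling_of : set (set triangle) :=
  [set l | exists2 tau, R tau & l = [set tau; mate P tau]].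

(** The only cubic lattice point over [w] whose second coordinate is [P tau w]. *)
Definition lift_of : lifting := fun tau w =>
  point3 (P tau w + w.1) (P tau w) (P tau w - w.2).

Lemma mate_share tau : share_edge tau (mate P tau).
Proof.
rewrite share_edgeE; case: tau => [[] [i j]]; rewrite /mate /neighbours.
  by do 2?[case: ifP => _]; rewrite !inE eqxx ?orbT.
by do 2?[case: ifP => _]; rewrite !inE eqxx ?orbT.
Qed.

(** The exceptional edge of [tau] is shared with its mate, on which [P] has the same values by
    [P_adj]; hence it is also the exceptional edge of the mate. *)
Lemma mateK tau : R tau -> mate P (mate P tau) = tau.
Proof.
move=> Rt; have st := P_steps Rt; have Rm := P_mate Rt.
have sm := P_steps Rm; have adj (w : lattice_point) := P_adj Rt Rm (mate_share tau) (w := w).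
case: tau Rt st Rm sm adj => [[] [i j]] Rt; rewrite /steps /mate.
- case: ifP => [e|ne].
    rewrite !subrK => _ Rm _ adj.
    have e1 : _ := adj (i, j) ltac:(vmem) ltac:(vmem).
    have e2 : _ := adj (i + 1, j) ltac:(vmem) ltac:(vmem).
    by rewrite -e1 -e2 e.
  case: ifP => [e|ne'].
    rewrite !subrK => [[h1 h2 h3] Rm [h4 h5 h6] adj].
    have e1 : _ := adj (i, j) ltac:(vmem) ltac:(vmem).
    have e2 : _ := adj (i, j + 1) ltac:(vmem) ltac:(vmem).
    by rewrite -e1 -e2 e ifF //; ilia.
  move=> [h1 h2 h3] Rm [h4 h5 h6] adj.
  have e1 : _ := adj (i + 1, j) ltac:(vmem) ltac:(vmem).
  have e2 : _ := adj (i, j + 1) ltac:(vmem) ltac:(vmem).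
  by rewrite !ifF //; ilia.
- case: ifP => [e|ne].
    rewrite !addrK => _ Rm _ adj.
    have e1 : _ := adj (i, j + 1) ltac:(vmem) ltac:(vmem).
    have e2 : _ := adj (i + 1, j + 1) ltac:(vmem) ltac:(vmem).
    by rewrite -e1 -e2 e.
  case: ifP => [e|ne'].
    rewrite !addrK => [[h1 h2 h3] Rm [h4 h5 h6] adj].
    have e1 : _ := adj (i + 1, j) ltac:(vmem) ltac:(vmem).
    have e2 : _ := adj (i + 1, j + 1) ltac:(vmem) ltac:(vmem).
    by rewrite -e1 -e2 e ifF //; ilia.
  move=> [h1 h2 h3] Rm [h4 h5 h6] adj.
  have e1 : _ := adj (i + 1, j) ltac:(vmem) ltac:(vmem).
  have e2 : _ := adj (i, j + 1) ltac:(vmem) ltac:(vmem).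
  by rewrite !ifF //; ilia.
Qed.

Lemma tiling_ofP : is_tiling R tiling_of.
Proof.
split=> [l [tau Rt ->]|tau Rt].
  split; first by exists tau, (mate P tau); split => //; exact: mate_share.
  by move=> s [->|->] //; exact: P_mate.
exists [set tau; mate P tau]; split; first by split; [exists tau|left].
move=> l [[s Rs ->] [->|->]] //.
by rewrite mateK // set2C.
Qed.

Lemma lozenge_side_of tau w w' : R tau ->
  lozenge_side tiling_of tau w w' <->
  ~ (w \in vertices (mate P tau) /\ w' \in vertices (mate P tau)).
Proof.
move=> Rt; split=> [h [h1 h2]|h l tau' [s Rs ->] lt lt' h1 h2].
  have := h [set tau; mate P tau] (mate P tau).
  have ne := share_edge_neq (mate_share tau).
  move=> h'; apply: ne; rewrite h' //; [by exists tau|by left|by right].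
have e : s = tau \/ mate P s = tau by case: lt => ->; [left|right].
have {lt lt'}[//|e'] : tau' = tau \/ tau' = mate P tau.
  case: e lt' => [->|<-] [->|->]; try (by left); try by right.
  by rewrite mateK //; right.
by rewrite e' in h1 h2; case: h.
Qed.

Lemma uncrossed_step tau (w w' : lattice_point) (k : 'I_3) : R tau ->
  w \in vertices tau -> w' \in vertices tau ->
  w' = w + diag_proj (axis_vec k) ->
  ~ (w \in vertices (mate P tau) /\ w' \in vertices (mate P tau)) ->
  P tau w' = P tau w + ((k : nat) == 1%N)%:R.
Proof.
move=> Rt; case: w => wi wj; case: w' => wi' wj' hw hw' e.
have := congr1 snd e; have := congr1 fst e; move: hw hw'.
rewrite {e} diag_proj_axis; have := P_steps Rt.
case: tau Rt => [[] [i j]] Rt; case: k => -[|[|[|k]]] hk //= st;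
rewrite /= !inE !xpair_eqE ?addr0 => h h' e e'.
- have [-> -> -> ->] : [/\ wi = i, wj = j, wi' = i + 1 & wj' = j].
    by split; ilia.
  case: st => s1 s2 s3; case: ifP => [_ []|/negbT ne _]; last by ilia.
  by split; vmem.
- have [-> -> -> ->] : [/\ wi = i + 1, wj = j, wi' = i & wj' = j + 1].
    by split; ilia.
  case: st => s1 s2 s3; case: ifP => [/eqP e1 _|/negbT ne]; first by ilia.
  case: ifP => [/eqP e1 _|/negbT ne' []]; first by ilia.
  by split; vmem.
- have [-> -> -> ->] : [/\ wi = i, wj = j + 1, wi' = i & wj' = j].
    by split; ilia.
  case: st => s1 s2 s3; case: ifP => [/eqP e1 _|/negbT ne]; first by ilia.
  case: ifP => [/eqP e1 []|/negbT ne' _]; last by ilia.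
  by split; vmem.
- have [-> -> -> ->] : [/\ wi = i, wj = j + 1, wi' = i + 1 & wj' = j + 1].
    by split; ilia.
  case: st => s1 s2 s3; case: ifP => [_ []|/negbT ne _]; last by ilia.
  by split; vmem.
- have [-> -> -> ->] : [/\ wi = i + 1, wj = j, wi' = i & wj' = j + 1].
    by split; ilia.
  case: st => s1 s2 s3; case: ifP => [/eqP e1 _|/negbT ne]; first by ilia.
  case: ifP => [/eqP e1 _|/negbT ne' []]; first by ilia.
  by split; vmem.
- have [-> -> -> ->] : [/\ wi = i + 1, wj = j + 1, wi' = i + 1 & wj' = j].
    by split; ilia.
  case: st => s1 s2 s3; case: ifP => [/eqP e1 _|/negbT ne]; first by ilia.
  case: ifP => [/eqP e1 []|/negbT ne' _]; last by ilia.
  by split; vmem.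
Qed.

Lemma lift_ofP : is_lift R tiling_of lift_of.
Proof.
split.
- by move=> tau [i j] _ _; rewrite /lift_of diag_proj_point3 /=; congr (_, _); ring.
- by move=> tau tau' w Rt Rt' s h h'; rewrite /lift_of (P_adj Rt Rt' s h h').
move=> tau w w' k Rt hw hw' e /(lozenge_side_of _ _ Rt) side.
rewrite /lift_of (uncrossed_step Rt hw hw' e side) e diag_proj_axis axis_vecE.
case: k e side => -[|[|[|k]]] hk //= _ _; apply/rowP => l; rewrite !mxE;
  case: l => -[|[|[|l]]] hl //=; case: w {hw} => i j /=; ring.
Qed.

Section LiftHeight.

Variable L : lifting.
Hypothesis L_lift : is_lift R tiling_of L.

(* Difference in height between [L] and [lift_of]: constant on triangles, and
   hence the sole freedom in the choice of a lift. *)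
Definition defect (tau : triangle) (w : lattice_point) : int :=
  height (L tau w) - (3 * P tau w + w.1 - w.2).

Lemma defect_step tau (w w' : lattice_point) (k : 'I_3) : R tau ->
  w \in vertices tau -> w' \in vertices tau ->
  w' = w + diag_proj (axis_vec k) ->
  ~~ ((w \in vertices (mate P tau)) && (w' \in vertices (mate P tau))) ->
  defect tau w = defect tau w'.
Proof.
move=> Rt hw hw' e /negP side; case: L_lift => _ _ st.
have side' : ~ (w \in vertices (mate P tau) /\ w' \in vertices (mate P tau)).
  by move=> h; apply: side; apply/andP.
rewrite /defect (st tau w w' k Rt hw hw' e); last exact/lozenge_side_of.
rewrite heightD height_axis (uncrossed_step Rt hw hw' e side') e diag_proj_axis.
by case: k {e} => -[|[|[|k]]] hk //=; case: w {hw side side'} => i j /=; ring.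
Qed.

(** Only one edge of a triangle is the diagonal of its lozenge. The two others connect the three
    vertices, and [defect_step] applies to them. *)
Lemma defect_triangle tau (w w' : lattice_point) : R tau ->
  w \in vertices tau -> w' \in vertices tau -> defect tau w = defect tau w'.
Proof.
move=> Rt.
suff [w0 h] : exists w0, forall v, v \in vertices tau ->
    defect tau v = defect tau w0 by move=> hw hw'; rewrite (h w) // (h w').
pose k0 : 'I_3 := inord 0; pose k1 : 'I_3 := inord 1; pose k2 : 'I_3 := inord 2.
have e0 : diag_proj (axis_vec k0) = (1, 0) by rewrite diag_proj_axis inordK.
have e1 : diag_proj (axis_vec k1) = (- 1, 1) by rewrite diag_proj_axis inordK.
have e2 : diag_proj (axis_vec k2) = (0, - 1) by rewrite diag_proj_axis inordK.
have e (a b c d dx dy : int) : c = a + dx -> d = b + dy ->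
    (c, d) = (a, b) + (dx, dy) :> lattice_point by move=> -> ->.
have step (a b c d : int) k := @defect_step tau (a, b) (c, d) k Rt.
case: tau Rt step => [[] [i j]] Rt step.
- have s0 := step i j (i + 1) j k0; have s1 := step (i + 1) j i (j + 1) k1.
  have s2 := step i (j + 1) i j k2.
  rewrite e0 in s0; rewrite e1 in s1; rewrite e2 in s2.
  have {}s0 := s0 ltac:(vmem) ltac:(vmem) ltac:(apply: e; ring).
  have {}s1 := s1 ltac:(vmem) ltac:(vmem) ltac:(apply: e; ring).
  have {}s2 := s2 ltac:(vmem) ltac:(vmem) ltac:(apply: e; ring).
  exists (i, j) => v; rewrite /= !inE => hv.
  suff [h1 h2] : defect (true, (i, j)) (i, j) = defect (true, (i, j)) (i + 1, j)
      /\ defect (true, (i, j)) (i, j) = defect (true, (i, j)) (i, j + 1).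
    by case/or3P: hv => /eqP -> //; rewrite -?h1 -?h2.
  move: s0 s1 s2; rewrite /mate; do 2?[case: ifP => _] => s0 s1 s2.
  + by rewrite s1 ?s2 //; vmem.
  + by rewrite s0 ?s1 //; vmem.
  + by rewrite s2 ?s0 //; vmem.
- have s0 := step i (j + 1) (i + 1) (j + 1) k0.
  have s1 := step (i + 1) j i (j + 1) k1.
  have s2 := step (i + 1) (j + 1) (i + 1) j k2.
  rewrite e0 in s0; rewrite e1 in s1; rewrite e2 in s2.
  have {}s0 := s0 ltac:(vmem) ltac:(vmem) ltac:(apply: e; ring).
  have {}s1 := s1 ltac:(vmem) ltac:(vmem) ltac:(apply: e; ring).
  have {}s2 := s2 ltac:(vmem) ltac:(vmem) ltac:(apply: e; ring).
  exists (i + 1, j) => v; rewrite /= !inE => hv.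
  suff [h1 h2] : defect (false, (i, j)) (i + 1, j)
        = defect (false, (i, j)) (i, j + 1)
      /\ defect (false, (i, j)) (i + 1, j)
        = defect (false, (i, j)) (i + 1, j + 1).
    by case/or3P: hv => /eqP -> //; rewrite -?h1 -?h2.
  move: s0 s1 s2; rewrite /mate; do 2?[case: ifP => _] => s0 s1 s2.
  + by rewrite s2 ?s1 //; vmem.
  + by rewrite s1 ?s0 //; vmem.
  + by rewrite s0 ?s2 //; vmem.
Qed.

End LiftHeight.

End LiftOfFunction.

(** * From height functions to tilings *)

Section Embedding.

Variables (D : halves) (x : nat).
Hypothesis wf : wf_halves D.

(** The shift by [x] makes all abscissas natural numbers, including those of the extra lobe to the
    left of the lower half. In that half, moving away from the axis at a fixed abscissa is a step
    along u - v. *)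
Definition ept (s : bool) (r i : nat) : lattice_point :=
  if s then pt (i%:Z - x%:Z) (x%:Z + r%:Z)
  else pt (i%:Z + r%:Z - x%:Z) (x%:Z - r%:Z).

Definition emb (s up : bool) (r i : nat) : triangle :=
  if s then tri up (i%:Z - x%:Z) (x%:Z + r%:Z)
  else if up then tri false (i%:Z + r%:Z - x%:Z) (x%:Z - r%:Z - 1)
  else tri true (i%:Z + r%:Z + 1 - x%:Z) (x%:Z - r%:Z - 1).

(* The cell on the other side of the horizontal side of an up-pointing cell. *)
Definition below (s : bool) (r i : nat) : triangle :=
  if r is r'.+1 then emb s false r' i else emb (~~ s) true 0 i.

Definition RD : set triangle :=
  [set tau | exists s up r i, inR D s up r i /\ tau = emb s up r i].

Lemma emb_inj s up r i s' up' r' i' : emb s up r i = emb s' up' r' i' ->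
  [/\ s = s', up = up', r = r' & i = i'].
Proof.
case: s; case: s'; case: up; case: up' => // -[h1 h2];
  by split => //; lia.
Qed.

Lemma RDE s up r i : RD (emb s up r i) <-> inR D s up r i.
Proof.
split=> [[s' [up' [r' [i' [h /emb_inj[-> -> -> ->]]]]]]|h] //.
by exists s, up, r, i.
Qed.

Lemma pt_eq (a b c d : int) : a = c -> b = d -> pt a b = pt c d.
Proof. by move=> -> ->. Qed.

Lemma tri_eq u (a b c d : int) : a = c -> b = d -> tri u a b = tri u c d.
Proof. by move=> -> ->. Qed.

Lemma vertices_emb s up r i (w : lattice_point) :
  w \in vertices (emb s up r i) ->
  exists r' i', w = ept s r' i' /\
    if up then [\/ r' = r /\ i' = i, r' = r /\ i' = i.+1 | r' = r.+1 /\ i' = i]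
    else [\/ r' = r /\ i' = i.+1, r' = r.+1 /\ i' = i | r' = r.+1 /\ i' = i.+1].
Proof.
case: s; case: up; rewrite /= !inE => /or3P[]/eqP ->.
- by exists r, i; split; [|constructor 1].
- by exists r, i.+1; split; [apply: pt_eq; lia|constructor 2].
- by exists r.+1, i; split; [apply: pt_eq; lia|constructor 3].
- by exists r, i.+1; split; [apply: pt_eq; lia|constructor 1].
- by exists r.+1, i; split; [apply: pt_eq; lia|constructor 2].
- by exists r.+1, i.+1; split; [apply: pt_eq; lia|constructor 3].
- by exists r.+1, i; split; [apply: pt_eq; lia|constructor 3].
- by exists r, i; split; [apply: pt_eq; lia|constructor 1].
- by exists r, i.+1; split; [apply: pt_eq; lia|constructor 2].
- by exists r.+1, i; split; [apply: pt_eq; lia|constructor 2].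
- by exists r.+1, i.+1; split; [apply: pt_eq; lia|constructor 3].
- by exists r, i.+1; split; [apply: pt_eq; lia|constructor 1].
Qed.

Lemma nbr_up s r i (tau : triangle) : share_edge (emb s true r i) tau -> RD tau ->
  [\/ tau = below s r i, tau = emb s false r i |
      exists2 i', i = i'.+1 & tau = emb s false r i'].
Proof.
rewrite share_edgeE => h Rt; move: h.
case: s; rewrite /= !inE => /or3P[]/eqP e.
- constructor 1; rewrite e; case: r {e} => [|r]; apply: tri_eq; lia.
- constructor 3; case: i e => [|i] e; last by exists i => //; rewrite e; apply: tri_eq; lia.
  (* At [i = 0] the left neighbour would have a negative abscissa, so it is no cell of the
     region. *)
  case: Rt => s' [up' [r' [i' [_]]]]; rewrite e.
  by case: s'; case: up' => //= -[]; lia.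
- by constructor 2; rewrite e.
- constructor 1; rewrite e; case: r {e} => [|r]; apply: tri_eq; lia.
- by constructor 2; rewrite e; apply: tri_eq; lia.
- constructor 3; case: i e => [|i] e; last by exists i => //; rewrite e; apply: tri_eq; lia.
  case: Rt => s' [up' [r' [i' [_]]]]; rewrite e.
  by case: s'; case: up' => //= -[]; lia.
Qed.

Lemma nbr_dn s r i (tau : triangle) : share_edge (emb s false r i) tau ->
  [\/ tau = emb s true r.+1 i, tau = emb s true r i |
      tau = emb s true r i.+1].
Proof.
rewrite share_edgeE; case: s; rewrite /= !inE => /or3P[]/eqP ->.
- by constructor 1; apply: tri_eq; lia.
- by constructor 3; apply: tri_eq; lia.
- by constructor 2; apply: tri_eq; lia.
- by constructor 1; apply: tri_eq; lia.
- by constructor 2; apply: tri_eq; lia.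
- by constructor 3; apply: tri_eq; lia.
Qed.

Lemma mid_axis i : inR D true true 0 i -> inR D false true 0 i ->
  (ml D <= i < mr D)%N.
Proof.
move=> h h'; apply: (wf_cover wf) => s.
have : inR D s true 0 i by case: s.
rewrite /inR /clen add0n (wf_lob wf) => /and4P[h1 h2 _ ->]; lia.
Qed.

(* The shift that glues the two halves along the middle of the axis, where their
   heights count different numbers of dents to the left. *)
Definition delta : int := (size (Bl D false))%:Z - (size (Bl D true))%:Z.

(** The case depends on the triangle and not on [w], so that a point of the axis may have one value
    on each side. Below the axis, a step away from it is opposite to the second coordinate vector,
    whence the term subtracting the row number. *)
Definition corner (h : bool -> nat -> nat -> nat) (tau : triangle)
    (w : lattice_point) : int :=
  if x%:Z <= tau.2.2 then - (h true (absz (w.2 - x%:Z)) (absz (w.1 + x%:Z)))%:Z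
  else delta - (absz (w.2 - x%:Z))%:Z - (h false (absz (w.2 - x%:Z)) (absz (w.1 + w.2)))%:Z.

Definition hval (h : bool -> nat -> nat -> nat) (s : bool) (r i : nat) : int :=
  if s then - (h true r i)%:Z else delta - r%:Z - (h false r i)%:Z.

Lemma corner_ept h s up r i r' i' :
  corner h (emb s up r i) (ept s r' i') = hval h s r' i'.
Proof.
rewrite /corner /hval; case: s; rewrite /=.
  rewrite lerDl //= (_ : absz (x%:Z + r'%:Z - x%:Z)%R = r'); last by lia.
  by rewrite (_ : absz (i'%:Z - x%:Z + x%:Z)%R = i') //; lia.
have -> : (x%:Z <= (if up then tri false (i%:Z + r%:Z - x%:Z) (x%:Z - r%:Z - 1)
   else tri true (i%:Z + r%:Z + 1 - x%:Z) (x%:Z - r%:Z - 1)).2.2) = false.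
  by case: up; rewrite /=; lia.
rewrite (_ : absz (x%:Z - r'%:Z - x%:Z)%R = r'); last by lia.
by rewrite (_ : absz (i'%:Z + r'%:Z - x%:Z + (x%:Z - r'%:Z))%R = i') //; lia.
Qed.

Lemma corner_at h s up r i (w : lattice_point) r' i' : w = ept s r' i' ->
  corner h (emb s up r i) w = hval h s r' i'.
Proof. by move=> ->; exact: corner_ept. Qed.

Lemma corner_tt h r i (I := i%:Z - x%:Z) (J := x%:Z + r%:Z) :
  [/\ corner h (tri true I J) (pt I J) = hval h true r i,
      corner h (tri true I J) (pt (I + 1) J) = hval h true r i.+1 &
      corner h (tri true I J) (pt I (J + 1)) = hval h true r.+1 i].
Proof.
by split; apply: (@corner_at h true true r i); apply: pt_eq; lia.
Qed.

Lemma corner_tf h r i (I := i%:Z - x%:Z) (J := x%:Z + r%:Z) :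
  [/\ corner h (tri false I J) (pt (I + 1) J) = hval h true r i.+1,
      corner h (tri false I J) (pt I (J + 1)) = hval h true r.+1 i &
      corner h (tri false I J) (pt (I + 1) (J + 1)) = hval h true r.+1 i.+1].
Proof.
by split; apply: (@corner_at h true false r i); apply: pt_eq; lia.
Qed.

Lemma corner_ft h r i (I := i%:Z + r%:Z - x%:Z) (J := x%:Z - r%:Z - 1) :
  [/\ corner h (tri false I J) (pt (I + 1) J) = hval h false r.+1 i,
      corner h (tri false I J) (pt I (J + 1)) = hval h false r i &
      corner h (tri false I J) (pt (I + 1) (J + 1)) = hval h false r i.+1].
Proof.
by split; apply: (@corner_at h false true r i); apply: pt_eq; lia.
Qed.

Lemma corner_ff h r i (I := i%:Z + r%:Z + 1 - x%:Z) (J := x%:Z - r%:Z - 1) :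
  [/\ corner h (tri true I J) (pt I J) = hval h false r.+1 i,
      corner h (tri true I J) (pt (I + 1) J) = hval h false r.+1 i.+1 &
      corner h (tri true I J) (pt I (J + 1)) = hval h false r i.+1].
Proof.
by split; apply: (@corner_at h false false r i); apply: pt_eq; lia.
Qed.

Section CornerTiling.

Variable h : bool -> nat -> nat -> nat.
Hypothesis H : isHF D h.

Lemma corner_steps tau : RD tau -> steps (corner h) tau.
Proof.
case=> s [up [r [i [inr ->]]]]; have rN : (r < rows D s)%N by case/and4P: inr.
have := hf_vert H i rN; have := hf_vert H i.+1 rN.
have := hf_diag H i rN; have := hf_horiz H s r i.
have := hf_horiz H s r.+1 i.
case: s {inr rN}; case: up => v v' d z z'; rewrite /steps /emb.
- by case: (corner_tt h r i); rewrite /tri /pt => -> -> ->; rewrite /hval; split; lia.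
- by case: (corner_tf h r i); rewrite /tri /pt => -> -> ->; rewrite /hval; split; lia.
- by case: (corner_ft h r i); rewrite /tri /pt => -> -> ->; rewrite /hval; split; lia.
- by case: (corner_ff h r i); rewrite /tri /pt => -> -> ->; rewrite /hval; split; lia.
Qed.

Lemma mate_upV s r i : h s r i.+1 = (h s r i).+1 ->
  mate (corner h) (emb s true r i) = below s r i.
Proof.
move=> e; case: s e => e; rewrite /mate /emb.
- case: (corner_tt h r i); rewrite /tri /pt => -> -> _; rewrite /hval.
  rewrite ifT; last by lia.
  by case: r e => [|r] e; apply: tri_eq; lia.
- case: (corner_ft h r i); rewrite /tri /pt => -> -> ->; rewrite /hval.
  rewrite ifT; last by lia.
  by case: r e => [|r] e; apply: tri_eq; lia.
Qed.

Lemma mate_upL s r i : (r < rows D s)%N -> h s r i.+1 = (h s r.+1 i.+1).+1 ->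
  mate (corner h) (emb s true r i.+1) = emb s false r i.
Proof.
move=> rN e; have d := hf_diag H i.+1 rN; have z := hf_horiz H s r i.+1.
case: s rN e d z => rN e d z; rewrite /mate /emb.
- case: (corner_tt h r i.+1); rewrite /tri /pt => -> -> ->; rewrite /hval.
  rewrite ifF; last by lia.
  by rewrite ifT; [apply: tri_eq|]; lia.
- case: (corner_ft h r i.+1); rewrite /tri /pt => -> -> ->; rewrite /hval.
  rewrite ifF; last by lia.
  by rewrite ifF; [apply: tri_eq|]; lia.
Qed.

Lemma mate_upR s r i : (r < rows D s)%N -> h s r i.+1 = h s r.+1 i ->
  mate (corner h) (emb s true r i) = emb s false r i.
Proof.
move=> rN e; have d := hf_vert H i rN; have z := hf_horiz H s r i.
case: s rN e d z => rN e d z; rewrite /mate /emb.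
- case: (corner_tt h r i); rewrite /tri /pt => -> -> ->; rewrite /hval.
  rewrite ifF; last by lia.
  by rewrite ifF; [apply: tri_eq|]; lia.
- case: (corner_ft h r i); rewrite /tri /pt => -> -> ->; rewrite /hval.
  rewrite ifF; last by lia.
  by rewrite ifT; [apply: tri_eq|]; lia.
Qed.

Lemma mate_dnV s r i : h s r.+1 i.+1 = (h s r.+1 i).+1 ->
  mate (corner h) (emb s false r i) = emb s true r.+1 i.
Proof.
move=> e; case: s e => e; rewrite /mate /emb.
- case: (corner_tf h r i); rewrite /tri /pt => _ -> ->; rewrite /hval.
  by rewrite ifT; [apply: tri_eq|]; lia.
- case: (corner_ff h r i); rewrite /tri /pt => -> -> _; rewrite /hval.
  by rewrite ifT; [apply: tri_eq|]; lia.
Qed.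

Lemma mate_dnL s r i : (r < rows D s)%N -> h s r i.+1 = (h s r.+1 i.+1).+1 ->
  mate (corner h) (emb s false r i) = emb s true r i.+1.
Proof.
move=> rN e; have d := hf_diag H i rN; have z := hf_horiz H s r.+1 i.
case: s rN e d z => rN e d z; rewrite /mate /emb.
- case: (corner_tf h r i); rewrite /tri /pt => -> -> ->; rewrite /hval.
  rewrite ifF; last by lia.
  by rewrite ifT; [apply: tri_eq|]; lia.
- case: (corner_ff h r i); rewrite /tri /pt => -> -> ->; rewrite /hval.
  rewrite ifF; last by lia.
  by rewrite ifF; [apply: tri_eq|]; lia.
Qed.

Lemma mate_dnR s r i : (r < rows D s)%N -> h s r i.+1 = h s r.+1 i ->
  mate (corner h) (emb s false r i) = emb s true r i.
Proof.
move=> rN e; have d := hf_vert H i.+1 rN; have z := hf_horiz H s r.+1 i.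
case: s rN e d z => rN e d z; rewrite /mate /emb.
- case: (corner_tf h r i); rewrite /tri /pt => -> -> ->; rewrite /hval.
  rewrite ifF; last by lia.
  by rewrite ifF; [apply: tri_eq|]; lia.
- case: (corner_ff h r i); rewrite /tri /pt => -> -> ->; rewrite /hval.
  rewrite ifF; last by lia.
  by rewrite ifT; [apply: tri_eq|]; lia.
Qed.

Lemma up_cases s r i : (r < rows D s)%N ->
  [\/ h s r i.+1 = (h s r i).+1, h s r i = (h s r.+1 i).+1 |
      h s r i.+1 = h s r.+1 i].
Proof.
move=> rN; have := hf_vert H i rN; have := hf_diag H i rN.
have := hf_horiz H s r i => z d v.
case: (eqVneq (h s r i.+1) (h s r i).+1) => [|n1]; first by constructor 1.
case: (eqVneq (h s r i) (h s r.+1 i).+1) => [|n2]; first by constructor 2.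
by constructor 3; lia.
Qed.

Lemma dn_cases s r i : (r < rows D s)%N ->
  [\/ h s r.+1 i.+1 = (h s r.+1 i).+1, h s r i.+1 = (h s r.+1 i.+1).+1 |
      h s r i.+1 = h s r.+1 i].
Proof.
move=> rN; have := hf_vert H i.+1 rN; have := hf_diag H i rN.
have := hf_horiz H s r.+1 i => z d v.
case: (eqVneq (h s r.+1 i.+1) (h s r.+1 i).+1) => [|n1]; first by constructor 1.
case: (eqVneq (h s r i.+1) (h s r.+1 i.+1).+1) => [|n2]; first by constructor 2.
by constructor 3; lia.
Qed.

Lemma corner_mate tau : RD tau -> RD (mate (corner h) tau).
Proof.
case=> s [up [r [i [inr ->]]]]; have rN : (r < rows D s)%N by case/and4P: inr.
case: up inr => inr.
- case: (up_cases i rN) => e.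
  + rewrite mate_upV //; case: r inr e {rN} => [|r] inr e /=; apply/RDE.
      exact: (cross_axis wf H inr e).
    exact: cross_upV.
  + have [i' ei inr'] := cross_upL wf H inr e; rewrite ei in e *.
    by rewrite mate_upL //; apply/RDE.
  + by rewrite mate_upR //; apply/RDE; exact: (cross_upR wf H).
- case: (dn_cases i rN) => e.
  + by rewrite mate_dnV //; apply/RDE; exact: (cross_dnV H).
  + by rewrite mate_dnL //; apply/RDE; exact: (cross_dnL wf H).
  + by rewrite mate_dnR //; apply/RDE; exact: (cross_dnR wf H).
Qed.

Lemma hval_axis i : (ml D <= i <= mr D)%N -> hval h true 0 i = hval h false 0 i.
Proof.
move=> im; have := hf_axis H i; rewrite /hval /delta !(cntB_mid wf) //; lia.
Qed.

(** Adjacent cells of different halves face each other across the axis; by [mid_axis] this happens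
    only along the gap, where [hval_axis] matches the two expressions. *)
Lemma corner_adj tau tau' (w : lattice_point) : RD tau -> RD tau' ->
  share_edge tau tau' -> w \in vertices tau -> w \in vertices tau' ->
  corner h tau w = corner h tau' w.
Proof.
wlog : tau tau' / x%:Z <= tau.2.2.
  move=> wl Rt Rt' st wt wt'; case: (boolP (x%:Z <= tau.2.2)) => xt.
    exact: wl.
  case: (boolP (x%:Z <= tau'.2.2)) => xt'.
    by apply/esym; apply: wl => //; rewrite share_edge_sym.
  by rewrite /corner (negbTE xt) (negbTE xt').
move=> xt Rt Rt' st wt wt'; case: (boolP (x%:Z <= tau'.2.2)) => xt'.
  by rewrite /corner xt xt'.
case: Rt => s [up [r [i [inr et]]]]; case: Rt' => s' [up' [r' [i' [inr' et']]]].
have es : s = true by move: xt; rewrite et; case: s {inr et} => //; case: up; rewrite /=; lia.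
have es' : s' = false.
  move: xt'; rewrite et'; case: s' {inr' et'} => //.
  by rewrite /=; lia.
rewrite {}es {s} in et inr; rewrite {}es' {s'} in et' inr'.
have [eup er] : up = true /\ r = 0%N.
  move: st; rewrite share_edgeE et et'.
  case: up {inr et}; case: up' {inr' et'}; rewrite /= !inE ?xpair_eqE //=; try lia.
rewrite {}eup {}er {up r} in et inr.
have [eup er ei] : [/\ up' = true, r' = 0%N & i' = i].
  move: st; rewrite share_edgeE et et'.
  case: up' {inr' et'}; rewrite /= !inE ?xpair_eqE //=; try lia.
  by move=> h0; split => //; lia.
rewrite {}eup {}er {}ei {up' r' i'} in et' inr'.
have im := mid_axis inr inr'.
rewrite et in wt *; rewrite et' in wt' *.
have [r1 [i1 [ew hw]]] := vertices_emb wt.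
have [r2 [i2 [ew' hw']]] := vertices_emb wt'.
rewrite (corner_at _ _ _ _ ew) (corner_at _ _ _ _ ew').
have [er1 er2] : r1 = 0%N /\ r2 = 0%N.
  move: ew'; rewrite ew => -[_]; lia.
have ei : i1 = i2 by move: ew'; rewrite ew er1 er2 => -[]; lia.
by rewrite er1 er2 -ei; apply: hval_axis; case: hw => -[_ ->]; lia.
Qed.

Definition tilingD : set (set triangle) := tiling_of RD (corner h).

Lemma tilingDP : is_tiling RD tilingD.
Proof.
by apply: tiling_ofP; [exact: corner_steps|exact: corner_mate|exact: corner_adj].
Qed.

Lemma liftDP : is_lift RD tilingD (lift_of (corner h)).
Proof.
by apply: lift_ofP; [exact: corner_steps|exact: corner_mate|exact: corner_adj].
Qed.

End CornerTiling.

End Embedding.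

Local Close Scope ring_scope.

(** * From tilings to height functions *)

Section HeightFunctionOfTiling.

Variables (D : halves) (x : nat).
Hypothesis wf : wf_halves D.
Variable T : set (set triangle).
Hypothesis tilT : is_tiling (RD D x) T.

Local Notation emb := (emb x).
Local Notation below := (below x).

Let N := rows D.

(* [tmV], [tmL], [tmR]: the up-pointing cell is matched with the cell across its
   horizontal side, or in the same half to its left or to its right. *)
Definition tm (a b : triangle) : bool := `[< T [set a; b] >].
Definition tmV s r i := tm (emb s true r i) (below s r i).
Definition tmL s r i := tm (emb s true r i.+1) (emb s false r i).
Definition tmLp s r i := if i is i'.+1 then tmL s r i' else false.
Definition tmR s r i := tm (emb s true r i) (emb s false r i).

Lemma tmC a b : tm a b = tm b a.
Proof. by rewrite /tm set2C. Qed.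

Lemma tm_up s r i tau : ~~ inR D s true r i -> tm (emb s true r i) tau = false.
Proof.
by move=> n; apply/asboolP => /(tiling_pair tilT)[/(RDE D) h _ _]; rewrite h in n.
Qed.

Lemma tm_dn s r i tau : ~~ inR D s false r i -> tm tau (emb s false r i) = false.
Proof.
by move=> n; apply/asboolP => /(tiling_pair tilT)[_ /(RDE D) h _]; rewrite h in n.
Qed.

Lemma tm_partner tau : RD D x tau -> exists tau',
  [/\ share_edge tau tau', RD D x tau' & forall c, tm tau c = (c == tau')].
Proof.
move=> Rt; have [tau' [Tt u]] := tiling_partner tilT Rt.
have [_ R' s] := tiling_pair tilT Tt.
exists tau'; split => // c; apply/asboolP/eqP => [/u //|->]; exact: Tt.
Qed.

Lemma emb_eq s up r i s' up' r' i' : (emb s up r i == emb s' up' r' i')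
  = [&& s == s', up == up', r == r' & i == i'].
Proof.
apply/eqP/and4P => [/emb_inj[-> -> -> ->] //|[/eqP-> /eqP-> /eqP-> /eqP->]] //.
Qed.

Lemma below_dn s r i r' i' : (below s r i == emb s false r' i')
  = (r == r'.+1) && (i == i').
Proof. by case: r => [|r] /=; rewrite emb_eq ?eqxx ?andbF //= eqSS. Qed.

Lemma tm_up_sum s r i : inR D s true r i ->
  tmV s r i + tmLp s r i + tmR s r i = 1.
Proof.
move=> /(RDE D x) Rt; have [tau' [st R' e]] := tm_partner Rt.
rewrite /tmV /tmR !e.
have -> : tmLp s r i =
    if i is i'.+1 then emb s false r i' == tau' else false.
  by case: i Rt st e => // i Rt st e; rewrite /tmLp /tmL e.
case: (nbr_up st R') => [->|->|[i' ei ->]].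
- rewrite eqxx; case: i {Rt st e} => [|i]; rewrite ?[_ == below _ _ _]eq_sym !below_dn;
    rewrite ?(gtn_eqF (ltnSn r)) ?(ltn_eqF (ltnSn r)) //.
- rewrite below_dn (ltn_eqF (ltnSn r)) /= eqxx.
  by case: i {Rt st e} => // i; rewrite emb_eq !eqxx /= (ltn_eqF (ltnSn i)).
- rewrite ei below_dn (ltn_eqF (ltnSn r)) /= eqxx emb_eq.
  by rewrite (gtn_eqF (ltnSn i')) !andbF.
Qed.

Lemma tm_dn_sum s r i : inR D s false r i ->
  tmV s r.+1 i + tmL s r i + tmR s r i = 1.
Proof.
move=> /(RDE D x) Rt; have [tau' [st R' e]] := tm_partner Rt.
rewrite /tmV /tmL /tmR /= ![tm _ (emb s false r i)]tmC !e.
case: (nbr_dn st) => ->; rewrite !emb_eq !eqxx /= ?andbT.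
- by rewrite !(ltn_eqF (ltnSn r)).
- by rewrite (gtn_eqF (ltnSn r)) (gtn_eqF (ltnSn i)).
- by rewrite (gtn_eqF (ltnSn r)) (ltn_eqF (ltnSn i)).
Qed.

(** [tv] and [tl] tell whether the horizontal and the left side of an up-pointing cell are crossed
    by a lozenge. Counting lobes as crossed in [tv], and everything beyond the right end as crossed
    in [tl], makes [tv_tl] hold without exception. *)
Definition tv (s : bool) (r i : nat) : bool := inl D s i (clen true r) || tmV s r i.
Definition tl (s : bool) (r i : nat) : bool :=
  (hi D s < i + clen true r) || tmLp s r i.

Lemma inl_dents s i l j : inl D s i l -> i <= j < i + l -> j \in dents D s.
Proof. by move=> il h; rewrite -(wf_lob wf); apply: inl_sub il; lia. Qed.

Lemma inl_base s i l : 0 < l -> inl D s i l -> lo D s <= i /\ i + l <= hi D s.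
Proof.
move=> l0 il; have := dents_base wf (inl_dents il (j := i) ltac:(lia)).
have := dents_base wf (inl_dents il (j := i + l.-1) ltac:(lia)); lia.
Qed.

Lemma inl_size s i l : inl D s i l -> l <= N s.
Proof.
move=> il; have : size (iota i l) <= size (dents D s).
  apply: uniq_leq_size; rewrite ?iota_uniq // => j; rewrite mem_iota.
  exact: inl_dents.
by rewrite size_iota /N /rows; lia.
Qed.

(** A conservation law: the two cells at [(r, i)] share a side and each is matched once, so both
    sums are 1 minus the indicator that this side is crossed. The other cases treat the lobes and
    the ends of the rows. *)
Lemma tv_tl s r i : r < N s ->
  tv s r i + tl s r i = tv s r.+1 i + tl s r i.+1 /\ tv s r i + tl s r i <= 1.
Proof.
move=> rN; have nb := rows_base wf s; rewrite -/N in nb.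
have up_out j r' : ~~ inR D s true r' j -> tmV s r' j = false /\
    tmLp s r' j = false.
  move=> n; split; first exact: tm_up.
  by case: j n => // j n; exact: tm_up.
have dn_out j : ~~ inR D s false r j -> tmL s r j = false /\ tmR s r j = false.
  by move=> n; split; exact: tm_dn.
have upR j r' : inR D s true r' j =
    [&& lo D s <= j, j + r'.+1 <= hi D s, r' < N s & ~~ inl D s j r'.+1].
  by rewrite /inR /clen addn1.
have dnR j : inR D s false r j =
    [&& lo D s <= j, j + r.+2 <= hi D s, r < N s & ~~ inl D s j r.+2].
  by rewrite /inR /clen addn2.
have ib j l := @inl_base s j l.+1 isT.
have is1 l j l' : i <= j -> j + l' <= i + l -> inl D s i l -> inl D s j l'.
  exact: inl_sub.
have us := @tm_up_sum s r; have ds := @tm_dn_sum s r.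
rewrite /tv /tl /clen !addn1.
case: (ltnP i (lo D s)) => il.
  have [-> ->] := up_out i r ltac:(rewrite upR leqNgt il //).
  have [-> _] := up_out i r.+1 ltac:(rewrite upR leqNgt il //).
  have [e3 _] := dn_out i ltac:(rewrite dnR leqNgt il //).
  rewrite /= e3 !orbF.
  have -> : inl D s i r.+1 = false by apply/negP => /ib; lia.
  have -> : inl D s i r.+2 = false by apply/negP => /ib; lia.
  by split; lia.
case: (ltnP (hi D s) (i + r.+1)) => ih.
  have [-> ->] := up_out i r ltac:(rewrite upR (leqNgt _ (hi D s)) ih andbF //).
  have ih' : hi D s < i + r.+2 by lia.
  have [-> _] := up_out i r.+1 ltac:(rewrite upR (leqNgt _ (hi D s)) ih' andbF //).
  rewrite !orbF.
  have -> : inl D s i r.+1 = false by apply/negP => /ib; lia.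
  have -> : inl D s i r.+2 = false by apply/negP => /ib; lia.
  by rewrite (_ : _ < i.+1 + r.+1 = true) //; lia.
case: (ltnP (hi D s) (i + r.+2)) => ih2.
  have [-> _] := up_out i r.+1 ltac:(rewrite upR (leqNgt _ (hi D s)) ih2 andbF //).
  have [_ v3] := dn_out i ltac:(rewrite dnR (leqNgt _ (hi D s)) ih2 andbF //).
  have -> : inl D s i r.+2 = false by apply/negP => /ib; lia.
  rewrite (_ : _ < i.+1 + r.+1 = true) /=; last by lia.
  case: (boolP (inl D s i r.+1)) => b.
    by have [_ ->] := up_out i r ltac:(rewrite upR b !andbF //).
  have := us i; rewrite upR il ih rN b v3 => /(_ isT).
  by case: (tmV s r i); case: (tmLp s r i).
rewrite (_ : _ < i.+1 + r.+1 = false) /=; last by lia.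
case: (boolP (inl D s i r.+2)) => b2.
  have b1 : inl D s i r.+1 by apply: is1 b2; lia.
  have b3 : inl D s i.+1 r.+1 by apply: is1 b2; lia.
  have [_ ->] := up_out i r ltac:(rewrite upR b1 !andbF //).
  have [_ /= ->] := up_out i.+1 r ltac:(rewrite upR b3 !andbF //).
  by rewrite b1.
have := ds i; rewrite dnR il ih2 rN b2 => /(_ isT).
case: (boolP (inl D s i r.+1)) => b1.
  have [_ ->] := up_out i r ltac:(rewrite upR b1 !andbF //).
  have -> : tmR s r i = false by apply: tm_up; rewrite upR b1 !andbF.
  by case: (tmV s r.+1 i); case: (tmL s r i).
have := us i; rewrite upR il ih rN b1 => /(_ isT).
by case: (tmV s r i); case: (tmV s r.+1 i); case: (tmL s r i);
  case: (tmLp s r i); case: (tmR s r i).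
Qed.

Definition theight (s : bool) (r i : nat) : nat := count (tv s r) (iota 0 i).

Lemma theightS s r i : theight s r i.+1 = theight s r i + tv s r i.
Proof. by rewrite /theight -addn1 iotaD count_cat /= addn0. Qed.

Lemma theight_tl s r i : r < N s ->
  theight s r i = theight s r.+1 i + tl s r i.
Proof.
move=> rN; elim: i => [|i IH].
  rewrite /theight /tl /= orbF add0n /clen; have := rows_base wf s.
  by rewrite -/N => nb; rewrite ltnNge; lia.
by rewrite !theightS IH; have [e _] := tv_tl i rN; lia.
Qed.

Definition tmid (i : nat) : bool := tm (emb true true 0 i) (emb false true 0 i).

Lemma tmid_mid i : tmid i -> ml D <= i < mr D /\ forall s, i \notin dents D s.
Proof.
move/asboolP/(tiling_pair tilT) => [/(RDE D) h1 /(RDE D) h2 _].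
split; first exact: (mid_axis wf).
move=> s; rewrite -(wf_lob wf).
by move: h1 h2; rewrite /inR /clen !add0n; case: s => /and4P[_ _ _ ?] /and4P[].
Qed.

Lemma tv0 s i : tv s 0 i = (i \in dents D s) || tmid i.
Proof.
rewrite /tv /clen add0n (wf_lob wf); congr (_ || _).
by case: s => //; rewrite /tmV /= tmC.
Qed.

Lemma theight0 s i : theight s 0 i = cntB D s i + count tmid (iota 0 i).
Proof.
elim: i => [|i IH]; first by rewrite cntB_lo.
rewrite theightS IH cntBS // -[i.+1 in RHS]addn1 iotaD count_cat tv0 /= addn0.
case: (boolP (tmid i)) => [/tmid_mid[_ /(_ s)/negbTE ->]|_] /=; first by lia.
by rewrite orbF; lia.
Qed.

Lemma theight_top s r i : N s <= r -> theight s r i = 0.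
Proof.
move=> Nr; elim: i => // i IH; rewrite theightS IH add0n /tv.
have -> : inl D s i (clen true r) = false.
  by apply/negP => /inl_size; rewrite /clen; lia.
by rewrite /tmV tm_up // /inR ltnNge Nr /= !andbF.
Qed.

Lemma theight_hi s r : r <= N s -> theight s r (hi D s) = N s - r.
Proof.
move=> rN; rewrite -(subKn rN); move: (N s - r) (leq_subr r (N s)) => k kN.
elim: k kN => [|k IH] kN; first by rewrite subn0 theight_top // subnn.
have lt : N s - k.+1 < N s by lia.
rewrite theight_tl // (_ : (N s - k.+1).+1 = N s - k); last by lia.
rewrite IH ?(ltnW kN) // /tl /clen (_ : _ < _ = true) /=; lia.
Qed.

(** A global count: coming down from the top, row 0 has height [N s] at its right end, and the dents
    account for all of it but [nfree D]. *)
Lemma count_tmid i : mr D <= i -> count tmid (iota 0 i) = nfree D.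
Proof.
have cst k : count tmid (iota 0 (mr D + k)) = count tmid (iota 0 (mr D)).
  rewrite iotaD count_cat add0n (_ : count _ (iota (mr D) k) = 0) ?addn0 //.
  apply/eqP; rewrite -leqn0 leqNgt -has_count; apply/hasPn => j.
  by rewrite mem_iota => jm; apply/negP => /tmid_mid[]; lia.
have [w _] := (wf_hi wf true, tt).
have := theight_hi (s := true) (leq0n _).
rewrite theight0 cntB_hi // subn0 /N /rows -(subnKC w) cst => e mi.
by rewrite -(subnKC mi) cst; lia.
Qed.

Lemma theight_HF : isHF D theight.
Proof.
split.
- move=> s i im; rewrite theight0 (_ : count _ _ = 0) ?addn0 //.
  apply/eqP; rewrite -leqn0 leqNgt -has_count; apply/hasPn => j.
  by rewrite mem_iota => jm; apply/negP => /tmid_mid[]; lia.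
- by move=> s i im; rewrite theight0 count_tmid.
- by move=> i; rewrite !theight0; lia.
- by move=> s r i; rewrite theightS; case: tv; lia.
- by move=> s r i rN; rewrite (theight_tl i rN); case: tl; lia.
- move=> s r i rN; rewrite theightS (theight_tl i rN); have [_] := tv_tl i rN.
  by case: tl; case: tv; lia.
- exact: theight_top.
Qed.

(** By [tiling_sub] it suffices that the lozenges rebuilt from the heights belong to [T]; at each
    cell, the step of the height and the uniqueness of the partner single out the same neighbour. *)
Lemma tilingD_theight : T = tilingD D x theight.
Proof.
have H := theight_HF; apply/esym/(tiling_sub (tilingDP x wf H) tilT).
move=> l [tau [s [up [r [i [inr ->]]]]] ->].
have rN : r < N s by case/and4P: inr.
have ninl : inl D s i (clen up r) = false by case/and4P: inr => _ _ _ /negbTE.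
have base : i + clen up r <= hi D s by case/and4P: inr.
suff : tm (emb s up r i) (mate (corner D x theight) (emb s up r i)).
  by move/asboolP.
have hv j : theight s r j.+1 = theight s r j + tv s r j by exact: theightS.
have hv' : theight s r.+1 i.+1 = theight s r.+1 i + tv s r.+1 i by exact: theightS.
have hl j := theight_tl j rN.
have nhi : hi D s < i + clen true r = false.
  by move: base; rewrite /clen; case: (up); lia.
case: up inr ninl base => inr ninl base.
- have := tm_up_sum inr; have := hl i; rewrite /tl nhi /=.
  have := hv i; rewrite /tv ninl /=.
  case: (up_cases H i rN) => e e1 e2 e3.
  + by rewrite (mate_upV D x e) -/(tmV s r i); case: (tmV s r i) e1; lia.
  + have [i' ei _] := cross_upL wf H inr e; rewrite ei /tmLp in e e2 *.
    by rewrite (mate_upL x H rN e) -/(tmL s r i'); case: (tmL s r i') e2; lia.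
  + rewrite (mate_upR x H rN e) -/(tmR s r i); move: e1 e2 e3.
    move: (tmLp s r i) => b.
    have v := hf_vert H i rN.
    by case: (tmR s r i) => //; case: (tmV s r i); case: b; lia.
- have := tm_dn_sum inr; have := hl i.+1; rewrite /tl /tmLp.
  have -> : hi D s < i.+1 + clen true r = false.
    by move: base; rewrite /clen; lia.
  have := hv'; rewrite /tv.
  rewrite (_ : clen true r.+1 = clen false r) ?ninl /=; last by rewrite /clen; lia.
  case: (dn_cases H i rN) => e e1 e2 e3.
  + rewrite (mate_dnV D x e) tmC -[emb s false r i]/(below s r.+1 i) -/(tmV s r.+1 i).
    by case: (tmV s r.+1 i) e1; lia.
  + rewrite (mate_dnL x H rN e) tmC -/(tmL s r i).
    by case: (tmL s r i) e2; lia.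
  + rewrite (mate_dnR x H rN e) tmC -/(tmR s r i).
    by case: (tmR s r i) e3 => //; case: (tmV s r.+1 i) e1; case: (tmL s r i) e2; lia.
Qed.

End HeightFunctionOfTiling.

Local Open Scope ring_scope.

(** * Stacks and their volume *)

Lemma triangles_at (tau : triangle) (wi wj : int) :
  pt wi wj \in vertices tau ->
  [\/ tau = tri true wi wj, tau = tri true (wi - 1) wj |
      tau = tri true wi (wj - 1)] \/
  [\/ tau = tri false (wi - 1) wj, tau = tri false wi (wj - 1) |
      tau = tri false (wi - 1) (wj - 1)].
Proof.
case: tau => [[] [i j]]; rewrite /= !inE => /or3P[]/eqP[-> ->]; [left|left|left|right|right|right].
- by constructor 1.
- by constructor 2; apply: tri_eq; lia.
- by constructor 3; apply: tri_eq; lia.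
- by constructor 1; apply: tri_eq; lia.
- by constructor 2; apply: tri_eq; lia.
- by constructor 3; apply: tri_eq; lia.
Qed.

Lemma edge_triangles (tau : triangle) (w w' : lattice_point) : w != w' ->
  w \in vertices tau -> w' \in vertices tau -> exists tau0,
  [/\ share_edge tau tau0, w \in vertices tau0, w' \in vertices tau0 &
      forall tau', w \in vertices tau' -> w' \in vertices tau' ->
        tau' = tau \/ tau' = tau0].
Proof.
move=> ne wt wt'; suff [tau0 [t0 [h1 h2] h3]] : exists tau0,
    [/\ tau0 \in neighbours tau, (w \in vertices tau0) /\ (w' \in vertices tau0) &
      forall tau', w \in vertices tau' -> w' \in vertices tau' ->
        tau' = tau \/ tau' = tau0].
  by exists tau0; split => //; rewrite share_edgeE.
case: w w' ne wt wt' => wi wj [wi' wj'] ne wt wt'.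
move: wt wt' ne.
have fin (t : triangle) (p p' : lattice_point) : t \in neighbours tau ->
    p \in vertices t -> p' \in vertices t ->
    (forall k l, p \in vertices (tri tau.1 k l) -> p' \in vertices (tri tau.1 k l) ->
       k = tau.2.1 /\ l = tau.2.2) ->
    (forall k l, p \in vertices (tri (~~ tau.1) k l) ->
       p' \in vertices (tri (~~ tau.1) k l) -> k = t.2.1 /\ l = t.2.2) ->
    t.1 = ~~ tau.1 ->
    exists tau0, [/\ tau0 \in neighbours tau, (p \in vertices tau0) /\ (p' \in vertices tau0) &
      forall tau', p \in vertices tau' -> p' \in vertices tau' ->
        tau' = tau \/ tau' = tau0].
  move=> ht hp hp' u1 u2 tb; exists t; split => // -[b [k l]] g g'.
  case: (eqVneq b tau.1) => eb; [left|right].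
    by rewrite eb in g g' *; have [-> ->] := u1 _ _ g g'; case: (tau) => [? [? ?]].
  have {}eb : b = ~~ tau.1 by case: b eb {g g'}; case: tau.1.
  by rewrite eb in g g' *; have [-> ->] := u2 _ _ g g'; rewrite -tb; case: (t) => [? [? ?]].
move: fin; case: tau => [[] [i j]] fin; rewrite /= !inE !xpair_eqE => h h' ne.
- case: (boolP ((wj == j) && (wj' == j))) => c.
    apply: (fin (tri false i (j - 1))) => //=; rewrite ?inE ?xpair_eqE /=; try lia.
    + move=> k l; rewrite !inE !xpair_eqE; lia.
    + move=> k l; rewrite !inE !xpair_eqE; lia.
  case: (boolP ((wi == i) && (wi' == i))) => c'.
    apply: (fin (tri false (i - 1) j)) => //=; rewrite ?inE ?xpair_eqE /=; try lia.
    + move=> k l; rewrite !inE !xpair_eqE; lia.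
    + move=> k l; rewrite !inE !xpair_eqE; lia.
  apply: (fin (tri false i j)) => //=; rewrite ?inE ?xpair_eqE /=; try lia.
  + move=> k l; rewrite !inE !xpair_eqE; lia.
  + move=> k l; rewrite !inE !xpair_eqE; lia.
- case: (boolP ((wj == j + 1) && (wj' == j + 1))) => c.
    apply: (fin (tri true i (j + 1))) => //=; rewrite ?inE ?xpair_eqE /=; try lia.
    + move=> k l; rewrite !inE !xpair_eqE; lia.
    + move=> k l; rewrite !inE !xpair_eqE; lia.
  case: (boolP ((wi == i + 1) && (wi' == i + 1))) => c'.
    apply: (fin (tri true (i + 1) j)) => //=; rewrite ?inE ?xpair_eqE /=; try lia.
    + move=> k l; rewrite !inE !xpair_eqE; lia.
    + move=> k l; rewrite !inE !xpair_eqE; lia.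
  apply: (fin (tri true i j)) => //=; rewrite ?inE ?xpair_eqE /=; try lia.
  + move=> k l; rewrite !inE !xpair_eqE; lia.
  + move=> k l; rewrite !inE !xpair_eqE; lia.
Qed.

Section Surfaces.

Variables (D : halves) (x : nat).
Hypothesis wf : wf_halves D.

Local Notation emb := (emb x).
Local Notation ept := (ept x).
Local Notation RD := (RD D x).
Local Notation corner := (corner D x).
Local Notation tilingD := (tilingD D x).

Let N := rows D.

Lemma ept_eq s r i s' r' i' : ept s r i = ept s' r' i' ->
  [/\ r = r', i = i' & (0 < r)%N -> s = s'].
Proof. by case: s; case: s' => -[h1 h2]; split => //; lia. Qed.

Lemma RD_tri (b : bool) (I J : int) : RD (tri b I J) ->
  (exists i, I = i%:Z - x%:Z) \/ (J < x%:Z)%R.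
Proof.
case=> s [up [r [i [_ e]]]]; case: s e => e.
  by left; exists i; case: e.
by right; case: up e => -[_ _ ->]; lia.
Qed.

Lemma interior_cells s r i (tau : triangle) : interior D s r i ->
  ept s r i \in vertices tau -> RD tau.
Proof.
have nb s' := rows_base wf s'.
have ind s' j l : inl D s' j l.+1 -> j \in dents D s'.
  by rewrite -(wf_lob wf); apply: inl_sub; lia.
case: r => [|r] /=.
  case/and4P => im ir nt nf.
  case: i im ir => // i im ir wt.
  have rr s' up j : (i <= j)%N -> (j + (if up then 1 else 2) <= i.+2)%N ->
      inR D s' up 0 j.
    move=> ij ji; rewrite /inR /clen add0n.
    have := wf_lo wf s'; have := wf_hi wf s' => h1 h2.
    apply/and4P; split; [lia|lia|by case: (s')|].
    apply/negP => h; have /(dents_out wf) : j \in dents D s'.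
      by case: up h ji => h _; exact: ind h.
    by case: up ji {h}; lia.
  have wt' : pt (i.+1%:Z - x%:Z) x%:Z \in vertices tau.
    by move: wt; case: s => //; rewrite /ept ?addr0 ?subr0.
  case: (triangles_at wt') => -[] ->.
  - by exists true, true, 0%N, i.+1; split; [apply: rr|apply: tri_eq]; lia.
  - by exists true, true, 0%N, i; split; [apply: rr|apply: tri_eq]; lia.
  - by exists false, false, 0%N, i; split; [apply: rr|apply: tri_eq]; lia.
  - by exists true, false, 0%N, i; split; [apply: rr|apply: tri_eq]; lia.
  - by exists false, true, 0%N, i.+1; split; [apply: rr|apply: tri_eq]; lia.
  - by exists false, true, 0%N, i; split; [apply: rr|apply: tri_eq]; lia.
case/and4P; case: i => // i il ih rN ni.
have rr up r' j : (i <= j)%N -> (j <= i.+1)%N -> (i.+1 + r.+1 <= j + clen up r')%N ->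
    (j + clen up r' <= i.+1 + r.+2)%N -> (r' <= r.+1)%N -> inR D s up r' j.
  move=> h1 h2 h3 h4 h5; rewrite /inR; apply/and4P; split; try lia.
  by apply: contra ni; apply: inl_sub; lia.
case: s il ih rN ni rr => il ih rN ni rr wt; case: (triangles_at wt) => -[] ->.
- by exists true, true, r.+1, i.+1; split; [apply: rr; rewrite /clen|apply: tri_eq]; lia.
- by exists true, true, r.+1, i; split; [apply: rr; rewrite /clen|apply: tri_eq]; lia.
- by exists true, true, r, i.+1; split; [apply: rr; rewrite /clen|apply: tri_eq]; lia.
- by exists true, false, r.+1, i; split; [apply: rr; rewrite /clen|apply: tri_eq]; lia.
- by exists true, false, r, i.+1; split; [apply: rr; rewrite /clen|apply: tri_eq]; lia.
- by exists true, false, r, i; split; [apply: rr; rewrite /clen|apply: tri_eq]; lia.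
- by exists false, false, r, i.+1; split; [apply: rr; rewrite /clen|apply: tri_eq]; lia.
- by exists false, false, r, i; split; [apply: rr; rewrite /clen|apply: tri_eq]; lia.
- by exists false, false, r.+1, i; split; [apply: rr; rewrite /clen|apply: tri_eq]; lia.
- by exists false, true, r, i.+1; split; [apply: rr; rewrite /clen|apply: tri_eq]; lia.
- by exists false, true, r.+1, i.+1; split; [apply: rr; rewrite /clen|apply: tri_eq]; lia.
- by exists false, true, r.+1, i; split; [apply: rr; rewrite /clen|apply: tri_eq]; lia.
Qed.

(** With [interior_cells], this shows that cubes of a stack project exactly to interior points. A
    point of the axis has a name in each half; the last clause selects the upper one. *)
Lemma cells_interior (w : lattice_point) :
  (forall tau, w \in vertices tau -> RD tau) ->
  exists s r i, [/\ w = ept s r i, interior D s r i & r = 0%N -> s = true].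
Proof.
case: w => wi wj all.
have c1 : RD (tri true wi wj) by apply: all; vmem.
have c2 : RD (tri true (wi - 1) wj) by apply: all; vmem.
have c3 : RD (tri true wi (wj - 1)) by apply: all; vmem.
have c5 : RD (tri false wi (wj - 1)) by apply: all; vmem.
have c6 : RD (tri false (wi - 1) (wj - 1)) by apply: all; vmem.
have c4 : RD (tri false (wi - 1) wj) by apply: all; vmem.
have [hx|hx] := lerP x%:Z wj.
  have [i ei] : exists i : nat, wi = i.+1%:Z - x%:Z.
    by case: (RD_tri c2) => [[i e]|]; [exists i|]; lia.
  have [r er] : exists r : nat, wj = x%:Z + r%:Z by exists (absz (wj - x%:Z)%R); lia.
  have {}c1 : inR D true true r i.+1.
    by apply/(RDE D x); rewrite (_ : emb _ _ _ _ = tri true wi wj) //; apply: tri_eq; lia.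
  have {}c2 : inR D true true r i.
    by apply/(RDE D x); rewrite (_ : emb _ _ _ _ = tri true (wi - 1) wj) //; apply: tri_eq; lia.
  exists true, r, i.+1; split => //; first by apply: pt_eq; lia.
  case: r er c1 c2 => [|r] er c1 c2.
    have {}c5 : inR D false true 0 i.+1.
      by apply/(RDE D x); rewrite (_ : emb _ _ _ _ = tri false wi (wj - 1)) //; apply: tri_eq; lia.
    have {}c6 : inR D false true 0 i.
      by apply/(RDE D x); rewrite (_ : emb _ _ _ _ = tri false (wi - 1) (wj - 1)) //; apply: tri_eq; lia.
    have := mid_axis wf c1 c5; have := mid_axis wf c2 c6 => /andP[m1 m2] /andP[m3 m4].
    rewrite /interior; case/and4P: c1 => _ _ n1 _; case/and4P: c5 => _ _ n2 _.
    by apply/and4P; split => //; lia.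
  have {}c3 : inR D true true r i.+1.
    by apply/(RDE D x); rewrite (_ : emb _ _ _ _ = tri true wi (wj - 1)) //; apply: tri_eq; lia.
  move: c1 c2 c3; rewrite /inR /clen !addn1 => /and4P[a1 a2 a3 _] /and4P[b1 b2 _ _].
  case/and4P => _ _ _ ni.
  by rewrite /interior; apply/and4P; split => //; lia.
have [r er] : exists r : nat, wj = x%:Z - r.+1%:Z.
  by exists (absz (x%:Z - wj - 1)%R); lia.
have neg (i : int) u (r' : nat) (t : triangle) : RD t ->
    t = tri u (i + r'%:Z - x%:Z) (x%:Z - r'%:Z - 1) -> u = false -> 0 <= i.
  by move=> [s [up [r0 [i0 [_ ->]]]]]; case: s; case: up => -[] e1 e2 e3 e4; lia.
have [i ei] : exists i : nat, wi = i.+1%:Z + r.+1%:Z - x%:Z.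
  have := neg (wi + x%:Z - r.+1%:Z - 1) false r.+1 _ c6.
  move=> /(_ ltac:(apply: tri_eq; lia) erefl) h.
  by exists (absz (wi + x%:Z - r.+1%:Z - 1)%R); lia.
have {}c1 : inR D false false r i.+1.
  by apply/(RDE D x); rewrite (_ : emb _ _ _ _ = tri true wi wj) //; apply: tri_eq; lia.
have {}c5 : inR D false true r.+1 i.+1.
  by apply/(RDE D x); rewrite (_ : emb _ _ _ _ = tri false wi (wj - 1)) //; apply: tri_eq; lia.
have {}c6 : inR D false true r.+1 i.
  by apply/(RDE D x); rewrite (_ : emb _ _ _ _ = tri false (wi - 1) (wj - 1)) //; apply: tri_eq; lia.
have {}c4 : inR D false true r i.+1.
  by apply/(RDE D x); rewrite (_ : emb _ _ _ _ = tri false (wi - 1) wj) //; apply: tri_eq; lia.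
exists false, r.+1, i.+1; split => //; first by apply: pt_eq; lia.
move: c5 c6 c4; rewrite /inR /clen !addn1 => /and4P[a1 a2 a3 _] /and4P[b1 b2 _ _].
case/and4P => _ _ _ ni.
by rewrite /interior; apply/and4P; split => //; lia.
Qed.

Lemma corner_fixed h h' (tau : triangle) (w : lattice_point) : isHF D h -> isHF D h' ->
  RD tau -> w \in vertices tau -> (exists2 tau', w \in vertices tau' & ~ RD tau') ->
  corner h tau w = corner h' tau w.
Proof.
move=> H H' [s [up [r0 [i0 [inr ->]]]]] wt [tau' wt' nR].
have [r [i [ew hri]]] := vertices_emb wt.
rewrite !(corner_at _ _ _ _ _ ew); have rN : (r <= rows D s)%N.
  have : (r0 < rows D s)%N by case/and4P: inr.
  by case: up hri {inr wt} => -[] [-> _]; lia.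
have e : h s r i = h' s r i.
  apply: (hf_fixed wf H H' rN); apply/negP => /interior_cells int.
  by apply: nR; apply: int; rewrite -ew.
by rewrite /hval; move: e; case: (s) => ->.
Qed.

Lemma boundary_fixed h h' tau (w w' : lattice_point) : isHF D h -> isHF D h' ->
  boundary_edge RD tau w w' -> corner h tau w = corner h' tau w.
Proof.
move=> H H' [Rt ne wt wt' u].
have [tau0 [st w0 w0' _]] := edge_triangles ne wt wt'.
apply: corner_fixed => //; exists tau0 => // R0.
by apply: (share_edge_neq st); rewrite (u tau0).
Qed.

Definition top_corner : lattice_point := (0, (x + N true)%N%:Z).

Let R : region := Region RD top_corner.

Definition hT (T : set (set triangle)) := theight D x T.

Lemma hT_HF T : is_tiling RD T -> isHF D (hT T).
Proof. by move=> h; exact: theight_HF. Qed.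

Lemma tiling_hT T : is_tiling RD T -> T = tilingD (hT T).
Proof. by move=> h; exact: tilingD_theight. Qed.

Lemma lift_of_eq P P' tau (w : lattice_point) : P tau w = P' tau w ->
  lift_of P tau w = lift_of P' tau w.
Proof. by rewrite /lift_of => ->. Qed.

Lemma top_fixed h h' tau tau' : isHF D h -> isHF D h' -> RD tau -> RD tau' ->
  top_corner \in vertices tau -> top_corner \in vertices tau' ->
  corner h tau top_corner = corner h' tau' top_corner.
Proof.
move=> H H' [s [up [r0 [i0 [inr ->]]]]] [s' [up' [r0' [i0' [inr' ->]]]]] wt wt'.
have [r [i [ew hri]]] := vertices_emb wt.
have [r' [i' [ew' hri']]] := vertices_emb wt'.
rewrite (corner_at _ _ _ _ _ ew) (corner_at _ _ _ _ _ ew').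
have r0N : (r0 < rows D s)%N by case/and4P: inr.
have r0N' : (r0' < rows D s')%N by case/and4P: inr'.
have side s2 r2 i2 : top_corner = ept s2 r2 i2 -> i2 = x /\
    if s2 then r2 = N true else r2 = 0%N /\ N true = 0%N.
  by case: s2 => -[h1 h2]; split => //; lia.
have [-> {}er] := side _ _ _ ew; have [-> {}er'] := side _ _ _ ew'.
case: s er r0N {ew wt hri inr} => [er r0N|[er N0] _];
  case: s' er' r0N' {ew' wt' hri' inr'} => [er' r0N'|[er' N0'] _] //.
- by rewrite er er' /hval (hf_top H) // (hf_top H').
- by move: r0N; rewrite -/(N true) N0'.
- by move: r0N'; rewrite -/(N true) N0.
(* Without an upper half the corner lies on the axis, and [hf_axis] carries the vanishing upper
   height over to the lower half. *)
- rewrite er er' /hval; have := hf_axis H x; have := hf_axis H' x.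
  have t1 := hf_top H (s := true) (r := 0) x.
  have t2 := hf_top H' (s := true) (r := 0) x.
  by rewrite t1 ?t2 -/(N true) ?N0 //; lia.
Qed.

Lemma normalized_exists : normalized_lifts R (fun T => lift_of (corner (hT T))).
Proof.
split.
- by move=> T hT'; have := liftDP x wf (hT_HF hT'); rewrite -tiling_hT.
- move=> T T' tau tau' hT1 hT2 Rt Rt' wt wt'; rewrite /lift_of.
  by rewrite (top_fixed (hT_HF hT1) (hT_HF hT2) Rt Rt' wt wt').
- move=> T T' tau w w' hT1 hT2 b; apply: lift_of_eq.
  exact: boundary_fixed (hT_HF hT1) (hT_HF hT2) b.
Qed.

(** The explicit lifts show that there is something to choose. Afterwards only normalisation is
    used, for an arbitrary family [L]. *)
Lemma surface_normalized : normalized_lifts R (surface R).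
Proof.
by apply: (@xgetPex _ _ [set L | normalized_lifts R L]); exists (fun T => lift_of (corner (hT T)));
  exact: normalized_exists.
Qed.

Section Defect.

Variables (L : set (set triangle) -> lifting).
Hypothesis normL : normalized_lifts R L.

Definition dft h (tau : triangle) (w : lattice_point) : int :=
  defect (corner h) (L (tilingD h)) tau w.

Lemma dft_triangle h tau (w w' : lattice_point) : isHF D h -> RD tau ->
  w \in vertices tau -> w' \in vertices tau -> dft h tau w = dft h tau w'.
Proof.
move=> H; case: normL => isL _ _.
apply: defect_triangle; [exact: corner_steps|exact: corner_mate|exact: corner_adj|].
by apply: isL; exact: tilingDP.
Qed.

Lemma dft_adj h tau tau' (w : lattice_point) : isHF D h -> RD tau -> RD tau' ->
  share_edge tau tau' -> w \in vertices tau -> w \in vertices tau' ->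
  dft h tau w = dft h tau' w.
Proof.
move=> H Rt Rt' st wt wt'; case: normL => isL _ _.
have [_ la _] := isL _ (tilingDP x wf H).
by rewrite /dft /defect (corner_adj wf H Rt Rt' st wt wt') (la tau tau').
Qed.

(** If the neighbour lies in the region, the equality is carried over the common edge. Otherwise
    this is a boundary edge, where neither the lift nor the explicit value depends on the tiling. *)
Lemma dft_boundary h h' tau tau' (w w' : lattice_point) :
  isHF D h -> isHF D h' -> RD tau -> share_edge tau tau' -> w != w' ->
  w \in vertices tau -> w' \in vertices tau ->
  w \in vertices tau' -> w' \in vertices tau' ->
  (RD tau' -> dft h tau' w = dft h' tau' w) ->
  dft h tau w = dft h' tau w.
Proof.
move=> H H' Rt st ne wt wt' w0 w0' IH.
case: (pselect (RD tau')) => [R0|nR0].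
  by rewrite !(dft_adj (tau := tau) (tau' := tau')) // IH.
have b : boundary_edge RD tau w w'.
  split => // tau2 R2 h2 h2'.
  have [tau0 [st0 h0 h0' u]] := edge_triangles ne wt wt'.
  case: (u tau' w0 w0') => [e|e0]; first by case: (share_edge_neq st).
  by case: (u tau2 h2 h2') => // e2; case: nR0; rewrite e0 -e2.
case: normL => _ _ bd; rewrite /dft /defect (boundary_fixed H H' b).
by rewrite (bd _ _ tau w w' (tilingDP x wf H) (tilingDP x wf H') b).
Qed.

Lemma ept_up s r i : [/\ ept s r i \in vertices (emb s true r i),
  ept s r i.+1 \in vertices (emb s true r i) &
  ept s r.+1 i \in vertices (emb s true r i)].
Proof. by case: s; split; rewrite /= !inE !xpair_eqE; lia. Qed.

Lemma ept_dn s r i : [/\ ept s r i.+1 \in vertices (emb s false r i),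
  ept s r.+1 i \in vertices (emb s false r i) &
  ept s r.+1 i.+1 \in vertices (emb s false r i)].
Proof. by case: s; split; rewrite /= !inE !xpair_eqE; lia. Qed.

Definition left_cell s r i : triangle :=
  if s then tri false (i%:Z - x%:Z - 1) (x%:Z + r%:Z)
  else tri true (i%:Z + r%:Z - x%:Z) (x%:Z - r%:Z - 1).

(* Along a row from left to right, starting outside of the region: whenever the
   edge to the left of a cell is a boundary edge, normalization fixes the lift. *)
Lemma dft_const h h' tau (w : lattice_point) : isHF D h -> isHF D h' ->
  RD tau -> w \in vertices tau -> dft h tau w = dft h' tau w.
Proof.
move=> H H' [s [up [r [i [inr ->]]]]] wt.
have gen up' i' : inR D s up' r i' ->
    (exists2 w0 : lattice_point, w0 \in vertices (emb s up' r i') &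
      dft h (emb s up' r i') w0 = dft h' (emb s up' r i') w0) ->
    forall w1 : lattice_point, w1 \in vertices (emb s up' r i') ->
      dft h (emb s up' r i') w1 = dft h' (emb s up' r i') w1.
  move=> inr' [w0 hw0 e] w1 hw1; have Rt : RD (emb s up' r i') by apply/RDE.
  by rewrite (dft_triangle H Rt hw1 hw0) (dft_triangle H' Rt hw1 hw0).
have dn_of_up i' : (inR D s true r i' -> forall w1 : lattice_point,
      w1 \in vertices (emb s true r i') ->
      dft h (emb s true r i') w1 = dft h' (emb s true r i') w1) ->
    inR D s false r i' -> forall w1 : lattice_point,
      w1 \in vertices (emb s false r i') ->
      dft h (emb s false r i') w1 = dft h' (emb s false r i') w1.
  move=> IH inr'; apply: gen => //; have [v1 v2 _] := ept_dn s r i'.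
  have [_ u1 u2] := ept_up s r i'.
  exists (ept s r i'.+1) => //.
  apply: (dft_boundary H H' (tau' := emb s true r i') (w' := ept s r.+1 i')) => //.
  - exact/RDE.
  - by rewrite share_edgeE; case: (s); rewrite /= !inE !xpair_eqE; lia.
  - by apply/eqP => /ept_eq[]; lia.
  - by move=> /RDE R0; apply: IH.
have up_of_left i' : (RD (left_cell s r i') ->
      dft h (left_cell s r i') (ept s r i') = dft h' (left_cell s r i') (ept s r i')) ->
    inR D s true r i' -> forall w1 : lattice_point,
      w1 \in vertices (emb s true r i') ->
      dft h (emb s true r i') w1 = dft h' (emb s true r i') w1.
  move=> IH inr'; apply: gen => //; have [u0 _ u2] := ept_up s r i'.
  exists (ept s r i') => //.
  apply: (dft_boundary H H' (tau' := left_cell s r i') (w' := ept s r.+1 i')) => //.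
  - exact/RDE.
  - by rewrite share_edgeE; case: (s); rewrite /= !inE !xpair_eqE; lia.
  - by apply/eqP => /ept_eq[]; lia.
  - by rewrite /left_cell; case: (s); rewrite /= !inE !xpair_eqE; lia.
  - by rewrite /left_cell; case: (s); rewrite /= !inE !xpair_eqE; lia.
have both i' : forall up', inR D s up' r i' -> forall w1 : lattice_point,
      w1 \in vertices (emb s up' r i') ->
      dft h (emb s up' r i') w1 = dft h' (emb s up' r i') w1.
  elim: i' => [|i' IH].
    have up0 : inR D s true r 0 -> forall w1 : lattice_point,
      w1 \in vertices (emb s true r 0) ->
      dft h (emb s true r 0) w1 = dft h' (emb s true r 0) w1.
      apply: up_of_left => -[s0 [up0 [r0 [i0 [_ e]]]]]; exfalso; move: e.
      by rewrite /left_cell; case: (s); case: s0; case: up0 => -[]; lia.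
    by case; [exact: up0|exact: dn_of_up].
  have up1 : inR D s true r i'.+1 -> forall w1 : lattice_point,
      w1 \in vertices (emb s true r i'.+1) ->
      dft h (emb s true r i'.+1) w1 = dft h' (emb s true r i'.+1) w1.
    apply: up_of_left; have -> : left_cell s r i'.+1 = emb s false r i'.
      by rewrite /left_cell; case: (s); apply: tri_eq; lia.
    by move=> /RDE R0; apply: IH => //; have [] := ept_dn s r i'.
  by case; [exact: up1|exact: dn_of_up].
exact: both.
Qed.

Lemma height_diff h h' tau (w : lattice_point) : isHF D h -> isHF D h' ->
  RD tau -> w \in vertices tau ->
  height (L (tilingD h) tau w) - height (L (tilingD h') tau w)
  = 3 * (corner h tau w - corner h' tau w).
Proof.
by move=> H H' Rt wt; have := dft_const H H' Rt wt; rewrite /dft /defect; lia.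
Qed.

(** A side of a lozenge raises the height by 1. On a diagonal the second coordinate is one unit
    short, and with it the other two, which gives 1 - 3. *)
Lemma lift_step h tau (w v : lattice_point) (k : 'I_3) : isHF D h -> RD tau ->
  w \in vertices tau -> v \in vertices tau -> v = w + diag_proj (axis_vec k) ->
  let d := height (L (tilingD h) tau v) - height (L (tilingD h) tau w) in
  d = 1 \/ d = - 2.
Proof.
move=> H Rt wt vt e /=.
have := dft_triangle H Rt wt vt; rewrite /dft /defect.
have := corner_steps H Rt.
set P := corner h; move: (height _) (height _) => hv hw.
case: w v wt vt e => wi wj [vi vj] wt vt e.
have := congr1 snd e; have := congr1 fst e; rewrite {e} diag_proj_axis.
case: tau Rt wt vt => [[] [i j]] Rt; rewrite /= !inE !xpair_eqE => wt vt;
  case: k => -[|[|[|k]]] hk //= e1 e2 [s1 s2 s3].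
- have [-> -> -> ->] : [/\ wi = i, wj = j, vi = i + 1 & vj = j].
    by split; ilia.
  by ilia.
- have [-> -> -> ->] : [/\ wi = i + 1, wj = j, vi = i & vj = j + 1].
    by split; ilia.
  by ilia.
- have [-> -> -> ->] : [/\ wi = i, wj = j + 1, vi = i & vj = j].
    by split; ilia.
  by ilia.
- have [-> -> -> ->] : [/\ wi = i, wj = j + 1, vi = i + 1 & vj = j + 1].
    by split; ilia.
  by ilia.
- have [-> -> -> ->] : [/\ wi = i + 1, wj = j, vi = i & vj = j + 1].
    by split; ilia.
  by ilia.
- have [-> -> -> ->] : [/\ wi = i + 1, wj = j + 1, vi = i + 1 & vj = j].
    by split; ilia.
  by ilia.
Qed.

(** All six triangles around an interior point are cells, and successive ones share an edge, so the
    corners there have a common lift. *)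
Lemma lift_around h s r i tau : isHF D h -> interior D s r i ->
  ept s r i \in vertices tau ->
  L (tilingD h) tau (ept s r i) = L (tilingD h) (emb s true r i) (ept s r i).
Proof.
move=> H int; case ew : (ept s r i) => [wi wj].
have cells t : (wi, wj) \in vertices t -> RD t.
  by rewrite -ew; exact: interior_cells.
have [_ la _] : is_lift RD (tilingD h) (L (tilingD h)).
  by case: normL => isL _ _; apply: isL; exact: tilingDP.
suff key t : (wi, wj) \in vertices t ->
    L (tilingD h) t (wi, wj) = L (tilingD h) (tri true wi wj) (wi, wj).
  move=> ht; rewrite key //; apply/esym/key.
  by rewrite -ew; case: (ept_up s r i).
have adj t1 t2 : (wi, wj) \in vertices t1 -> (wi, wj) \in vertices t2 ->
    t2 \in neighbours t1 -> L (tilingD h) t1 (wi, wj) = L (tilingD h) t2 (wi, wj).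
  by move=> ht ht' st; apply: la => //; rewrite ?share_edgeE //; exact: cells.
have e1 : L (tilingD h) (tri false (wi - 1) wj) (wi, wj) =
    L (tilingD h) (tri true wi wj) (wi, wj) by apply: adj; vmem.
have e2 : L (tilingD h) (tri true (wi - 1) wj) (wi, wj) =
    L (tilingD h) (tri false (wi - 1) wj) (wi, wj) by apply: adj; vmem.
have e3 : L (tilingD h) (tri false (wi - 1) (wj - 1)) (wi, wj) =
    L (tilingD h) (tri true (wi - 1) wj) (wi, wj) by apply: adj; vmem.
have e4 : L (tilingD h) (tri false wi (wj - 1)) (wi, wj) =
    L (tilingD h) (tri true wi wj) (wi, wj) by apply: adj; vmem.
have e5 : L (tilingD h) (tri true wi (wj - 1)) (wi, wj) =
    L (tilingD h) (tri false wi (wj - 1)) (wi, wj) by apply: adj; vmem.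
move=> ht; case: (triangles_at ht) => -[] -> //.
- by rewrite e2 e1.
- by rewrite e5 e4.
- by rewrite e3 e2 e1.
Qed.

End Defect.

End Surfaces.

Lemma diag_projD p p' : diag_proj (p + p') = diag_proj p + diag_proj p'.
Proof.
by rewrite /diag_proj !mxE; apply: pt_eq => /=; ring.
Qed.

Lemma diag_proj_const (c : int) : diag_proj (const_mx c) = 0.
Proof. by rewrite /diag_proj !mxE !subrr. Qed.

Lemma height_const (c : int) : height (const_mx c) = 3 * c.
Proof.
rewrite /height; under eq_bigr => k _ do rewrite mxE.
by rewrite sumr_const card_ord; ring.
Qed.

Lemma sum_axis_vec : \sum_(k < 3) axis_vec k = const_mx 1.
Proof.
apply/rowP => l; rewrite summxE mxE (bigD1 l) //= mxE !eqxx big1 ?addr0 //.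
by move=> k kl; rewrite mxE eq_sym (negbTE kl) andbF.
Qed.

Lemma cube_vertexP (p : cube) (S : {set 'I_3}) :
  [\/ cube_vertex p S = p,
      exists k, cube_vertex p S = p + axis_vec k,
      exists k, cube_vertex p S = p + const_mx 1 - axis_vec k |
      cube_vertex p S = p + const_mx 1].
Proof.
have cS : (#|S| <= 3)%N by have := max_card (mem S); rewrite card_ord.
case: (ltngtP #|S| 1) => [|S2|/eqP/cards1P[k ->]].
- rewrite ltnS leqn0 cards_eq0 => /eqP ->; constructor 1.
  by rewrite /cube_vertex big1 ?addr0 // => k; rewrite inE.
- have cC : (#|S| + #|finset.setC S| = 3)%N by rewrite cardsC card_ord.
  have e : cube_vertex p S + \sum_(k in finset.setC S) axis_vec k = p + const_mx 1.
    rewrite /cube_vertex -[LHS]addrA -sum_axis_vec.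
    rewrite [in RHS](bigID (fun k => k \in S)) /=.
    suff -> : \sum_(k in finset.setC S) axis_vec k =
      \sum_(k | k \notin S) axis_vec k by [].
    by apply: eq_bigl => k; rewrite inE.
  move: S2 cS; rewrite leq_eqVlt => /orP[/eqP S2|S3] cS.
    have /eqP/cards1P[k ek] : #|finset.setC S| = 1%N by lia.
    constructor 3; exists k; rewrite -e ek big_set1; apply/eqP.
    by rewrite -addrA subrr addr0.
  constructor 4; rewrite -e big1 ?addr0 // => k.
  have /eqP : #|finset.setC S| = 0%N by lia.
  by rewrite cards_eq0 => /eqP ->; rewrite inE.
- by constructor 2; exists k; rewrite /cube_vertex big_set1.
Qed.

Section Stacks.

Variables (D : halves) (x : nat).
Hypothesis wf : wf_halves D.

Local Notation emb := (emb x).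
Local Notation ept := (ept x).
Local Notation RD := (RD D x).
Local Notation corner := (corner D x).
Local Notation tilingD := (tilingD D x).

Let N := rows D.
Let R : region := Region RD (top_corner D x).
Let L := surface R.
Let normL : normalized_lifts R L := surface_normalized x wf.

Lemma max_HF (cs : seq conf) : cs != [::] -> {subset cs <= confs D} ->
  exists2 h1, isHF D h1 & forall c, c \in cs ->
    forall s r i, (hof D c s r i <= h1 s r i)%N.
Proof.
elim: cs => // c cs IH _ sub; have cc : c \in confs D by apply: sub; rewrite inE eqxx.
case: (eqVneq cs [::]) => [->|/IH].
  exists (hof D c); first exact: hof_HF.
  by move=> c'; rewrite inE => /eqP -> *.
case=> [c' c'cs|h1 H1 le1]; first by apply: sub; rewrite inE c'cs orbT.
exists (fun s r i => maxn (h1 s r i) (hof D c s r i)).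
  by apply: hf_max => //; exact: hof_HF.
move=> c'; rewrite inE => /orP[/eqP -> *|c'cs s r i]; first exact: leq_maxr.
by apply: leq_trans (leq_maxl _ _); exact: le1.
Qed.

Hypothesis confs_nonempty : confs D != [::].

Definition T0 := lowest_tiling R.

(** By [conf_of], the maximum over the finitely many configurations dominates every height function;
    its tiling is the lowest. *)
Lemma lowest_prop : is_tiling RD T0 /\
  forall T', is_tiling RD T' -> weakly_below RD (L T0) (L T').
Proof.
apply: (@xgetPex _ _ [set T | is_tiling RD T /\
  forall T', is_tiling RD T' -> weakly_below RD (L T) (L T')]).
have [h1 H1 le1] := max_HF confs_nonempty (fun _ => id).
exists (tilingD h1); split; first exact: tilingDP.
move=> T' tT'; rewrite (tiling_hT wf tT'); have H' := hT_HF wf tT'.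
have [c cc ec] := conf_of wf H'.
move=> tau w Rt wt; rewrite -subr_ge0 (height_diff wf normL) //.
case: Rt wt => s [up [r0 [i0 [_ ->]]]] /vertices_emb[r [i [ew _]]].
rewrite !(corner_at _ _ _ _ _ ew) /hval; have := le1 c cc s r i.
by rewrite ec; case: (s); lia.
Qed.

Definition h0 := hT D x T0.

Lemma h0_HF : isHF D h0.
Proof. by apply: hT_HF => //; case: lowest_prop. Qed.

Lemma T0E : T0 = tilingD h0.
Proof. by apply: tiling_hT => //; case: lowest_prop. Qed.

Lemma interior_rows s r i : interior D s r i -> (r <= N s)%N.
Proof. by case: r => //= r /and4P[_ _ /ltnW]. Qed.

Lemma interior_up s r i : interior D s r i -> RD (emb s true r i).
Proof.
by move=> int; apply: (interior_cells wf int); case: (ept_up x s r i).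
Qed.

Lemma h0_max h s r i : isHF D h -> (r <= N s)%N -> (h s r i <= h0 s r i)%N.
Proof.
move=> H rN; case: (boolP (interior D s r i)) => int; last first.
  by rewrite (hf_fixed wf H h0_HF rN int).
have [v _ _] := ept_up x s r i.
have [_ /(_ _ (tilingDP x wf H))] := lowest_prop.
move/(_ _ _ (interior_up int) v); rewrite T0E -subr_ge0.
rewrite (height_diff wf normL H h0_HF (interior_up int) v).
rewrite !corner_ept /hval; case: (s); lia.
Qed.

Definition base s r i : cubic_point := L T0 (emb s true r i) (ept s r i).

Lemma base_proj s r i : interior D s r i -> diag_proj (base s r i) = ept s r i.
Proof.
move=> int; case: normL => isL _ _; case: lowest_prop => tT0 _.
have [pr _ _] := isL _ tT0; apply: pr; first exact: interior_up.
by case: (ept_up x s r i).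
Qed.

Lemma proj_eq (p p' : cubic_point) : diag_proj p = diag_proj p' ->
  p = p' + const_mx (p 0 1 - p' 0 1).
Proof.
rewrite (point3E p) (point3E p') !diag_proj_point3 => -[e1 e2].
apply/rowP => l; rewrite !mxE.
by case: l => -[|[|[|l]]] hl //=; lia.
Qed.

Lemma height_at h s r i tau : isHF D h -> interior D s r i ->
  ept s r i \in vertices tau ->
  height (L (tilingD h) tau (ept s r i)) =
  height (base s r i) + 3 * ((h0 s r i)%:Z - (h s r i)%:Z).
Proof.
move=> H int ht; rewrite (lift_around wf normL H int ht) /base T0E.
have [v _ _] := ept_up x s r i.
have := height_diff wf normL H h0_HF (interior_up int) v.
by rewrite !corner_ept /hval; case: (s); lia.
Qed.

(** Over an interior point the two surfaces are [3 * (h0 - h)] apart in height, and each cube of the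
    column takes 3. The lowest and the highest vertex of a cube already determine whether it
    fits. *)
Lemma stackP h p : isHF D h -> stack_of_tiling R (tilingD h) p <->
  exists s r i n, [/\ interior D s r i, r = 0%N -> s = true,
    (n < h0 s r i - h s r i)%N & p = base s r i + const_mx n%:Z].
Proof.
move=> H; split.
  move=> st; have cells tau : diag_proj p \in vertices tau -> RD tau.
    by move=> /st[].
  have [s [r [i [ew int rs]]]] := cells_interior wf cells.
  have [v _ _] := ept_up x s r i.
  have [_ hS] : RD (emb s true r i) /\ _ := st _ (eq_ind_r (fun w => w \in _) v ew).
  have p0 : cube_vertex p finset.set0 = p.
    by rewrite /cube_vertex big1 ?addr0 // => k; rewrite inE.
  have p1 : cube_vertex p (finset.setTfor 'I_3) = p + const_mx 1.
    rewrite /cube_vertex -sum_axis_vec; congr (_ + _).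
    by apply: eq_bigl => k; rewrite inE.
  have := hS finset.set0; rewrite p0 ew => /(_ v) /andP[lo0 _].
  have := hS (finset.setTfor 'I_3).
  rewrite p1 diag_projD diag_proj_const addr0 ew => /(_ v) /andP[_ hi1].
  rewrite heightD height_const -/T0 T0E -/L in lo0 hi1.
  rewrite (height_at H int v) in hi1; rewrite (height_at h0_HF int v) in lo0.
  have ep := proj_eq (etrans ew (esym (base_proj int))).
  set c := p 0 1 - _ in ep; rewrite ep heightD height_const in lo0 hi1.
  have le := h0_max i H (interior_rows int).
  exists s, r, i, (absz c); split => //; first by lia.
  by rewrite {1}ep; congr (_ + const_mx _); lia.
move=> [s [r [i [n [int rs nlt ->]]]]].
have bp := base_proj int.
have pp : diag_proj (base s r i + const_mx n%:Z) = ept s r i.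
  by rewrite diag_projD diag_proj_const addr0.
move=> tau; rewrite pp => wt; have Rt := interior_cells wf int wt.
split => // S vS.
rewrite -/T0 T0E -/L.
have lo0 := height_at h0_HF int wt; have hi0 := height_at H int wt.
set p' := base s r i + _ in pp vS *.
have hp : height p' = height (base s r i) + 3 * n%:Z by rewrite heightD height_const.
clearbody p'.
(* At the six other vertices both surfaces differ by 1 or 2 from their heights over the centre, in
   the direction that keeps the inequalities. *)
have steplo k := @lift_step D x wf L normL h0 tau _ _ k h0_HF Rt.
have stephi k := @lift_step D x wf L normL h tau _ _ k H Rt.
have le := h0_max i H (interior_rows int).
case: (cube_vertexP p' S) vS => [->|[k ->]|[k ->]|->].
- by rewrite pp => _; rewrite hp lo0 hi0; lia.
- rewrite diag_projD pp => vS; rewrite heightD height_axis hp.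
  have := steplo _ _ k wt vS erefl; have := stephi _ _ k wt vS erefl.
  by rewrite lo0 hi0; case=> ? [] ?; lia.
- rewrite !diag_projD diag_proj_const pp addr0 => vS.
  have e : ept s r i = ept s r i + diag_proj (- axis_vec k) + diag_proj (axis_vec k).
    by rewrite -addrA -diag_projD addNr -[0]/(const_mx 0) diag_proj_const addr0.
  have hk : height (- axis_vec k) = - 1.
    by have := heightD (- axis_vec k) (axis_vec k); rewrite addNr -[0]/(const_mx 0) height_const height_axis; lia.
  rewrite !heightD height_const hk hp.
  have := steplo _ _ k vS wt e; have := stephi _ _ k vS wt e.
  by rewrite lo0 hi0; case=> ? [] ?; lia.
- rewrite diag_projD diag_proj_const addr0 pp => _.
  by rewrite heightD height_const hp lo0 hi0; lia.
Qed.

End Stacks.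

Lemma volume_seq (s : seq cube) : uniq s -> volume [set` s] = size s.
Proof.
move=> us; rewrite /volume; apply: perm_size; apply: uniq_perm => //.
move=> p; rewrite in_fset_set; last exact: finite_seq.
by apply/idP/idP; rewrite inE.
Qed.

Section Volume.

Variables (D : halves) (x : nat).
Hypothesis wf : wf_halves D.
Hypothesis confs_nonempty : confs D != [::].

Local Notation emb := (emb x).
Local Notation ept := (ept x).
Local Notation RD := (RD D x).
Local Notation tilingD := (tilingD D x).
Local Notation h0 := (h0 D x).
Local Notation base := (base D x).

Let N := rows D.
Let R : region := Region RD (top_corner D x).
Let W := maxn (hi D true) (hi D false).

Let hiW s : (hi D s <= W)%N.
Proof. by case: s; rewrite leq_max leqnn ?orbT. Qed.

Definition row_verts (s : bool) (n : nat) : seq (bool * (nat * nat)) :=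
  [seq (s, (r, i)) | r <- iota 1 n, i <- iota 0 W.+1].

Definition verts : seq (bool * (nat * nat)) :=
  [seq (true, (0%N, i)) | i <- iota 0 W.+1] ++
  (row_verts true (N true) ++ row_verts false (N false)).

Lemma row_verts_uniq s n : uniq (row_verts s n).
Proof.
by apply: allpairs_uniq; rewrite ?iota_uniq // => -[? ?] [? ?] _ _ [-> ->].
Qed.

Lemma mem_row_verts s n s' r i : ((s', (r, i)) \in row_verts s n) =
  [&& s' == s, 0 < r, r <= n & i <= W]%N.
Proof.
apply/allpairsPdep/and4P => [[r' [i' [hr hi [-> -> ->]]]]|[/eqP -> h1 h2 h3]].
  by rewrite !mem_iota in hr hi; split => //; lia.
by exists r, i; split => //; rewrite mem_iota; lia.
Qed.

Lemma mem_axis_verts s r i :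
  ((s, (r, i)) \in [seq (true, (0%N, i)) | i <- iota 0 W.+1]) =
  [&& s, r == 0 & i <= W]%N.
Proof.
apply/mapP/and3P => [[j hj [-> -> ->]]|[-> /eqP -> h]].
  by split => //; rewrite mem_iota in hj.
by exists i => //; rewrite mem_iota.
Qed.

Lemma verts_uniq : uniq verts.
Proof.
rewrite !cat_uniq !row_verts_uniq map_inj_uniq ?iota_uniq /=; last by move=> ? ? [].
rewrite andbT; apply/andP; split; apply/hasPn => -[s [r i]] /=.
  by rewrite mem_cat mem_axis_verts !mem_row_verts; case: r => [|r]; rewrite /= !andbF.
by rewrite !mem_row_verts; case: s.
Qed.

Lemma mem_verts s r i : ((s, (r, i)) \in verts) =
  [&& r <= N s, i <= W & (r == 0) ==> s]%N.
Proof.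
rewrite !mem_cat mem_axis_verts !mem_row_verts.
by case: s; case: r => [|r] //=; rewrite ?andbF ?andbT ?orbF.
Qed.

Lemma interior_verts s r i : interior D s r i -> (r = 0%N -> s = true) ->
  (s, (r, i)) \in verts.
Proof.
move=> int rs; rewrite mem_verts (interior_rows int) /=; apply/andP; split.
  have := hiW s; have := hiW true; have := wf_hi wf true.
  case: r int {rs} => [/and4P[]|r /and4P[]]; lia.
by apply/implyP => /eqP /rs ->.
Qed.

(** All vertices are listed, to match [vsum]; by [drop_interior] the columns over the others are
    empty. *)
Definition cubes (h : bool -> nat -> nat -> nat) : seq cube :=
  [seq base v.1 v.2.1 v.2.2 + const_mx n%:Z | v <- verts,
     n <- iota 0 (h0 v.1 v.2.1 v.2.2 - h v.1 v.2.1 v.2.2)].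

Lemma drop_interior h s r i n : isHF D h -> (s, (r, i)) \in verts ->
  n \in iota 0 (h0 s r i - h s r i) -> interior D s r i.
Proof.
move=> H; rewrite mem_verts => /and3P[rN _ _]; rewrite mem_iota => hn.
apply/negPn/negP => ni.
have := hf_fixed wf H (h0_HF x wf confs_nonempty) rN ni; lia.
Qed.

Lemma base_inj s r i n s' r' i' n' :
  (s, (r, i)) \in verts -> (s', (r', i')) \in verts ->
  interior D s r i -> interior D s' r' i' ->
  base s r i + const_mx n%:Z = base s' r' i' + const_mx n'%:Z ->
  [/\ s = s', r = r', i = i' & n = n'].
Proof.
move=> v v' int int' e.
have := congr1 diag_proj e; rewrite !diag_projD !diag_proj_const !addr0.
rewrite !base_proj // => /ept_eq[er ei es].
have es' : s = s'.
  case: r er es v {int e} => [|r] er es v; last by apply: es.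
  move: v v'; rewrite !mem_verts -er => /and3P[_ _ a] /and3P[_ _ b].
  by case: (s) (s') a b => -[].
split => //; move: e; rewrite -er -ei -es' => /addrI/rowP/(_ 0).
by rewrite !mxE; lia.
Qed.

Lemma cubes_uniq h : isHF D h -> uniq (cubes h).
Proof.
move=> H; apply: allpairs_uniq_dep; rewrite ?verts_uniq //.
  by move=> *; exact: iota_uniq.
move=> [v n] [v' n'] /allpairsPdep[v1 [n1 [hv hn e]]] /allpairsPdep[v1' [n1' [hv' hn' e']]].
case: e => -> ->; case: e' => -> -> /= {v n v' n'} e.
case: v1 v1' hv hn hv' hn' e => s [r i] [s' [r' i']] hv hn hv' hn' e.
have [-> -> -> ->] := base_inj hv hv' (drop_interior H hv hn) (drop_interior H hv' hn') e.
by [].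
Qed.

Lemma stack_cubes h : isHF D h -> stack_of_tiling R (tilingD h) = [set` cubes h].
Proof.
move=> H; apply/seteqP; split => p.
  move/(stackP x wf confs_nonempty p H) => [s [r [i [n [int rs hn ->]]]]] /=.
  apply/allpairsPdep; exists (s, (r, i)), n; split => //.
    exact: interior_verts.
  by rewrite mem_iota.
move=> /= /allpairsPdep[[s [r i]] [n [hv hn ->]]].
apply/(stackP x wf confs_nonempty _ H); exists s, r, i, n; split => //.
- exact: drop_interior hv hn.
- by move: hv; rewrite mem_verts => /and3P[_ _ /implyP h1] /eqP /h1.
- by move: hn; rewrite mem_iota.
Qed.

Lemma vsum_verts h : vsum D W h = \sum_(v <- verts) h v.1 v.2.1 v.2.2.
Proof.
rewrite /vsum /verts /row_verts !big_cat big_map !big_allpairs_dep.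
by rewrite /index_iota !subSS !subn0.
Qed.

Lemma volume_vsum h : isHF D h ->
  (volume (stack_of_tiling R (tilingD h)) + vsum D W h = vsum D W h0)%N.
Proof.
move=> H; rewrite stack_cubes // volume_seq; last exact: cubes_uniq.
rewrite !vsum_verts /cubes size_allpairs_dep sumnE big_map -big_split /=.
apply: eq_big_seq => -[s [r i]]; rewrite mem_verts => /and3P[rN _ _] /=.
by rewrite size_iota subnK //; apply: (h0_max _ wf confs_nonempty).
Qed.

Lemma stack_inj h h' : isHF D h -> isHF D h' ->
  stack_of_tiling R (tilingD h) = stack_of_tiling R (tilingD h') ->
  forall s r i, (r <= N s)%N -> h s r i = h' s r i.
Proof.
wlog suff le : h h' / isHF D h -> isHF D h' ->
  stack_of_tiling R (tilingD h) = stack_of_tiling R (tilingD h') ->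
  forall s r i, (r <= N s)%N -> (h s r i <= h' s r i)%N.
  move=> H H' e s r i rN; apply/eqP; rewrite eqn_leq.
  by rewrite (le h h') // (le h' h).
move=> H H' e s r i rN; rewrite leqNgt; apply/negP => lt.
have int : interior D s r i.
  by apply/negPn/negP => ni; have := hf_fixed wf H H' rN ni; lia.
have [s1 [int1 rs lt1]] : exists s1, [/\ interior D s1 r i, r = 0%N -> s1 = true &
    (h' s1 r i < h s1 r i)%N].
  case: r rN lt int => [|r] rN lt int; last by exists s.
  exists true; split => //; have := hf_axis H i; have := hf_axis H' i.
  by case: (s) lt; lia.
have rN1 := interior_rows int1; have le := h0_max x wf confs_nonempty i H rN1.
have le' := h0_max x wf confs_nonempty i H' rN1.
(* The first cube missing from the column of [h]; the column of [h'] is longer and contains it. *)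
pose n := (h0 s1 r i - h s1 r i)%N.
have : stack_of_tiling R (tilingD h') (base s1 r i + const_mx n%:Z).
  by apply/(stackP x wf confs_nonempty _ H'); exists s1, r, i, n; split => //; rewrite /n; lia.
rewrite -e => /(stackP x wf confs_nonempty _ H)[s2 [r2 [i2 [n2 [int2 rs2 lt2 e2]]]]].
have [es er ei en] := base_inj (interior_verts int1 rs) (interior_verts int2 rs2) int1 int2 e2.
by move: lt2; rewrite -es -er -ei -en /n; lia.
Qed.

Lemma monotone_stacksE : monotone_stacks R =
  (fun c => stack_of_tiling R (tilingD (hof D c))) @` [set` confs D].
Proof.
apply/seteqP; split => [p [T tT <-]|p [c cc <-]].
  have := hT_HF wf tT => /(conf_of wf)[c cc ec].
  exists c => //; rewrite [in RHS](tiling_hT wf tT); congr (stack_of_tiling _ (tilingD _)).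
  by apply/funext => s; apply/funext => r; apply/funext => i.
by exists (tilingD (hof D c)) => //; apply: tilingDP => //; exact: hof_HF.
Qed.

Definition cvol (c : conf) : nat :=
  volume (stack_of_tiling R (tilingD (hof D c))).

Lemma stacks_sum (F : comNzRingType) (q : F) :
  \sum_(pi \in monotone_stacks R) q ^+ volume pi
  = \sum_(c <- confs D) q ^+ cvol c.
Proof.
rewrite monotone_stacksE fsbig_image; first by rewrite -fsbig_seq ?confs_uniq.
move=> c c'; rewrite !inE => cc cc' e.
apply: (hof_inj wf cc cc') => s r i rN.
by apply: (stack_inj (hof_HF wf cc) (hof_HF wf cc')) rN.
Qed.

Lemma lowest_conf : exists2 c0, c0 \in confs D & hof D c0 = h0.
Proof.
have [c0 cc0 ec0] := conf_of wf (h0_HF x wf confs_nonempty).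
by exists c0 => //; apply/funext => s; apply/funext => r; apply/funext => i.
Qed.

(** Both the volume and the weight are constants minus [vsum], by [volume_vsum] and [vsum_wt]. The
    volume is 0 for the lowest configuration, so the shift is its weight. *)
Lemma wt_cvol : exists w, forall c, c \in confs D -> wt c = (w + cvol c)%N.
Proof.
have [c0 cc0 ec0] := lowest_conf; exists (wt c0) => c cc.
have e := volume_vsum (hof_HF wf cc).
have := vsum_wt wf hiW cc; have := vsum_wt wf hiW cc0; rewrite ec0.
by move: e; rewrite -/(cvol c); lia.
Qed.

Lemma cvol_lowest : exists2 c0, c0 \in confs D & cvol c0 = 0%N.
Proof.
have [c0 cc0 ec0] := lowest_conf; exists c0 => //.
by have := volume_vsum (hof_HF wf cc0); rewrite -/(cvol c0) ec0; lia.
Qed.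

End Volume.

Local Close Scope ring_scope.

(** * The regions P and Q *)

Fixpoint blocks (up : bool) (p : nat) (c : seq nat) : seq (nat * nat) :=
  if c is k :: c' then
    (if up then [:: (p, k)] else [::]) ++ blocks (~~ up) (p + k) c'
  else [::].

Definition covers (i l : nat) (pk : nat * nat) : bool :=
  (pk.1 <= i) && (i + l <= pk.1 + pk.2).

Lemma blocks_cat up p c c' :
  blocks up p (c ++ c') = blocks up p c ++ blocks (up (+) odd (size c)) (p + sumn c) c'.
Proof.
elim: c up p => [|k c IH] up p /=; first by rewrite addn0 addbF.
by rewrite IH catA addnA addNb addbN.
Qed.

Lemma mem_lblk up p c i : (i \in lblk up p c) = has (covers i 1) (blocks up p c).
Proof.
elim: c up p => //= k c IH up p; rewrite mem_cat has_cat IH; congr (_ || _).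
by case: up; rewrite //= orbF mem_iota /covers /= addn1.
Qed.

Lemma lblk_range up p c : {in lblk up p c, forall i, p <= i < p + sumn c}.
Proof.
elim: c up p => //= k c IH up p i; rewrite mem_cat => /orP[|/IH]; last by lia.
by case: up => //; rewrite mem_iota; lia.
Qed.

Lemma lblk_sorted up p c : sorted ltn (lblk up p c).
Proof.
elim: c up p => //= k c IH up p.
rewrite sorted_pairwise; last exact: ltn_trans.
rewrite pairwise_cat -!sorted_pairwise ?IH ?andbT; try exact: ltn_trans.
apply/andP; split; last by case: up => //; exact: iota_ltn_sorted.
apply/allrelP => i j; case: up => //; rewrite mem_iota => ? /lblk_range; lia.
Qed.

Lemma lblk_cover up p c i : p <= i < p + sumn c ->
  (i \in lblk up p c) || (i \in lblk (~~ up) p c).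
Proof.
elim: c up p => [|k c IH] up p /=; first lia.
move=> h; rewrite !mem_cat; case: (ltnP i (p + k)) => ik.
  have ii : i \in iota p k by rewrite mem_iota; lia.
  by case: up => /=; rewrite ii ?orbT.
by have /orP[->|->] := IH (~~ up) (p + k) ltac:(lia); rewrite ?orbT.
Qed.

Lemma lblk_perm up p c : perm_eq (lblk up p c ++ lblk (~~ up) p c) (iota p (sumn c)).
Proof.
have us u : uniq (lblk u p c) by apply: sorted_ltn_uniq; exact: lblk_sorted.
apply: uniq_perm; rewrite ?iota_uniq //.
  rewrite cat_uniq !us andbT /=; apply/hasPn => i.
  elim: c up p {us} => //= k c IH up p; rewrite !mem_cat.
  case: up => /=; rewrite ?mem_iota.
    by move=> h; rewrite negb_or IH ?andbT //; have := lblk_range h; lia.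
  case/orP => [ik|h]; last exact: (IH true).
  apply/negP => h; have := lblk_range h.
  by move: ik; lia.
move=> i; rewrite mem_cat mem_iota; apply/idP/idP => [/orP[]/lblk_range //|].
exact: lblk_cover.
Qed.

Section HexagonHalves.

Variables (fl : bool) (x y z t : nat) (a b : seq nat).
Hypothesis b_even : ~~ odd (size b).

Let L := sumn (x :: a).
Let M := y + z.

(** [fl] is the half that widens to the right: the lower one for P, the upper one for Q. To the left
    it is always the lower one, by a lobe of length [x]. The lobes of one half are gaps of the
    other, hence the opposite starting parities. *)
Definition hexD : halves := Halves
  (fun s => if s then x else 0)
  (fun s => L + M + sumn b + (if s == fl then t else 0))
  L (L + M) y
  (fun s => lblk (~~ s) 0 (x :: a))
  (fun s => lblk (s == fl) (L + M) (rcons (rev b) t))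
  (fun s => blocks (~~ s) 0 (x :: a) ++
            blocks (s == fl) (L + M) (rcons (rev b) t)).

Lemma inl_hexD s i l : inl hexD s i l =
  has (covers i l) (blocks (~~ s) 0 (x :: a))
  || has (covers i l) (blocks (s == fl) (L + M) (rcons (rev b) t)).
Proof. exact: has_cat. Qed.

Lemma blocks_rcons up p : blocks up p (rcons (rev b) t) =
  blocks up p (rev b) ++ (if up then [:: (p + sumn b, t)] else [::]).
Proof.
by rewrite -cats1 blocks_cat size_rev (negbTE b_even) addbF sumn_rev /= cats0.
Qed.

Lemma lblk_rcons up p : lblk up p (rcons (rev b) t) =
  lblk up p (rev b) ++ (if up then iota (p + sumn b) t else [::]).
Proof.
by rewrite -cats1 lblk_cat size_rev (negbTE b_even) addbF sumn_rev /= cats0.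
Qed.

Lemma hexD_wf : wf_halves hexD.
Proof.
have sL : L = x + sumn a by [].
split => /=.
- by case; rewrite ?sL ?leq_addr.
- by rewrite leq_add2l /M leq_addr.
- by move=> s; rewrite -addnA leq_addr.
- by move=> s; exact: (lblk_sorted (~~ s) 0 (x :: a)).
- by move=> s; exact: lblk_sorted.
- case=> i /=.
    by move/lblk_range; rewrite sL add0n.
  by move/(@lblk_range true 0 (x :: a)); rewrite /= sL add0n.
- move=> s i; rewrite lblk_rcons mem_cat => /orP[/lblk_range|]; rewrite ?sumn_rev.
    by case: (s == fl); lia.
  by case: (s == fl) => //; rewrite mem_iota; lia.
- move=> s i; rewrite inl_hexD /dents mem_cat; congr (_ || _).
    exact/esym/(mem_lblk (~~ s) 0 (x :: a)).
  exact/esym/mem_lblk.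
- move=> i h; have [/andP[hi1 d1] /andP[hi2 d2]] := (h true, h false).
  move: d1 d2; rewrite /dents !(mem_cat _ (Bl _ _) (Br _ _)) !negb_or.
  move=> /andP[l1 r1] /andP[l2 r2].
  apply/andP; split; rewrite leqNgt; apply/negP => ih.
    have := @lblk_cover false 0 (x :: a) i; rewrite (negbTE l1 : (i \in lblk false 0 (x :: a)) = false).
    rewrite (negbTE l2 : (i \in lblk (~~ false) 0 (x :: a)) = false).
    by move=> /(_ ltac:(move: ih; rewrite sL; lia)).
  have := @lblk_cover (true == fl) (L + M) (rcons (rev b) t) i.
  have e : ~~ (true == fl) = (false == fl) by case: fl.
  rewrite e (negbTE r1 : (i \in lblk (true == fl) _ _) = false).
  rewrite (negbTE r2 : (i \in lblk (false == fl) _ _) = false) -cats1 sumn_cat sumn_rev /= => /(_ _).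
  by move: hi1 hi2 ih; case: fl => /=; lia.
Qed.

End HexagonHalves.

Lemma size_lblk_rev f p c : size (lblk (f (+) ~~ odd (size c)) p (rev c)) =
  if f then odd_sum c else even_sum c.
Proof.
elim: c f p => [|k c IH] f p.
  by rewrite odd_sum_nil even_sum_nil if_same.
rewrite rev_cons -cats1 lblk_cat size_cat size_rev /= negbK.
have e : f (+) odd (size c) = ~~ f (+) ~~ odd (size c) by case: f; case: odd.
rewrite {1}e IH odd_sum_cons even_sum_cons addbK cats0.
by case: (f) => /=; rewrite ?size_iota ?addn0 1?addnC.
Qed.

(** A cell lies in a lobe exactly when the smallest triangle containing it and based on the axis
    does, so only bases have to be compared. *)
Lemma left_fern_blocks (x : nat) s u r i f p c :
  has (fun l => all (in_lobe x%:Z l) (vertices (emb x s u r i)))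
      (left_fern f (p%:Z - x%:Z)%R c)
  = has (covers i (clen u r)) (blocks (if s then f else ~~ f) p c).
Proof.
elim: c f p => [|k c IH] f p; first by case: s.
rewrite [left_fern _ _ _]/= -cat1s has_cat has_seq1.
have -> : (p%:Z - x%:Z + k%:Z = (p + k)%N%:Z - x%:Z)%R by lia.
rewrite IH.
have -> : (if s then ~~ f else ~~ ~~ f) = ~~ (if s then f else ~~ f) by case: (s).
rewrite [blocks _ _ (k :: c)]/= has_cat; congr (_ || _).
by move: s f u {IH} => [] [] []; rewrite /= ?andbT /covers /clen /=; lia.
Qed.

Lemma right_fern_blocks (x : nat) s u r i f p c :
  has (fun l => all (in_lobe x%:Z l) (vertices (emb x s u r i)))
      (right_fern f ((p + sumn c)%N%:Z - x%:Z)%R c)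
  = has (covers i (clen u r))
      (blocks ((if s then f else ~~ f) (+) ~~ odd (size c)) p (rev c)).
Proof.
elim: c f p => [|k c IH] f p; first by case: s.
rewrite [right_fern _ _ _]/= -cat1s has_cat has_seq1.
have -> : ((p + (k + sumn c))%N%:Z - x%:Z - k%:Z = (p + sumn c)%N%:Z - x%:Z)%R by lia.
rewrite IH rev_cons -cats1 blocks_cat has_cat sumn_rev size_rev [size _]/= orbC.
have -> : (if s then ~~ f else ~~ ~~ f) (+) ~~ odd (size c)
  = (if s then f else ~~ f) (+) ~~ odd (size c).+1.
  by case: (s); case: (f) => /=; rewrite ?negbK.
congr (_ || _).
have -> : (if s then f else ~~ f) (+) ~~ odd (size c).+1 (+) odd (size c) =
  if s then f else ~~ f.
  by rewrite /= negbK addbK.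
by move: s f u {IH} => [] [] []; rewrite /= ?andbT /covers /clen /=; lia.
Qed.

Section HexagonRegions.

Variables (x y z t : nat) (a b : seq nat).
Hypothesis b_even : ~~ odd (size b).

Lemma rows_hexD fl s : rows (hexD fl x y z t a b) s =
  (if s then odd_sum a else x + even_sum a) +
  ((if s == fl then even_sum b + t else odd_sum b)) + y.
Proof.
rewrite /rows /dents size_cat; congr (_ + _ + _).
  by case: s; rewrite (size_lblk _ 0 (x :: a)) /= ?odd_sum_cons ?even_sum_cons.
rewrite [Br _ _]/= lblk_rcons // size_cat.
have := size_lblk_rev (~~ (s == fl)) (sumn (x :: a) + (y + z)) b.
rewrite b_even addbT negbK => ->.
by case: (s == fl); rewrite ?size_iota ?addn0.
Qed.

Lemma fern_hexD fl s u r i :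
  has (fun l => all (in_lobe x%:Z l) (vertices (emb x s u r i)))
    (left_fern true 0%R a ++
       right_fern (~~ fl) ((sumn a + sumn b + y + z)%N%:Z)%R b)
  = has (covers i (clen u r)) (blocks s x a)
    || has (covers i (clen u r))
         (blocks (s == fl) (sumn (x :: a) + (y + z)) (rev b)).
Proof.
rewrite has_cat; congr (_ || _).
  rewrite -(subrr (x%:Z : int)) left_fern_blocks; by case: s.
have -> : ((sumn a + sumn b + y + z)%N%:Z =
  ((sumn (x :: a) + (y + z)) + sumn b)%N%:Z - x%:Z)%R by rewrite /=; lia.
rewrite right_fern_blocks b_even addbT.
by case: s; case: fl.
Qed.

Lemma inl_hexD_split fl s i l : inl (hexD fl x y z t a b) s i l =
  [|| ~~ s && (i + l <= x), has (covers i l) (blocks s x a),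
      has (covers i l) (blocks (s == fl) (sumn (x :: a) + (y + z)) (rev b)) |
      (s == fl) && covers i l (sumn (x :: a) + (y + z) + sumn b, t)].
Proof.
rewrite inl_hexD blocks_rcons // has_cat.
rewrite [blocks (~~ s) 0 _]/= has_cat negbK add0n orbA -!orbA.
congr (_ || (_ || (_ || _))); last by case: (s == fl); rewrite //= orbF.
by case: s; rewrite //= orbF /covers /= add0n.
Qed.

Lemma cells_P s u r i (oa := odd_sum a) (ea := even_sum a)
    (ob := odd_sum b) (eb := even_sum b) :
  all (in_hexagon (x + y + oa + ob) (z + ea + eb) (y + t + oa + ob)
    (x + y + ea + eb) (z + oa + ob) (y + t + ea + eb)) (vertices (emb x s u r i))
  && ~~ has (fun l => all (in_lobe x%:Z l) (vertices (emb x s u r i)))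
    (left_fern true 0%R a ++
       right_fern true ((sumn a + sumn b + y + z)%N%:Z)%R b)
  = inR (hexD false x y z t a b) s u r i.
Proof.
rewrite (fern_hexD false) /inR rows_hexD inl_hexD_split.
have := odd_even_sum a; have := odd_even_sum b; rewrite -/oa -/ea -/ob -/eb.
set A := has _ _; set B := has _ _; move: A B => [] [] sb sa;
  rewrite ?andbF ?orbT ?andbF //= ?andbF //.
move: s u => [] []; rewrite /covers /clen /=; lia.
Qed.

Lemma cells_Q s u r i (oa := odd_sum a) (ea := even_sum a)
    (ob := odd_sum b) (eb := even_sum b) :
  all (in_hexagon (x + y + t + oa + eb) (z + ea + ob) (y + oa + eb)
    (x + y + t + ea + ob) (z + oa + eb) (y + ea + ob)) (vertices (emb x s u r i))
  && ~~ has (fun l => all (in_lobe x%:Z l) (vertices (emb x s u r i)))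
    (left_fern true 0%R a ++
       right_fern false ((sumn a + sumn b + y + z)%N%:Z)%R b)
  = inR (hexD true x y z t a b) s u r i.
Proof.
rewrite (fern_hexD true) /inR rows_hexD inl_hexD_split.
have := odd_even_sum a; have := odd_even_sum b; rewrite -/oa -/ea -/ob -/eb.
set A := has _ _; set B := has _ _; move: A B => [] [] sb sa;
  rewrite ?andbF ?orbT ?andbF //= ?andbF //.
move: s u => [] []; rewrite /covers /clen /=; lia.
Qed.

(** The closing condition turns the lower bound on [i + j] into 0, which makes the abscissas of the
    lower half natural numbers. *)
Lemma hexagon_emb nw n ne se s sw (tau : triangle) :
  (nw + n = se + s)%N ->
  all (in_hexagon nw n ne se s sw) (vertices tau) ->
  exists h u r i, tau = emb x h u r i.
Proof.
move=> e; case: tau => [u [I J]].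
have [hx|hx] := lerP (x%:Z)%R J => h.
  exists true, u, (absz (J - x%:Z)%R), (absz (I + x%:Z)%R).
  have I0 : (0 <= I)%R by move: h; case: u; rewrite /=; lia.
  by apply: tri_eq; lia.
exists false, (~~ u), (absz (x%:Z - J - 1)%R).
exists (absz (if u then I + J else I + J + 1)%R).
move: h; case: u; rewrite /= => h; apply: tri_eq; lia.
Qed.

Lemma regionPE : regionP x y z t a b =
  Region (RD (hexD false x y z t a b) x) (top_corner (hexD false x y z t a b) x).
Proof.
have ea := odd_even_sum a; have eb := odd_even_sum b.
rewrite /regionP /hexagon_minus_lobes; congr Region.
  apply/seteqP; split => tau /= h.
    have [s [u [r [i e]]]] : exists s u r i, tau = emb x s u r i.
      by case/andP: h => h _; apply: hexagon_emb h; lia.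
    by exists s, u, r, i; split => //; rewrite -cells_P -e.
  by case: h => s [u [r [i [h ->]]]]; rewrite cells_P.
by rewrite /top_corner rows_hexD /=; congr (_, Posz _); lia.
Qed.

Lemma regionQE : regionQ x y z t a b =
  Region (RD (hexD true x y z t a b) x) (top_corner (hexD true x y z t a b) x).
Proof.
have ea := odd_even_sum a; have eb := odd_even_sum b.
rewrite /regionQ /hexagon_minus_lobes; congr Region.
  apply/seteqP; split => tau /= h.
    have [s [u [r [i e]]]] : exists s u r i, tau = emb x s u r i.
      by case/andP: h => h _; apply: hexagon_emb h; lia.
    by exists s, u, r, i; split => //; rewrite -cells_Q -e.
  by case: h => s [u [r [i [h ->]]]]; rewrite cells_Q.
by rewrite /top_corner rows_hexD /=; congr (_, Posz _); lia.
Qed.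

End HexagonRegions.

Lemma odd_even_sum_pad (c : seq nat) k :
  odd_sum (c ++ nseq k 0) = odd_sum c /\ even_sum (c ++ nseq k 0) = even_sum c.
Proof.
elim: c => [|a c [IH1 IH2]]; last first.
  by rewrite cat_cons !odd_sum_cons !even_sum_cons IH1 IH2.
elim: k => // k [IH1 IH2]; rewrite /= odd_sum_cons even_sum_cons.
by rewrite IH1 IH2 odd_sum_nil even_sum_nil.
Qed.

Lemma zero_lobe h tau u p : ~~ all (in_lobe h (u, p, 0)) (vertices tau).
Proof. by case: tau => [[] [i j]]; case: u; rewrite /=; lia. Qed.

Lemma has_left_fern_pad h tau f p c k :
  has (fun l => all (in_lobe h l) (vertices tau)) (left_fern f p (c ++ nseq k 0))
  = has (fun l => all (in_lobe h l) (vertices tau)) (left_fern f p c).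
Proof.
elim: c f p => [|a c IH] f p; last by rewrite /= IH.
by elim: k f p => // k IH f p /=; rewrite (negbTE (zero_lobe _ _ _ _)) IH.
Qed.

Lemma has_right_fern_pad h tau f p c k :
  has (fun l => all (in_lobe h l) (vertices tau)) (right_fern f p (c ++ nseq k 0))
  = has (fun l => all (in_lobe h l) (vertices tau)) (right_fern f p c).
Proof.
elim: c f p => [|a c IH] f p; last by rewrite /= IH.
by elim: k f p => // k IH f p /=; rewrite (negbTE (zero_lobe _ _ _ _)) IH.
Qed.

Lemma pad_evenE c : exists k, pad_even c = c ++ nseq k 0.
Proof.
rewrite /pad_even; case: c => [|a c]; first by exists 2.
case: ifP => _; first by exists 1; rewrite cats1.
by exists 0; rewrite cats0.
Qed.

Lemma pad_even_even c : ~~ odd (size (pad_even c)) /\ pad_even c != [::].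
Proof.
rewrite /pad_even; case: c => [|a c] //.
by case: ifP => [h|/negbT //]; rewrite size_rcons /= in h *; rewrite h; case: c {h}.
Qed.

Lemma sumn_pad c k : sumn (c ++ nseq k 0) = sumn c.
Proof. by rewrite sumn_cat sumn_nseq addn0. Qed.

(** By [zero_lobe] an empty lobe contains no unit triangle, so the padding required by the closed
    forms is harmless. *)
Lemma regions_pad x y z t a b :
  regionP x y z t (pad_even a) (pad_even b) = regionP x y z t a b /\
  regionQ x y z t (pad_even a) (pad_even b) = regionQ x y z t a b.
Proof.
have [k ->] := pad_evenE a; have [l ->] := pad_evenE b.
have [oa ea] := odd_even_sum_pad a k; have [ob eb] := odd_even_sum_pad b l.
split; rewrite /regionP /regionQ /hexagon_minus_lobes oa ea ob eb !sumn_pad; congr Region;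
  apply/seteqP; split => tau /=;
  by rewrite !has_cat has_left_fern_pad has_right_fern_pad.
Qed.

Local Close Scope classical_set_scope.
Local Open Scope ring_scope.

(** * The generating function of the configurations *)

Section ConfSum.

Variables (F : fieldType) (q : F).
Hypothesis q_neq0 : q != 0.
Hypothesis q_nroot : forall n, q ^+ n.+1 != 1.

Lemma sum_confs (D : halves) : wf_halves D ->
  \sum_(c <- confs D) q ^+ wt c * (qdens q (rows D true) * qdens q (rows D false))
  = \sum_(U <- ksub (ml D) (mr D - ml D) (nfree D))
      q ^+ sumn U * (vd q (crow D U true) * vd q (crow D U false)).
Proof.
move=> wf; rewrite /confs big_allpairs_dep; apply: eq_big_seq => U hU.
rewrite big_allpairs_dep /=.
have e s := sum_pats q (crow_sorted wf s hU).
rewrite -(e true) -(e false) !(crow_size _ hU).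
set qt := qdens q _; set qf := qdens q _.
set St := \sum_(p <- pats _ (crow D U true)) q ^+ sumn (map sumn p).
set Sf := \sum_(p <- pats _ (crow D U false)) _.
transitivity (St * (q ^+ sumn U * (qt * qf) * Sf)); last by ring.
rewrite mulr_suml; apply: eq_bigr => p _.
rewrite !mulr_sumr; apply: eq_bigr => p' _.
by rewrite /wt /= !exprD; ring.
Qed.

(* Each factor of the dents off the middle meets the free positions through
   the union of both halves, which is all of the outer part of the axis. *)
Lemma vd_split (L M R : nat) (A A' B B' U : seq nat) :
  perm_eq (A ++ A') (iota 0 L) -> perm_eq (B ++ B') (iota (L + M) R) ->
  vd q (A ++ U ++ B) * vd q (A' ++ U ++ B') * vd q (iota 0 L ++ iota (L + M) R)
  = vd q (A ++ B) * vd q (A' ++ B') *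
    (vd q U * vd q (iota 0 L ++ U ++ iota (L + M) R)).
Proof.
move=> pA pB; rewrite !vd_cat !cross_catr.
have eA V : cross q A V * cross q A' V = cross q (iota 0 L) V.
  by rewrite -cross_catl (cross_perml q V pA).
have eB V : cross q V B * cross q V B' = cross q V (iota (L + M) R).
  by rewrite -cross_catr (cross_permr q V pB).
by rewrite -(eA U) -(eB U); ring.
Qed.

Section Hexagon.

Variables (fl : bool) (x y z t : nat) (a b : seq nat).
Hypothesis b_even : ~~ odd (size b).

Let D := hexD fl x y z t a b.
Let L := (x + sumn a)%N.
Let R := (sumn b + t)%N.

Lemma vd_neq0 c : sorted ltn c -> vd q c != 0.
Proof.
elim: c => [|k c IH] /= sc; first exact: oner_neq0.
rewrite mulf_neq0 ?IH ?(path_sorted sc) // /cross big_seq1.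
rewrite prodf_seq_neq0; apply/allP => l lc /=.
have kl : (k < l)%N by exact: (allP (order_path_min ltn_trans sc)).
rewrite -(subnKC (ltnW kl)) exprD -[X in _ - X]mulr1 -mulrBr mulf_neq0 ?expf_neq0 //.
by rewrite subr_eq0; case: (l - k)%N (subn_gt0 k l) => [|n] => [|_]; [rewrite kl|].
Qed.

Lemma hexD_sum :
  \sum_(c <- confs D) q ^+ wt c * (qdens q (rows D true) * qdens q (rows D false))
  * vd q (iota 0 L ++ iota (L + (y + z)) R)
  = vd q (Bl D true ++ Br D true) * vd q (Bl D false ++ Br D false) * Zsum q L R y z.
Proof.
rewrite -mulr_suml sum_confs; last exact: hexD_wf.
rewrite mulr_suml /Zsum mulr_sumr /= addKn; apply: eq_bigr => U _.
have pA : perm_eq (Bl D true ++ Bl D false) (iota 0 L).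
  exact: (lblk_perm false 0 (x :: a)).
have pB : perm_eq (Br D true ++ Br D false) (iota (L + (y + z)) R).
  have := lblk_perm (true == fl) (L + (y + z)) (rcons (rev b) t).
  by rewrite -cats1 sumn_cat sumn_rev /= addn0 cats1 /D /=; case: (fl).
have := vd_split U pA pB; rewrite /crow -[(L + y + z)%N]addnA => e.
by rewrite -mulrA e; ring.
Qed.

(** [o] and [e] list the blocks of dents of the upper and the lower half, alternating with gaps.
    Dividing their factors [qH (odd_sum _)] by [qdens], taken at [odd_sum _ + y] rows, leaves the
    last quotient. *)
Lemma hexD_eqv (o e : seq nat) : odd (size o) -> odd (size e) ->
  (exists p, Bl D true ++ Br D true = lblk true p o) ->
  (exists p, Bl D false ++ Br D false = lblk true p e) ->
  eqv q (\sum_(c <- confs D) q ^+ wt c)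
   (qs q o * qs q e *
    (qH q y * qH q z * qH q (L + R + 2 * y + z) /
      (qH q (y + z) * qH q (L + R + 2 * y))) *
    (qH q (L + R + y) / qH q (L + R + y + z)) *
    (qH q (L + y) * qH q (R + y) / (qH q L * qH q R)) *
    (qH q (odd_sum e) * qH q (odd_sum o) /
      (qH q (odd_sum e + y) * qH q (odd_sum o + y)))).
Proof.
move=> oo oe [po eo] [pe ee].
have szo : rows D true = (odd_sum o + y)%N.
  by rewrite /rows /dents eo size_lblk.
have sze : rows D false = (odd_sum e + y)%N.
  by rewrite /rows /dents ee size_lblk.
have qd n : qdens q n != 0.
  by apply/prodf_neq0 => m _; apply/prodf_neq0 => k _; rewrite subr_eq0.
have vn : vd q (iota 0 L ++ iota (L + (y + z)) R) != 0.
  apply: vd_neq0; rewrite -[iota (L + (y + z)) R]cat0s.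
  by apply: sorted_blocks => //; exact: leq_addr.
have -> : \sum_(c <- confs D) q ^+ wt c =
  vd q (Bl D true ++ Br D true) * vd q (Bl D false ++ Br D false) * Zsum q L R y z /
  (qdens q (rows D true) * qdens q (rows D false) * vd q (iota 0 L ++ iota (L + (y + z)) R)).
  apply: (canRL (mulfK _)); first by rewrite !mulf_neq0.
  by rewrite -hexD_sum -!mulr_suml mulrA.
have Hn := qH_neq0 q_nroot.
rewrite eo ee szo sze; apply: eqv_trans.
  apply: (eqv_div q_neq0 q_nroot).
    apply: eqv_mul (eqv_Zsum q_neq0 q_nroot L R y z).
    by apply: eqv_mul; exact: eqv_vd_qs.
  apply: eqv_mul; first by apply: eqv_mul; exact: eqv_qdens.
  rewrite vd_cat; apply: eqv_mul (eqv_vd_block q_nroot _ _).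
  apply: eqv_mul (eqv_vd_block q_nroot _ _) _.
  exact: (eqv_cross_blocks q_nroot 0).
move: (L) (R) => l r; rewrite mul2n -addnn !addnA.
have -> : (l + y + z + r = l + r + y + z)%N by lia.
have -> : (y + z + r = r + y + z)%N by lia.
by apply: eq_eqv; field; rewrite !Hn.
Qed.

End Hexagon.

End ConfSum.

Lemma all_but_lastE (c : seq nat) : c != [::] ->
  c = rcons (all_but_last c) (last 0%N c).
Proof.
case/lastP: c => // c k _.
by rewrite /all_but_last size_rcons last_rcons -[in take _ _]cats1 take_size_cat.
Qed.

Section ClosedForms.

Variables (F : fieldType) (q : F).
Hypothesis q_neq0 : q != 0.
Hypothesis q_nroot : forall n, q ^+ n.+1 != 1.
Variables (x y z t : nat) (a b : seq nat).
Hypothesis a_even : ~~ odd (size a).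
Hypothesis b_even : ~~ odd (size b).
Hypothesis a_nnil : a != [::].
Hypothesis b_nnil : b != [::].

Lemma eqv_Phi_even :
  eqv q (\sum_(c <- confs (hexD false x y z t a b)) q ^+ wt c)
    (Phi_even q x y z t a b).
Proof.
pose a' := all_but_last a; pose al := last 0%N a.
pose b' := all_but_last b; pose bl := last 0%N b.
have ea : a = rcons a' al by exact: all_but_lastE.
have eb : b = rcons b' bl by exact: all_but_lastE.
have oa' : odd (size a') by move: a_even; rewrite ea size_rcons /= negbK.
have ob' : odd (size b') by move: b_even; rewrite eb size_rcons /= negbK.
(* The innermost lobes of both ferns point down: in the upper half they merge with the middle into a
   single gap, while in the lower half ([e]) they are blocks on either side of it. *)
pose o := a' ++ (al + y + z + bl)%N :: rev b'.
pose e := x :: a ++ (y + z)%N :: rcons (rev b) t.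
have oo : odd (size o) by rewrite size_cat /= size_rev oddD /= oa' ob'.
have oe : odd (size e).
  by rewrite /= size_cat /= size_rcons size_rev oddD /= (negbTE a_even) (negbTE b_even).
have wo : Bl (hexD false x y z t a b) true ++ Br (hexD false x y z t a b) true
    = lblk true x o.
  rewrite /= lblk_rcons //= cats0 eb rev_rcons /= {1}ea -cats1.
  rewrite !lblk_cat oa' /= !cats0 add0n; congr (_ ++ lblk _ _ _).
  by rewrite ea -cats1 sumn_cat /=; lia.
have we : Bl (hexD false x y z t a b) false ++ Br (hexD false x y z t a b) false
    = lblk true 0 e.
  by rewrite /= lblk_cat (negbTE a_even) /= -catA; congr (_ ++ (_ ++ _)).
have := hexD_eqv q_neq0 q_nroot b_even oo oe (ex_intro _ _ wo) (ex_intro _ _ we).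
have ro := rows_hexD x y z t a b_even false true.
have re := rows_hexD x y z t a b_even false false.
rewrite /rows /dents wo size_lblk /= in ro.
rewrite /rows /dents we size_lblk /= in re.
set X := _ * _ * _ * _; suff -> : X = Phi_even q x y z t a b by [].
rewrite /X {X} /Phi_even -/a' -/al -/b' -/bl -/o -/e.
have -> : (odd_sum o = odd_sum a + odd_sum b)%N by lia.
have -> : (odd_sum e = even_sum a + even_sum b + x + t)%N by lia.
by congr (_ * _ * (_ / _) * (_ / _) * (_ / _) * (_ / _));
  do ?[congr (_ * _)]; congr (qH _ _); lia.
Qed.

Lemma eqv_Psi_even :
  eqv q (\sum_(c <- confs (hexD true x y z t a b)) q ^+ wt c)
    (Psi_even q x y z t a b).
Proof.
pose a' := all_but_last a; pose al := last 0%N a.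
pose b' := all_but_last b; pose bl := last 0%N b.
have ea : a = rcons a' al by exact: all_but_lastE.
have eb : b = rcons b' bl by exact: all_but_lastE.
have oa' : odd (size a') by move: a_even; rewrite ea size_rcons /= negbK.
have ob' : odd (size b') by move: b_even; rewrite eb size_rcons /= negbK.
pose o := a' ++ (al + y + z)%N :: rcons (rev b) t.
pose e := x :: a ++ (y + z + bl)%N :: rev b'.
have oo : odd (size o).
  by rewrite size_cat /= size_rcons size_rev oddD /= oa' (negbTE b_even).
have oe : odd (size e).
  by rewrite /= size_cat /= size_rev oddD /= (negbTE a_even) ob'.
have wo : Bl (hexD true x y z t a b) true ++ Br (hexD true x y z t a b) true
    = lblk true x o.
  rewrite /= {1}ea -cats1 !lblk_cat oa' /= !cats0 add0n; congr (_ ++ lblk _ _ _).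
  by rewrite ea -cats1 sumn_cat /=; lia.
have we : Bl (hexD true x y z t a b) false ++ Br (hexD true x y z t a b) false
    = lblk true 0 e.
  rewrite /= lblk_rcons // cats0 eb rev_rcons /= lblk_cat (negbTE a_even) /= -catA.
  by congr (_ ++ (_ ++ lblk _ _ _)); lia.
have := hexD_eqv q_neq0 q_nroot b_even oo oe (ex_intro _ _ wo) (ex_intro _ _ we).
have ro := rows_hexD x y z t a b_even true true.
have re := rows_hexD x y z t a b_even true false.
rewrite /rows /dents wo size_lblk /= in ro.
rewrite /rows /dents we size_lblk /= in re.
set X := _ * _ * _ * _; suff -> : X = Psi_even q x y z t a b by [].
rewrite /X {X} /Psi_even -/a' -/al -/b' -/bl -/o -/e.
have -> : (odd_sum o = odd_sum a + even_sum b + t)%N by lia.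
have -> : (odd_sum e = even_sum a + odd_sum b + x)%N by lia.
by congr (_ * _ * (_ / _) * (_ / _) * (_ / _) * (_ / _));
  do ?[congr (_ * _)]; congr (qH _ _); lia.
Qed.

Lemma qs_neq0 c : qs q c != 0.
Proof.
have Hn := qH_neq0 q_nroot.
rewrite /qs !mulf_neq0 ?invr_neq0 //; apply/prodf_neq0 => i _;
  by apply/prodf_neq0 => j _.
Qed.

Ltac nonzero := repeat first [exact: qs_neq0 | exact: (qH_neq0 q_nroot) |
  apply: mulf_neq0 | apply: invr_neq0].

Lemma Phi_even_neq0 : Phi_even q x y z t a b != 0.
Proof. by rewrite /Phi_even; nonzero. Qed.

Lemma Psi_even_neq0 : Psi_even q x y z t a b != 0.
Proof. by rewrite /Psi_even; nonzero. Qed.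

End ClosedForms.

(** * Removing the ambiguity of powers of q and q - 1 *)

Section Normalisation.

Local Notation frac := {fraction {poly int}}.

Lemma qvar_neq0 : qvar != 0.
Proof. by rewrite tofrac_eq0 polyX_eq0. Qed.

Lemma qvar_nroot n : qvar ^+ n.+1 != 1.
Proof.
rewrite /qvar -tofracXn -tofrac1 tofrac_eq; apply/eqP => /(congr1 (fun p : {poly int} => size p)).
by rewrite size_polyXn size_poly1.
Qed.

(* A quotient of polynomials with value 1 at 0, and without zero or pole at 1:
   such a fraction is determined by its class modulo powers of q and q - 1. *)
Definition normalised (v : frac) : Prop :=
  exists A B : {poly int}, [/\ A.[0] = 1, B.[0] = 1, A.[1] != 0, B.[1] != 0 &
    v = tofrac A / tofrac B].

Lemma tofrac_horner_neq0 (A : {poly int}) (c : int) : A.[c] != 0 -> tofrac A != 0.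
Proof. by rewrite tofrac_eq0; apply: contraNneq => ->; rewrite horner0. Qed.

Lemma normalised1 : normalised 1.
Proof. by exists 1, 1; rewrite !hornerC tofrac1 divr1; split. Qed.

Lemma normalisedM u v : normalised u -> normalised v -> normalised (u * v).
Proof.
case=> A [B [a0 b0 a1 b1 ->]] [A' [B' [a0' b0' a1' b1' ->]]].
exists (A * A'), (B * B'); rewrite !hornerM a0 b0 a0' b0' !mulf_neq0 //.
by split => //; rewrite mulf_div !tofracM.
Qed.

Lemma normalisedV u : normalised u -> normalised u^-1.
Proof.
case=> A [B [a0 b0 a1 b1 ->]]; exists B, A; split => //.
by rewrite invfM invrK mulrC.
Qed.

Lemma normalised_prod (I : Type) (r : seq I) (P : pred I) (G : I -> frac) :
  (forall i, normalised (G i)) -> normalised (\prod_(i <- r | P i) G i).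
Proof.
move=> h; apply: (big_ind normalised) => //; first exact: normalised1.
exact: normalisedM.
Qed.

Lemma normalised_qint n : normalised (qint qvar n.+1).
Proof.
have e (c : int) : (\sum_(i < n.+1) 'X^i : {poly int}).[c] = \sum_(i < n.+1) c ^+ i.
  by rewrite horner_sum; apply: eq_bigr => i _; rewrite hornerXn.
exists (\sum_(i < n.+1) 'X^i), 1; rewrite !e !hornerC; split => //.
- by rewrite big_ord_recl expr0 big1 ?addr0 // => i _; rewrite exprS mul0r.
- under eq_bigr => i _ do rewrite expr1n.
  by rewrite sumr_const card_ord pnatr_eq0.
- rewrite tofrac1 divr1 rmorph_sum /qint; apply: eq_bigr => i _.
  by rewrite /qvar -tofracXn.
Qed.

Lemma normalised_qH n : normalised (qH qvar n).
Proof.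
by do 2![apply: normalised_prod => ?]; exact: normalised_qint.
Qed.

Lemma normalised_qs c : normalised (qs qvar c).
Proof.
rewrite /qs; apply: normalisedM; first exact/normalisedV/normalised_qH.
apply: normalisedM; last apply: normalisedV;
  by do 2![apply: normalised_prod => ?]; exact: normalised_qH.
Qed.

Ltac normalise := repeat first [exact: normalised_qH | exact: normalised_qs |
  apply: normalisedM | apply: normalisedV].

Lemma normalised_Phi x y z t a b : normalised (Phi_even qvar x y z t a b).
Proof. by rewrite /Phi_even; normalise. Qed.

Lemma normalised_Psi x y z t a b : normalised (Psi_even qvar x y z t a b).
Proof. by rewrite /Psi_even; normalise. Qed.

(** Both exponents are the order of vanishing at [c] of the same polynomial. *)
Lemma cancel_root (R : idomainType) (c : R) (G H : {poly R}) (m n : nat) :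
  G.[c] != 0 -> H.[c] != 0 ->
  ('X - c%:P) ^+ m * G = ('X - c%:P) ^+ n * H -> m = n /\ G = H.
Proof.
wlog mn : m n G H / (m <= n)%N.
  move=> wl g h e; case/orP: (leq_total m n) => mn; first exact: wl.
  by have [-> ->] := wl n m H G mn h g (esym e).
move=> g h; rewrite -(subnKC mn) exprD -mulrA.
have nz : ('X - c%:P) ^+ m != 0 by rewrite expf_neq0 ?polyXsubC_eq0.
move/(mulfI nz) => e; case: (n - m)%N e => [|k] e.
  by rewrite e expr0 mul1r addn0.
by move: g; rewrite e hornerM horner_exp hornerXsubC subrr exprS mul0r mul0r eqxx.
Qed.

(** Clearing denominators gives an identity of polynomials; the factors other than the powers vanish
    neither at 1 nor at 0, so [cancel_root] removes first the powers of ['X - 1] and then those of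
    ['X]. *)
Lemma normalised_eqv (P : {poly int}) (v : frac) : P.[0] != 0 -> P.[1] != 0 ->
  normalised v -> eqv qvar (tofrac P) v -> tofrac P = v.
Proof.
move=> p0 p1 [A [B [a0 b0 a1 b1 ->]]] [a [b [c [d e]]]].
have B0 := tofrac_horner_neq0 b1.
suff -> : A = P * B by rewrite tofracM mulfK.
have : 'X ^+ a * ('X - 1%:P) ^+ b * (P * B) = 'X ^+ c * ('X - 1%:P) ^+ d * A
    :> {poly int}.
  apply/eqP; rewrite -tofrac_eq !tofracM !tofracXn tofracB -/qvar.
  by rewrite -[1%:P]/(1 : {poly int}) tofrac1 mulrA e -!mulrA mulVf // mulr1; apply/eqP.
have swap (A1 A2 A3 : {poly int}) : A1 * A2 * A3 = A2 * (A1 * A3) by rewrite mulrAC mulrC.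
rewrite 2!swap => /(cancel_root (c := 1)).
have n1 (G : {poly int}) k : G.[1] != 0 -> ('X ^+ k * G).[1] != 0.
  by move=> g; rewrite hornerM hornerXn expr1n mul1r.
case; rewrite ?n1 ?hornerM ?mulf_neq0 // => _.
rewrite -['X]subr0 => /(cancel_root (c := 0)).
by rewrite hornerM b0 a0 mulr1; case.
Qed.

End Normalisation.

Lemma stacks_sum_eqv (D : halves) (x : nat) (v : {fraction {poly int}}) :
  wf_halves D -> v != 0 -> normalised v ->
  eqv qvar (\sum_(c <- confs D) qvar ^+ wt c) v ->
  \sum_(pi \in monotone_stacks (Region (RD D x) (top_corner D x)))
     qvar ^+ volume pi = v.
Proof.
move=> wf v0 nv ev.
(* This is the existence of a tiling: an empty sum is 0 and cannot be equivalent to the non-zero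
   [v]. *)
have ne : confs D != [::].
  apply: contraNneq v0 => e; move: ev; rewrite e big_nil => -[a [b [c [d /esym/eqP]]]].
  rewrite mulr0 !mulf_eq0 !expf_eq0 (negbTE qvar_neq0) (negbTE (q1_neq0 qvar_nroot)).
  by rewrite !andbF.
have [w ew] := wt_cvol x wf ne; have [c0 cc0 e0] := cvol_lowest x wf ne.
rewrite stacks_sum //.
pose P : {poly int} := \sum_(c <- confs D) 'X^(cvol D x c).
have eP : \sum_(c <- confs D) qvar ^+ cvol D x c = tofrac P.
  by rewrite rmorph_sum; apply: eq_bigr => c _; rewrite /= tofracXn.
have hP (k : int) : P.[k] = \sum_(c <- confs D) k ^+ cvol D x c.
  by rewrite horner_sum; apply: eq_bigr => c _; rewrite hornerXn.
rewrite eP; apply: normalised_eqv => //.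
(* The constant term counts the stacks of volume 0, and the lowest tiling provides one. *)
- rewrite hP (big_rem _ cc0) /= e0 expr0 gt_eqF // ltr_wpDr ?ltr01 //.
  by apply: sumr_ge0 => c _; rewrite exprn_ge0.
- rewrite hP; under eq_bigr => c _ do rewrite expr1n.
  by rewrite big_const_seq count_predT iter_addr_0 pnatr_eq0 size_eq0.
apply: eqv_trans ev; rewrite -eP.
exists w, 0%N, 0%N, 0%N; rewrite !expr0 !mulr1 mul1r mulr_sumr.
by apply: eq_big_seq => c /ew ->; rewrite exprD.
Qed.

Theorem theorem5p2 (m n x y z t : nat) (a : m.-tuple nat) (b : n.-tuple nat) :
  \sum_(pi \in monotone_stacks (regionP x y z t a b)) qvar ^+ volume pi
    = Phi qvar x y z t a b /\
  \sum_(pi \in monotone_stacks (regionQ x y z t a b)) qvar ^+ volume pi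
    = Psi qvar x y z t a b.
Proof.
have [<- <-] := regions_pad x y z t a b; rewrite /Phi /Psi.
have [ae an] := pad_even_even a; have [be bn] := pad_even_even b.
rewrite regionPE // regionQE //; split; apply: stacks_sum_eqv.
- exact: hexD_wf.
- exact: (Phi_even_neq0 qvar_nroot).
- exact: normalised_Phi.
- exact: (eqv_Phi_even qvar_neq0 qvar_nroot).
- exact: hexD_wf.
- exact: (Psi_even_neq0 qvar_nroot).
- exact: normalised_Psi.
- exact: (eqv_Psi_even qvar_neq0 qvar_nroot).
Qed.
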